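(* Let $\sigma\in\mathbb{C}$, let $\theta_{2n+1}\in\mathbb{C}$ ($n\ge 0$, finitely many nonzero), put $\theta(\lambda)=\sum_{n\ge 0}\theta_{2n+1}\lambda^n$, and let $X=\sum_{n\ge 0}\theta_{2n+1}\partial_{2n+1}+\sigma\sum_{n\ge 0}(n+\tfrac12)t_{2n+1}\partial_{2n+1}$. The points $(V,W)$ in the Sato periodic flag manifold $\mathrm{Fl}^{(2)}$ corresponding to solutions $v$ of the modified KdV hierarchy that are self-similar under $X$, i.e. $(X+\tfrac{\sigma}{2})v=0$, are given by $$V=\mathbb{C}\{\lambda^{-1}\varphi,\ \lambda^{2n+1}\varphi,\ \lambda^{2n+1}\tilde\varphi\}_{n\ge 0},\qquad W=\mathbb{C}\{\lambda^{2n}\varphi,\ \lambda^{2n}\tilde\varphi\}_{n\ge 0},$$ where $\varphi$ and $\tilde\varphi$ are the solutions of $$\Big\{\frac{\sigma}{2}\Big(\lambda\frac{d}{d\lambda}-\frac12(1+H)\Big)-\lambda\theta(\lambda^2)+\sum_{n\ge 0}\theta_{2n+1}\,\ell_{2n+1}^{\,t}\big|_{\mathbf{t}=0}(\lambda^2)\Big\}\begin{pmatrix}\varphi\\ \tilde\varphi\end{pmatrix}=0$$ having the asymptotic expansion $$\begin{pmatrix}\varphi\\ \tilde\varphi\end{pmatrix}\sim\begin{pmatrix}\lambda+\varphi_{20}+\varphi_{11}\lambda^{-1}+\varphi_{21}\lambda^{-2}+\cdots\\ 1+\tilde\varphi_{11}\lambda^{-1}+\tilde\varphi_{21}\lambda^{-2}+\cdots\end{pmatrix},\qquad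 \lambda\to\infty.$$ Here $H=\mathrm{diag}(1,-1)$, the superscript $t$ denotes transpose, and $\ell_{2n+1}$ is the matrix associated with $v$ defined in the context.
   Context: Functions depend on infinitely many complex variables $\mathbf{t}=\{t_{2n+1}\}_{n\ge 0}$ and are regular at $\mathbf{t}=0$; $\partial_{2n+1}:=\partial/\partial t_{2n+1}$, $d=\sum_{n\ge 0} dt_{2n+1}\partial_{2n+1}$. The Gel'fand--Dickii potentials $R_n[u]$ are the differential polynomials in $u$ (with respect to $\partial_1$) determined by $R_0=\tfrac12$, $\partial_1R_{n+1}=\big(\tfrac14\partial_1^3+u\partial_1+\tfrac12(\partial_1u)\big)R_n$ and $R_{n+1}[0]=0$ (so $R_1=u/4$). With $u=\partial_1v-v^2$, the modified KdV hierarchy is $\partial_{2n+1}v=\partial_1(\partial_1+2v)R_n[u]$, $n\ge 0$. With $\rho_n(\lambda):=2\sum_{m=0}^n\lambda^mR_{n-m}[u]$, $$\ell_{2n+1}(\lambda)=\begin{pmatrix}-(\partial_1+2v)\rho_n/2&\rho_n\\ \lambda\rho_n-\partial_1(\partial_1+2v)(\rho_n/2-R_n)&(\partial_1+2v)\rho_n/2\end{pmatrix}.$$ Periodic flag manifold (Sato setting). Let $\mathcal{H}$ be the space of formal series in $\lambda$ with complex coefficients and finitely many positive powers of $\lambda$. $\mathrm{Fl}^{(2)}$ is the set of pairs $(V,W)$ of subspaces of $\mathcal{H}$ in the Sato Grassmannian with $\lambda^2W\subset\lambda V\subset W$. Let $N^-SL(2,\mathbb{C})$ be the formal group of matrices with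 entries in $\mathbb{C}[[\lambda^{-1}]]$, determinant $1$, whose value at $\lambda=\infty$ is lower triangular with $1$'s on the diagonal. For $g\in N^-SL(2,\mathbb{C})$ with columns $\Phi=(\varphi_1,\varphi_2)^t$, $\tilde\Phi=(\tilde\varphi_1,\tilde\varphi_2)^t$, put $\varphi=T\Phi$, $\tilde\varphi=T\tilde\Phi$, where $(T\Phi)(\lambda)=\lambda\varphi_1(\lambda^2)+\varphi_2(\lambda^2)$; the point of $\mathrm{Fl}^{(2)}$ attached to $g$ (equivalently, to its coset modulo loops in $SL(2,\mathbb{C})$ with nonnegative powers of $\lambda$ and upper triangular value at $\lambda=0$) is the pair $(V,W)$ given by the spans displayed in the claim. Correspondence with solutions. With $E,H,F$ the standard basis of $\mathfrak{sl}(2,\mathbb{C})$ and $J(\lambda)=\lambda F+E$, let $P_\pm$ be the projections for the splitting of the formal loop algebra of $\mathfrak{sl}(2,\mathbb{C})$-valued series with finitely many positive powers of $\lambda$ into $B^+$ (nonnegative powers of $\lambda$, upper triangular value at $\lambda=0$) and $N^-$ (nonpositive powers, value at $\infty$ strictly lower triangular). To $g\in N^-SL(2,\mathbb{C})$ associate $\psi_-(\mathbf{t},\lambda)\in N^-SL(2,\mathbb{C})$ with $\psi_-|_{\mathbf{t}=0}=g^{-1}$ and $d\psi_-\cdot\psi_-^{-1}=-P_-\mathrm{Ad}\,\psi_-\big(\sum_{n\ge 0}\lambda^nJ\,dt_{2n+1}\big)$; formally $\exp(\sum_n t_{2n+1}\lambda^nJ)g=\psi_-^{-1}\psi_+$.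 Then $P_+\mathrm{Ad}\,\psi_-(J)=\begin{pmatrix}-v&1\\ \lambda&v\end{pmatrix}$ defines a solution $v$ of the modified KdV hierarchy, and $P_+\mathrm{Ad}\,\psi_-(\lambda^nJ)=\ell_{2n+1}$. The solution $v$ is unchanged under $g\mapsto\gamma g$ with $\gamma\in\Gamma_-$, the abelian group with Lie algebra spanned by $\lambda^nJ$, $n<0$, so the point corresponding to $v$ is understood modulo the left action of $\Gamma_-$.
   Formalization: When σ=0, that self-similar v are given in this way is claimed only if the system has a solution with the stated expansion (it has none for θ(λ)=1, v a nonzero constant); uniqueness of the pair of solutions is claimed only for σ≠0. *)

(* Defs.v *)
From HB Require Import structures.
From mathcomp Require Import all_boot all_order all_algebra.
From mathcomp Require Import boolp classical_sets functions cardinality fsbigop.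
From mathcomp Require Import finmap.
From mathcomp.multinomials Require mpoly.

Set Implicit Arguments.
Unset Strict Implicit.
Unset Printing Implicit Defensive.

Import Order.TTheory GRing.Theory Num.Theory.

Local Open Scope classical_set_scope.
Local Open Scope ring_scope.

(* Generalized power series: functions M -> A on an additive monoid M of
   exponents whose support belongs to a family of "small" sets for which the
   Cauchy product is a finite sum. The two instances used below are C[[t]] in
   infinitely many variables and Laurent series with finitely many positive
   powers. *)

Record supports (M : nmodType) := Supports {
  small :> set M -> Prop;
  small_sub : forall U V : set M, U `<=` V -> small V -> small U;
  small_setU : forall U V : set M, small U -> small V -> small (U `|` V);
  small_set1 : forall m : M, small [set m];
  small_sum : forall U V : set M, small U -> small V ->
    small [set p.1 + p.2 | p in U `*` V];
  small_fin : forall U V : set M, small U -> small V -> forall m : M,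
    finite_set [set p : M * M | (U p.1 /\ V p.2) /\ p.1 + p.2 = m] }.

Definition gsupp (M : nmodType) (A : nmodType) (f : M -> A) : set M :=
  [set m | f m != 0].

Record gser (M : nmodType) (S : supports M) (A : nmodType) := GSer {
  gcoef :> M -> A;
  gcoef_small : S (gsupp gcoef) }.

Definition conv (M : nmodType) (A : pzSemiRingType) (f g : M -> A) (m : M) : A :=
  \sum_(p \in [set p : M * M | p.1 + p.2 = m]) (f p.1 * g p.2).

Section GSerZmod.
Context (M : nmodType) (S : supports M) (A : zmodType).
Implicit Types f g h : gser S A.

HB.instance Definition _ := gen_eqMixin (gser S A).
HB.instance Definition _ := gen_choiceMixin (gser S A).

Lemma gserP f g : (forall m, f m = g m) -> f = g.
Proof.
case: f g => [f fS] [g gS] /= /funext fg; move: fS gS; rewrite fg => fS gS.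
by congr GSer; exact: Prop_irrelevance.
Qed.

Lemma small_set0 : S set0.
Proof. exact: small_sub (@sub0set _ _) (small_set1 S 0). Qed.

Lemma gsupp_out (f : M -> A) m : ~ gsupp f m -> f m = 0.
Proof. by move=> /negP; rewrite negbK => /eqP. Qed.

Fact gzero_small : S (gsupp (fun _ : M => 0 : A)).
Proof. by apply: small_sub small_set0 => m; rewrite /gsupp /= eqxx. Qed.
Definition gzero := GSer gzero_small.

Fact gopp_small f : S (gsupp (fun m => - f m)).
Proof. by apply: small_sub (gcoef_small f) => m; rewrite /gsupp /= oppr_eq0. Qed.
Definition gopp f := GSer (gopp_small f).

Fact gadd_small f g : S (gsupp (fun m => f m + g m)).
Proof.
apply: small_sub (small_setU (gcoef_small f) (gcoef_small g)) => m.
rewrite /gsupp /=; case: (eqVneq (f m) 0) => [->|]; last by left.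
by rewrite add0r; right.
Qed.
Definition gadd f g := GSer (gadd_small f g).

Fact gaddA : associative gadd.
Proof. by move=> f g h; apply: gserP => m /=; rewrite addrA. Qed.
Fact gaddC : commutative gadd.
Proof. by move=> f g; apply: gserP => m /=; rewrite addrC. Qed.
Fact gadd0 : left_id gzero gadd.
Proof. by move=> f; apply: gserP => m /=; rewrite add0r. Qed.
Fact gaddN : left_inverse gzero gopp gadd.
Proof. by move=> f; apply: gserP => m /=; rewrite addNr. Qed.

HB.instance Definition _ :=
  GRing.isZmodule.Build (gser S A) gaddA gaddC gadd0 gaddN.

Lemma gcoefD f g m : (f + g) m = f m + g m. Proof. by []. Qed.
Lemma gcoefN f m : (- f) m = - f m. Proof. by []. Qed.
Lemma gcoef0 m : (0 : gser S A) m = 0. Proof. by []. Qed.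

Fact gmon_small (a : A) (m : M) : S (gsupp (fun k => if k == m then a else 0)).
Proof.
apply: small_sub (small_set1 S m) => k; rewrite /gsupp /=.
by have [->|_] := eqVneq k m; rewrite ?eqxx.
Qed.
Definition gmonom (a : A) (m : M) : gser S A := GSer (gmon_small a m).

Fact grestrict_small (P : pred M) f : S (gsupp (fun k => if P k then f k else 0)).
Proof.
apply: small_sub (gcoef_small f) => k; rewrite /gsupp /=.
by case: (P k); rewrite ?eqxx.
Qed.
Definition grestrict (P : pred M) f : gser S A := GSer (grestrict_small P f).

End GSerZmod.

Section GSerMap.
Context (M : nmodType) (S : supports M) (A B : zmodType) (h : {additive A -> B}).

Fact gmap_small (f : gser S A) : S (gsupp (fun m => h (f m))).
Proof.
apply: small_sub (gcoef_small f) => m; rewrite /gsupp /=.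
by apply: contra_neq => ->; rewrite raddf0.
Qed.
Definition gmap (f : gser S A) : gser S B := GSer (gmap_small f).

End GSerMap.

Section GSerRing.
Context (M : nmodType) (S : supports M) (A : comNzRingType).
Implicit Types f g h : gser S A.

Lemma conv_fset (U V : set M) (f g : M -> A) m : S U -> S V ->
  gsupp f `<=` U -> gsupp g `<=` V ->
  conv f g m = \sum_(p <- fset_set [set p : M * M | (U p.1 /\ V p.2) /\ p.1 + p.2 = m])
                 (f p.1 * g p.2).
Proof.
move=> SU SV fU gV; rewrite /conv.
have fin := small_fin SU SV m; rewrite -(fsbig_finite _ _ fin).
apply/esym/fsbig_widen => [p [] //|p [/= pm /not_andP[]//]].
move=> /not_andP[nU|nV].
  by rewrite /= (gsupp_out (f := f)) ?mul0r// => /fU.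
by rewrite /= (gsupp_out (f := g)) ?mulr0// => /gV.
Qed.

Fact conv_small f g : S (gsupp (conv f g)).
Proof.
apply: small_sub (small_sum (gcoef_small f) (gcoef_small g)) => m.
apply: contra_neqP => nm; rewrite /conv fsbig1// => p pm.
have [fp|/gsupp_out->] := pselect (gsupp f p.1); last by rewrite mul0r.
have [gp|/gsupp_out->] := pselect (gsupp g p.2); last by rewrite mulr0.
by exfalso; apply: nm; exists p.
Qed.
Definition gmul f g := GSer (conv_small f g).

Fact gmulC : commutative gmul.
Proof.
move=> f g; apply: gserP => m /=; rewrite /conv.
rewrite (reindex_fsbig (fun p : M * M => (p.2, p.1)) [set p | p.1 + p.2 = m]) /=.
  by apply: eq_fsbigr => p _; rewrite mulrC.
split=> [[a b]/=|[a b] [c d] _ _ /= [-> ->]//|[a b]/= abm].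
  by rewrite addrC.
by exists (b, a) => //=; rewrite addrC.
Qed.

Definition gone : gser S A := gmonom S 1 0.

Fact gmul1 : left_id gone gmul.
Proof.
move=> f; apply: gserP => m /=; rewrite /conv.
rewrite -(fsbig_widen [set (0, m)]).
- by rewrite fsbig_set1 /= eqxx mul1r.
- by move=> _ -> /=; rewrite add0r.
- move=> [a b] [/= abm abn]; case: eqP => [a0|]; last by rewrite mul0r.
  by exfalso; apply: abn; rewrite /= -abm a0 add0r.
Qed.

Fact gmulDl : left_distributive gmul +%R.
Proof.
move=> f g h; apply: gserP => m; rewrite gcoefD /=.
have SU := small_setU (gcoef_small f) (gcoef_small g).
have suppD : gsupp (fun k => f k + g k) `<=` gsupp f `|` gsupp g.
  move=> k; apply: contraPP => /not_orP[/gsupp_out f0 /gsupp_out g0].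
  by rewrite /gsupp /= f0 g0 addr0 eqxx.
rewrite (conv_fset m SU (gcoef_small h) suppD)//.
rewrite (conv_fset m SU (gcoef_small h) (@subsetUl _ _ _))//.
rewrite (conv_fset m SU (gcoef_small h) (@subsetUr _ _ _))//.
by rewrite -big_split; apply: eq_bigr => p _; rewrite mulrDl.
Qed.

Let triples f g h m : seq (M * M * M) :=
  [seq (q, p.2) |
    p <- fset_set [set p : M * M |
           ([set r.1 + r.2 | r in gsupp f `*` gsupp g] p.1 /\ gsupp h p.2)
           /\ p.1 + p.2 = m],
    q <- fset_set [set q : M * M | (gsupp f q.1 /\ gsupp g q.2) /\ q.1 + q.2 = p.1]].

Let triples_uniq f g h m : uniq (triples f g h m).
Proof.
apply: allpairs_uniq_dep; [exact: fset_uniq|by move=> p _; exact: fset_uniq|].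
move=> [p q] [p' q'] /allpairsPdep[p1 [q1 [p1in q1in]]] [-> ->].
move=> /allpairsPdep[p2 [q2 [p2in q2in]]] [-> ->] /= [qq pp].
have fin s := small_fin (gcoef_small f) (gcoef_small g) s.
move: q1in q2in; rewrite !in_fset_set; try exact: fin.
move=> /set_mem[_ e1] /set_mem[_ e2].
case: p1 p2 pp e1 e2 {p1in p2in} => [a b] [c d] /= -> <- <-.
by rewrite qq.
Qed.

Let mem_triples f g h m x : x \in triples f g h m <->
  [/\ gsupp f x.1.1, gsupp g x.1.2, gsupp h x.2 & x.1.1 + x.1.2 + x.2 = m].
Proof.
have fin1 := small_fin (small_sum (gcoef_small f) (gcoef_small g)) (gcoef_small h) m.
have fin2 s := small_fin (gcoef_small f) (gcoef_small g) s.
split=> [/allpairsPdep[p [q [pin qin ->]]] /=|].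
  move: pin qin; rewrite !in_fset_set; try exact: fin1; try exact: fin2.
  move=> /set_mem[[_ hp] pm] /set_mem[[fq gq] qp].
  by split=> //; rewrite qp.
case: x => [[a b] c] /= [fa gb hc abc].
apply/allpairsPdep; exists (a + b, c), (a, b); split=> //.
  rewrite in_fset_set; try exact: fin1.
  by apply/mem_set; split=> //; split=> //; exists (a, b).
by rewrite in_fset_set; [exact/mem_set|exact: fin2].
Qed.

Let gmul_triples f g h m : gmul (gmul f g) h m =
  \sum_(x <- triples f g h m) (f x.1.1 * g x.1.2 * h x.2).
Proof.
rewrite /= (conv_fset (f := gmul f g) m (small_sum (gcoef_small f) (gcoef_small g)) (gcoef_small h)) //.
  rewrite /triples big_allpairs_dep; apply: eq_bigr => p _ /=.
  by rewrite (conv_fset p.1 (gcoef_small f) (gcoef_small g))// mulr_suml.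
move=> k; apply: contraPP => nk; rewrite /gsupp /= /conv fsbig1 ?eqxx// => p pm.
have [fp|/gsupp_out->] := pselect (gsupp f p.1); last by rewrite mul0r.
have [gp|/gsupp_out->] := pselect (gsupp g p.2); last by rewrite mulr0.
by exfalso; apply: nk; exists p.
Qed.

Fact gmulA : associative gmul.
Proof.
move=> f g h; rewrite (gmulC f); apply: gserP => m.
rewrite !gmul_triples.
rewrite (perm_big [seq ((x.1.2, x.2), x.1.1) | x <- triples f g h m]).
  by rewrite big_map; apply: eq_bigr => x _ /=; rewrite mulrC mulrA.
apply: uniq_perm => //.
  rewrite map_inj_uniq// => -[[a b] c] [[a' b'] c'] /= [-> -> ->] //.
move=> [[b c] a]; apply/idP/mapP => [/mem_triples[/= gb hc fa bca]|].
  exists ((a, b), c) => //; apply/mem_triples; split=> //=.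
  by rewrite -addrA addrC.
move=> [[[a' b'] c'] /mem_triples[/= fa gb hc abc] [-> -> ->]].
by apply/mem_triples; split=> //=; rewrite addrC addrA.
Qed.

Fact gone_neq0 : gone != 0.
Proof.
apply/eqP => /(congr1 (fun f : gser S A => f 0)) /=; rewrite eqxx.
by apply/eqP; exact: oner_neq0.
Qed.

HB.instance Definition _ := GRing.Zmodule_isComNzRing.Build (gser S A)
  gmulA gmulC gmul1 gmulDl gone_neq0.

Fact gscale_small (a : A) f : S (gsupp (fun m => a * f m)).
Proof.
apply: small_sub (gcoef_small f) => m; rewrite /gsupp /=.
by apply: contra_neq => ->; rewrite mulr0.
Qed.
Definition gscale a f := GSer (gscale_small a f).

Fact gscaleA a b f : gscale a (gscale b f) = gscale (a * b) f.
Proof. by apply: gserP => m /=; rewrite mulrA. Qed.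
Fact gscale1 : left_id 1 gscale.
Proof. by move=> f; apply: gserP => m /=; rewrite mul1r. Qed.
Fact gscaleDr : right_distributive gscale +%R.
Proof. by move=> a f g; apply: gserP => m /=; rewrite mulrDr. Qed.
Fact gscaleDl f : {morph gscale^~ f : a b / a + b}.
Proof. by move=> a b; apply: gserP => m /=; rewrite mulrDl. Qed.

HB.instance Definition _ := GRing.Zmodule_isLmodule.Build A (gser S A)
  gscaleA gscale1 gscaleDr gscaleDl.

Fact gscaleAl a f g : a *: (f * g) = a *: f * g.
Proof.
apply: gserP => m; rewrite /= (conv_fset m (gcoef_small f) (gcoef_small g))//.
rewrite (conv_fset (f := gscale a f) m (gcoef_small f) (gcoef_small g))//.
  by rewrite mulr_sumr; apply: eq_bigr => p _; rewrite /= mulrA.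
by move=> k; rewrite /gsupp /=; apply: contra_neq => ->; rewrite mulr0.
Qed.

HB.instance Definition _ := GRing.Lmodule_isLalgebra.Build A (gser S A) gscaleAl.
HB.instance Definition _ := GRing.Lalgebra_isComAlgebra.Build A (gser S A).

Lemma gcoefM f g m : (f * g) m = conv f g m. Proof. by []. Qed.
Lemma gcoefZ a f m : (a *: f) m = a * f m. Proof. by []. Qed.
Lemma gcoef1 m : (1 : gser S A) m = (if m == 0 then 1 else 0). Proof. by []. Qed.

End GSerRing.

(* {poly nat} encodes the finitely supported exponents m : nat -> nat, so that
   the monomial of exponent m is \prod_n t_{2n+1} ^+ m`_n. *)
Section TSupports.
Implicit Types m : {poly nat}.

Lemma tsupp_fin m : finite_set [set p : {poly nat} * {poly nat} | p.1 + p.2 = m].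
Proof.
pose B := (\sum_(i < size m) (m`_i)%R)%N.
pose P (f : {ffun 'I_(size m) -> 'I_B.+1}) : {poly nat} :=
  \poly_(i < size m) (if insub i is Some j then nat_of_ord (f j) else 0%N).
have below (a : {poly nat}) : (forall i, (a`_i)%R <= (m`_i)%R)%N -> range P a.
  move=> am; exists [ffun j : 'I_(size m) => inord (a`_j)%R] => //.
  apply/polyP => i; rewrite coef_poly; case: ltnP => im; last first.
    by move: (am i); rewrite (nth_default _ im) leqn0 => /eqP ->.
  rewrite insubT ffunE inordK //= ltnS (leq_trans (am i))//.
  by rewrite /B (bigD1 (Ordinal im)) //= leq_addr.
apply: (@sub_finite_set _ _ (range P `*` range P)); last first.
  by apply: finite_setX; apply: finite_image; exact: finite_finset.
move=> [a b] /= abm; split; apply: below => i; rewrite -abm coefD.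
  exact: leq_addr.
exact: leq_addl.
Qed.

Definition tsupports : supports {poly nat}.
Proof.
apply: (@Supports _ (fun _ => True)) => // U V _ _ m.
by apply: sub_finite_set (tsupp_fin m) => p [].
Defined.

End TSupports.

Lemma lsupp_fin (N N' m : int) :
  finite_set [set p : int * int | (p.1 <= N /\ p.2 <= N') /\ p.1 + p.2 = m].
Proof.
pose F (j : nat) : int * int := (N - j%:Z, m - N + j%:Z).
have fin : finite_set [set F j | j in `I_(`|(N + N' - m)%R|%N.+1)].
  by apply: finite_image; exact: finite_II.
apply: sub_finite_set fin => -[a b] /= [[aN bN] abm].
have aN' : 0 <= N - a by rewrite subr_ge0.
have bN' : 0 <= N' - b by rewrite subr_ge0.
have -> : N + N' - m = (N - a) + (N' - b) by rewrite -abm opprD addrACA.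
exists `|(N - a)%R|%N => /=.
  by rewrite ltnS -lez_nat (gez0_abs aN') (gez0_abs (addr_ge0 aN' bN')) lerDl.
rewrite /F gez0_abs// -abm; congr pair.
  by rewrite opprB addrCA subrr addr0.
by rewrite [a + b]addrC addrA subrK addrK.
Qed.

(* Supports bounded above: finitely many positive powers. *)
Definition lsupports : supports int.
Proof.
apply: (@Supports _ (fun U : set int => exists N : int, forall k, U k -> k <= N)).
- by move=> U V UV [N VN]; exists N => k /UV; exact: VN.
- move=> U V [N UN] [N' VN]; exists (Num.max N N') => k.
  by rewrite le_max => -[/UN ->//|/VN ->]; rewrite orbT.
- by move=> m; exists m => k ->.
- move=> U V [N UN] [N' VN]; exists (N + N') => k [[a b] [/= Ua Vb] <-].
  by apply: lerD; [exact: UN|exact: VN].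
- move=> U V [N UN] [N' VN] m.
  apply: sub_finite_set (lsupp_fin N N' m) => p [[Up Vp] pm].
  by split=> //; split; [exact: UN|exact: VN].
Defined.

Notation tser A := (gser tsupports A).
Notation laurent A := (gser lsupports A).

Section TSeries.
Context (C : fieldType).
Implicit Types (f u v : tser C) (n : nat).

(* pd n is the derivation d/dt_{2n+1}. *)
Definition pd n f : tser C :=
  @GSer _ tsupports _ (fun m => f (m + 'X^n) *+ (m`_n)%R.+1) I.

Fact pd_is_additive n : zmod_morphism (pd n).
Proof. by move=> f g; apply: gserP => m /=; rewrite mulrnBl. Qed.
HB.instance Definition _ n :=
  GRing.isZmodMorphism.Build (tser C) (tser C) (pd n) (pd_is_additive n).

Definition ev0 f : C := f 0.

Fact ev0_is_additive : zmod_morphism ev0.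
Proof. by []. Qed.
HB.instance Definition _ :=
  GRing.isZmodMorphism.Build (tser C) C ev0 ev0_is_additive.

(* tvar n is the variable t_{2n+1}. *)
Definition tvar n : tser C := gmonom tsupports 1 'X^n.

(* The sum over n is infinite, but at each exponent only finitely many terms
   are nonzero. *)
Definition scaling_field f : tser C :=
  @GSer _ tsupports _ (fun m =>
    \sum_(n \in [set: nat]) ((n%:R + 2%:R^-1) * (tvar n * pd n f) m)) I.

(* theta`_n is the parameter theta_{2n+1}. *)
Definition vfield (sigma : C) (theta : {poly C}) f : tser C :=
  \sum_(n < size theta) theta`_n *: pd n f + sigma *: scaling_field f.

Definition self_similar (sigma : C) (theta : {poly C}) v : Prop :=
  vfield sigma theta v + (sigma / 2%:R) *: v = 0.

Definition differential_polynomial (F : tser C -> tser C) : Prop :=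
  exists (k : nat) (P : mpoly.mpoly k C), forall u,
    F u = mpoly.mmap (fun c : C => c%:A) (fun i : 'I_k => iter i (pd 0) u) P.

Definition gelfand_dickii (R : nat -> tser C -> tser C) : Prop :=
  [/\ forall n, differential_polynomial (R n),
      forall u, R 0%N u = (2%:R^-1)%:A,
      forall n u, pd 0 (R n.+1 u) =
        4%:R^-1 *: iter 3 (pd 0) (R n u) + u * pd 0 (R n u)
        + 2%:R^-1 *: (pd 0 u * R n u)
    & forall n, R n.+1 0 = 0].

Definition miura v : tser C := pd 0 v - v ^+ 2.

Definition mkdv (R : nat -> tser C -> tser C) v : Prop :=
  forall n, pd n v =
    pd 0 (pd 0 (R n (miura v)) + 2%:R * v * R n (miura v)).

End TSeries.

Definition mx2 (A : Type) (a b c d : A) : 'M[A]_2 :=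
  \matrix_(i, j) (if i == 0 then (if j == 0 then a else b)
                  else (if j == 0 then c else d)).

Section Ell.
Context (C : fieldType) (R : nat -> tser C -> tser C) (v : tser C).
Implicit Types p : {poly tser C}.

Definition pd1_poly p : {poly tser C} := map_poly (@pd C 0) p.
Definition pd1_2v p : {poly tser C} := pd1_poly p + (2%:R * v) *: p.

Definition rho (n : nat) : {poly tser C} :=
  2%:R * \sum_(m < n.+1) R (n - m)%N (miura v) *: 'X^m.

(* ell n is the matrix l_{2n+1}, polynomial in the indeterminate 'X = lambda. *)
Definition ell (n : nat) : 'M[{poly tser C}]_2 :=
  let half : tser C := (2%:R^-1)%:A in
  mx2 (- (half *: pd1_2v (rho n)))
      (rho n)
      ('X * rho n - pd1_poly (pd1_2v (half *: rho n - (R n (miura v))%:P)))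
      (half *: pd1_2v (rho n)).

End Ell.

Section Loops.
Context (A : comNzRingType).
Implicit Types X : 'M[laurent A]_2.

Definition lam : laurent A := gmonom lsupports 1 1.
Definition lamV : laurent A := gmonom lsupports 1 (-1).

Definition Jmx : 'M[laurent A]_2 := mx2 0 1 lam 0.
Definition Hmx : 'M[laurent A]_2 := mx2 1 0 0 (-1).

(* Projections along the splitting of the loop algebra: B^+ has nonnegative
   powers of lambda and no lower left entry at lambda^0. *)
Definition Pplus X : 'M[laurent A]_2 :=
  \matrix_(i, j) grestrict (fun k : int =>
    if (i == 1) && (j == 0) then 0 < k else 0 <= k) (X i j).
Definition Pminus X : 'M[laurent A]_2 := X - Pplus X.

Definition NminusSL X : Prop :=
  [/\ forall i j (k : int), 0 < k -> X i j k = 0, \det X = 1,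
      (X 0 0 : laurent A) 0 = 1, (X 0 1 : laurent A) 0 = 0
    & (X 1 1 : laurent A) 0 = 1].

(* psi X psi^-1, for psi of determinant 1. *)
Definition Ad (psi X : 'M[laurent A]_2) : 'M[laurent A]_2 :=
  psi *m X *m \adj psi.

End Loops.

Section Correspondence.
Context (C : fieldType).
Local Notation H := (laurent C).

(* psi is psi_-(t, lambda); since det psi = 1, psi^-1 is \adj psi. *)
Definition dressing (g : 'M[H]_2) (psi : 'M[laurent (tser C)]_2) : Prop :=
  [/\ NminusSL psi,
      map_mx (gmap (@ev0 C)) psi *m g = 1%:M
    & forall n : nat, map_mx (gmap (@pd C n)) psi *m \adj psi =
        - Pminus (Ad psi (lam (tser C) ^+ n *: Jmx (tser C)))].

Definition solution_of (g : 'M[H]_2) (v : tser C) : Prop :=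
  exists psi, dressing g psi /\
    Pplus (Ad psi (Jmx (tser C))) = mx2 (- v%:A) 1 (lam (tser C)) v%:A.

(* f(lambda) |-> f(lambda^2) *)
Fact lsquare_small (f : H) : lsupports (gsupp (fun k : int =>
  if (2 %| k)%Z then f (k %/ 2)%Z else 0)).
Proof.
have [N fN] := gcoef_small f; exists (`|N| * 2) => k; rewrite /gsupp /=.
case: ifP => [/divzK k2 /fN kN|_]; last by rewrite eqxx.
by rewrite -k2 ler_pM2r// (le_trans kN)// ler_norm.
Qed.
Definition lsquare (f : H) : H := GSer (lsquare_small f).

(* lambda d/dlambda *)
Fact leuler_small (f : H) : lsupports (gsupp (fun k : int => f k *~ k)).
Proof.
apply: small_sub (gcoef_small f) => k; rewrite /gsupp /=.
by apply: contra_neq => ->; rewrite mul0rz.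
Qed.
Definition leuler (f : H) : H := GSer (leuler_small f).

Definition Tmap (Phi : 'cV[H]_2) : H :=
  lam C * lsquare (Phi 0 0) + lsquare (Phi 1 0).

Definition lspan (B : set H) : set H :=
  [set h | exists (k : nat) (a : 'I_k -> C) (b : 'I_k -> H),
    (forall i, B (b i)) /\ h = \sum_(i < k) a i *: b i].

Definition Vspan (phi tphi : H) : set H :=
  lspan [set h | h = lamV C * phi \/ exists n : nat,
    h = lam C ^+ n.*2.+1 * phi \/ h = lam C ^+ n.*2.+1 * tphi].

Definition Wspan (phi tphi : H) : set H :=
  lspan [set h | exists n : nat,
    h = lam C ^+ n.*2 * phi \/ h = lam C ^+ n.*2 * tphi].

Definition negative_powers (h : H) : Prop := forall k : int, 0 <= k -> h k = 0.

(* V is in the index zero Sato Grassmannian when the projection V -> C[lambda]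
   along the series in negative powers has kernel and cokernel of the same
   finite dimension k: e is a basis of the kernel and f induces one of the
   cokernel. *)
Definition sato_grassmannian (V : set H) : Prop :=
  [/\ V 0, forall (a : C) x y, V x -> V y -> V (a *: x + y)
    & exists (k : nat) (e f : 'I_k -> H),
      [/\ forall a : 'I_k -> C, \sum_i a i *: e i = 0 -> forall i, a i = 0,
          forall h, (V h /\ negative_powers h) <->
            exists a : 'I_k -> C, h = \sum_i a i *: e i,
          forall a : 'I_k -> C,
            (exists2 w, V w & negative_powers (\sum_i a i *: f i - w)) ->
            forall i, a i = 0
        & forall h, exists a : 'I_k -> C,
            exists2 w, V w & negative_powers (h - \sum_i a i *: f i - w)]].

Definition flag2 (V W : set H) : Prop :=
  [/\ sato_grassmannian V, sato_grassmannian W,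
      [set lam C ^+ 2 * h | h in W] `<=` [set lam C * h | h in V]
    & [set lam C * h | h in V] `<=` W].

Definition corresponds (v : tser C) (V W : set H) : Prop :=
  exists g : 'M[H]_2, [/\ NminusSL g, solution_of g v,
    V = Vspan (Tmap (col 0 g)) (Tmap (col 1 g))
  & W = Wspan (Tmap (col 0 g)) (Tmap (col 1 g))].

(* G = exp X, the exponential series converging coefficientwise. *)
Definition is_mxexp (X G : 'M[H]_2) : Prop :=
  forall i j (k : int), exists N : nat, forall n : nat, (N <= n)%N ->
    (\sum_(p < n) (((p`!)%:R^-1)%:A : H) *: X ^+ p) i j k = G i j k.

(* A (possibly infinite) combination of the lambda^n J, n < 0, is a J with a
   having only negative powers. *)
Definition Gamma_minus (G : 'M[H]_2) : Prop :=
  exists2 a : H, negative_powers a & is_mxexp (a *: Jmx C) G.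

(* Action of a loop on subspaces of H, transported from C^2-valued series by
   the bijection T. *)
Definition loop_act (G : 'M[H]_2) (V : set H) : set H :=
  [set Tmap (G *m Phi) | Phi in [set Phi | V (Tmap Phi)]].

(* p(lambda^2) as an element of H *)
Definition at_square (p : {poly C}) : H :=
  (map_poly (fun c : C => c%:A : H) p).[lam C ^+ 2].

Definition string_operator (sigma : C) (theta : {poly C})
    (R : nat -> tser C -> tser C) (v : tser C) (Y : 'cV[H]_2) : 'cV[H]_2 :=
  ((sigma / 2%:R)%:A : H) *:
    (map_mx leuler Y - ((2%:R^-1)%:A : H) *: ((1%:M + Hmx C) *m Y))
  - (lam C * at_square theta) *: Y
  + \sum_(n < size theta) ((theta`_n)%:A : H) *:
      ((map_mx (fun p => at_square (map_poly (@ev0 C) p)) (ell R v n))^T *m Y).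

Definition string_solution (sigma : C) (theta : {poly C})
    (R : nat -> tser C -> tser C) (v : tser C) (phi tphi : H) : Prop :=
  [/\ string_operator sigma theta R v
        (\col_i (if i == 0 then phi else tphi)) = 0,
      phi 1 = 1 /\ (forall k : int, 1 < k -> phi k = 0)
    & tphi 0 = 1 /\ (forall k : int, 0 < k -> tphi k = 0)].

(* (V, W) is, modulo the left action of Gamma_-, the pair of spans of a
   solution (phi, tphi) of the linear system. *)
Definition given_by_string_solution (sigma : C) (theta : {poly C})
    (R : nat -> tser C -> tser C) (v : tser C) (V W : set H) : Prop :=
  exists (G : 'M[H]_2) (phi tphi : H),
    [/\ Gamma_minus G, string_solution sigma theta R v phi tphi,
        loop_act G V = Vspan phi tphi & loop_act G W = Wspan phi tphi].

End Correspondence.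

(* Main.v *)
(* The proof lives in the principal grading of the loop algebra, in which
   E lambda^k, H lambda^k, F lambda^k have degrees 2k + 1, 2k, 2k - 1, so that
   N^- and B^+ are the loops of negative and nonnegative degrees. If delta is
   sigma / 2 times the principal degree, then delta J = (sigma / 2) J, and the
   operator X - delta is a derivation of loops that turns the flows of
   lambda^n J into themselves. Its defect K = ((X - delta) psi_-) psi_-^-1 lies
   in N^- and satisfies the linear system d_n K = P_-[P_+ Ad psi_-(lambda^n J), K],
   so it is determined by its value at t = 0, and v is self-similar as soon as
   K is psi_- (c J) psi_-^-1 with c free of t.
   Through the isomorphism T, under which lambda acts as J, the string equation
   for (phi, tphi) reads S(g) = 0 with S(g) = delta g - theta J g + g B and
   B = sum_n theta_{2n+1} l_{2n+1}(0), and K(0) = g^-1 S(g). Conversely,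
   self-similarity says that K commutes with Ad psi_-(J) modulo N^-; then
   psi_-^-1 K psi_- evolves under [J, -] in t_1, which forces it to be y J with y
   free of t_1, so that S(g) = y J g, and a factor exp(a J) in Gamma_- absorbs y.
   The identity P_+ Ad psi_-(lambda^n J) = l_{2n+1} holds because the upper right
   entry of Ad psi_-(J) and the generating series of the Gel'fand-Dickii
   potentials are normalized solutions of the same quadratic equation. *)

From HB Require Import structures.
Require Import Defs.
From mathcomp Require Import all_boot all_order all_algebra.
From mathcomp Require Import boolp classical_sets functions cardinality fsbigop.
From mathcomp Require Import finmap zify ring.
From mathcomp Require Import reals.
From mathcomp.real_closed Require Import complex.
From mathcomp.multinomials Require mpoly.

Set Implicit Arguments.
Unset Strict Implicit.
Unset Printing Implicit Defensive.

Import Order.TTheory GRing.Theory Num.Theory.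

Local Open Scope classical_set_scope.
Local Open Scope ring_scope.

(** A factor exp(a J) changes S(g) through the numbers sigma (k + 1/2) a_k with k < 0. As k + 1/2 is
    never zero, every y is absorbed when sigma is nonzero. At sigma = 0 nothing is absorbed: taking
    determinants in S(g) = y J g shows that a nonzero y excludes every solution of the string
    equation, hence the alternative between sigma nonzero and an existing solution. Uniqueness is
    restricted to nonzero sigma because at sigma = 0 a solution may be multiplied by any element of
    Gamma_-. A solution of the string equation is normalized only in its nonnegative degrees and its
    determinant is not prescribed; so inverses give way to cancellation by degree ([unip_cancel]),
    and equality of spans returns equality of matrices through the uniqueness of normalized
    generators. The Gel'fand-Dickii recursion determines only the t_1-derivative of each potential.
    The quadratic equation of its generating series is therefore first obtained up to a constant of
    integration, and fixing this constant takes the fact that a differential polynomial with zero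
    t_1-derivative, for all u, is constant. *)

Section GSerGeneral.
Context (M : nmodType) (S : supports M) (A : comNzRingType).
Implicit Types f g : gser S A.

(** A single finite list of exponent pairs serves every product whose factors have no larger
    support, so Leibniz rules can be checked term by term. *)
Lemma gcoefM_sum f g m : exists s : seq (M * M),
  (forall p, p \in s -> p.1 + p.2 = m) /\
  forall (B : comNzRingType) (F G : gser S B),
    gsupp F `<=` gsupp f -> gsupp G `<=` gsupp g ->
    (F * G) m = \sum_(p <- s) F p.1 * G p.2.
Proof.
exists (fset_set [set p : M * M | (gsupp f p.1 /\ gsupp g p.2) /\ p.1 + p.2 = m]).
split=> [p|B F G Ff Gg].
  rewrite in_fset_set; last exact: small_fin (gcoef_small f) (gcoef_small g) m.
  by move=> /set_mem[].
by rewrite gcoefM (conv_fset m (gcoef_small f) (gcoef_small g)).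
Qed.

Lemma gcoefM_neq0 f g m : (f * g) m != 0 ->
  exists p q, [/\ p + q = m, f p != 0 & g q != 0].
Proof.
move=> fgm; apply: contrapT => npq; move: fgm; rewrite gcoefM /conv fsbig1 ?eqxx//.
move=> p /= pm; have [->|fp] := eqVneq (f p.1) 0; first by rewrite mul0r.
have [->|gp] := eqVneq (g p.2) 0; first by rewrite mulr0.
by case: npq; exists p.1, p.2.
Qed.

Lemma gmonomM (a : A) n f m m' : n + m' = m -> (forall k, n + k = m -> k = m') ->
  (gmonom S a n * f) m = a * f m'.
Proof.
move=> nm inj; rewrite gcoefM /conv -(fsbig_widen [set (n, m')]).
- by rewrite fsbig_set1 /= eqxx.
- by move=> _ ->.
- move=> [p q] [/= pq pn]; case: eqP => [pE|]; last by rewrite mul0r.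
  by case: pn; rewrite /= pE in pq *; rewrite (inj q).
Qed.

Lemma gcoef_sum I (r : seq I) (P : pred I) (F : I -> gser S A) m :
  (\sum_(i <- r | P i) F i) m = \sum_(i <- r | P i) F i m.
Proof. by elim/big_rec2: _ => // i x y _ <-. Qed.

Lemma gcoefMn f n m : (f *+ n) m = f m *+ n.
Proof. by elim: n => // n IHn; rewrite !mulrS gcoefD IHn. Qed.

Lemma gcoefnM (n : nat) f m : (n%:R * f) m = n%:R * f m.
Proof. by rewrite !mulr_natl gcoefMn. Qed.

End GSerGeneral.

(** * Derivations and the scaling field on power series in the times *)

Section TSeriesTheory.
Context (C : numFieldType).
Implicit Types (f g u : tser C) (n : nat) (c : C).

Lemma tvarME n f (m : {poly nat}) : (tvar C n * f) (m + 'X^n) = f m.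
Proof.
rewrite /tvar (@gmonomM _ _ _ 1 'X^n f _ m) ?mul1r// 1?addrC// => k.
rewrite addrC => /polyP E; apply/polyP => i; have := E i.
by rewrite !coefD [RHS]addrC => E'; exact: (@addIn ('X^n)`_i _ _ E').
Qed.

Lemma tvarM_out n f (m : {poly nat}) : m`_n = 0%N -> (tvar C n * f) m = 0.
Proof.
move=> mn; apply/eqP; apply: contraT => /gcoefM_neq0[p [q [pq]]].
rewrite /tvar /=; have [pE _ _|pn] := eqVneq p 'X^n; last by rewrite eqxx.
by move: mn; rewrite -pq pE coefD coefXn eqxx.
Qed.

Lemma expSub (m : {poly nat}) n : (0 < (m`_n)%R)%N -> exists m', m = m' + 'X^n.
Proof.
move=> mn; exists (\poly_(i < size m) ((m`_i)%R - (i == n))%N).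
apply/polyP => i; rewrite coefD coef_poly coefXn.
have [iE|_] := eqVneq i n; last first.
  by case: ltnP => im; rewrite ?subn0 ?addr0// nth_default.
rewrite iE; case: ltnP => nm; first by rewrite -[RHS]/((m`_n)%R - 1 + 1)%N subnK.
by move: mn; rewrite nth_default.
Qed.

Lemma exp_neq0 (m : {poly nat}) : m != 0 -> exists n m', m = m' + 'X^n.
Proof.
move=> m0; suff [n /expSub[m' mE]] : exists n, (0 < (m`_n)%R)%N by exists n, m'.
apply: contrapT => nm; case/eqP: m0; apply/polyP => i; rewrite coef0.
by apply/eqP; rewrite -leqn0 leqNgt; apply/negP => mi; apply: nm; exists i.
Qed.

Lemma tvarM_pd n f (m : {poly nat}) : (tvar C n * pd n f) m = (m`_n)%R%:R * f m.
Proof.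
case: (posnP (m`_n)%R) => [mn|/expSub[m' ->]]; first by rewrite tvarM_out// mn mul0r.
by rewrite tvarME coefD coefXn eqxx mulr_natl; congr (_ *+ _); exact/esym/addn1.
Qed.

Lemma mulrnS_inj (k : nat) (x y : C) : x *+ k.+1 = y *+ k.+1 -> x = y.
Proof.
have k0 : k.+1%:R != 0 :> C by rewrite pnatr_eq0.
by rewrite -[LHS]mulr_natr -[RHS]mulr_natr; exact: mulIf.
Qed.

(** The operator t d/dt multiplies each coefficient by an exponent, which is additive, so it
    satisfies the Leibniz rule termwise; the factor t then cancels by [tvarME]. *)
Lemma pdM n f g : pd n (f * g) = pd n f * g + f * pd n g.
Proof.
pose P (F : tser C) : tser C := @GSer _ tsupports _ (fun m : {poly nat} => (m`_n)%R%:R * F m) I.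
have PE F : P F = tvar C n * pd n F by apply: gserP => m; rewrite tvarM_pd.
have PM : P (f * g) = P f * g + f * P g.
  apply: gserP => m; have [s [sm sE]] := gcoefM_sum f g m.
  rewrite gcoefD -[LHS]/((m`_n)%R%:R * (f * g) m) (sE _ f g)// (sE _ (P f) g)//; last first.
    by move=> k; rewrite /gsupp /=; apply: contra_neq => ->; rewrite mulr0.
  rewrite (sE _ f (P g))//; last first.
    by move=> k; rewrite /gsupp /=; apply: contra_neq => ->; rewrite mulr0.
  rewrite -big_split mulr_sumr /=; apply: eq_big_seq => p /sm <-.
  by rewrite coefD natrD; ring.
have {}PM : tvar C n * pd n (f * g) = tvar C n * (pd n f * g + f * pd n g).
  by rewrite -PE PM !PE mulrDr mulrA mulrCA.
by apply: gserP => m; rewrite -(tvarME n) PM tvarME.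
Qed.

Lemma pdZ n c f : pd n (c *: f) = c *: pd n f.
Proof. by apply: gserP => m /=; rewrite mulrnAr. Qed.

Lemma pd1 n : pd n (1 : tser C) = 0.
Proof.
have := pdM n 1 1; rewrite !mul1r mulr1 => /eqP.
by rewrite -subr_eq subrr => /eqP.
Qed.

Lemma pdA n c : pd n (c%:A : tser C) = 0.
Proof. by rewrite pdZ pd1 scaler0. Qed.

Lemma pd_comm n k f : pd n (pd k f) = pd k (pd n f).
Proof.
apply: gserP => m /=; rewrite -!mulrnA -!addrA [X in f (_ + X)]addrC.
congr (_ *+ _); rewrite !coefD !coefXn; case: (eqVneq k n) => [->//|_].
by rewrite !addr0 mulnC.
Qed.

Fact ev0_is_monoid_morphism : monoid_morphism (@ev0 C).
Proof.
split=> [|f g]; first by rewrite /ev0 gcoef1 eqxx.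
rewrite /ev0 gcoefM /conv -(fsbig_widen [set (0, 0)]).
- by rewrite fsbig_set1.
- by move=> _ -> /=; rewrite addr0.
- move=> [p q] [/= pq pn]; exfalso; apply: pn => /=.
  suff p0 : p = 0 by rewrite p0 add0r in pq *; rewrite pq.
  apply/polyP => i; have /polyP/(_ i) := pq; rewrite coefD !coef0.
  by case: (p`_i)%R.
Qed.
HB.instance Definition _ := GRing.isMonoidMorphism.Build (tser C) C (@ev0 C)
  ev0_is_monoid_morphism.

Lemma ev0Z c f : ev0 (c *: f) = c * ev0 f. Proof. by []. Qed.
Lemma ev0A c : ev0 (c%:A : tser C) = c.
Proof. by rewrite ev0Z rmorph1 mulr1. Qed.

(** The eigenvalue of [scaling_field] on the monomial of exponent m; the derivation property of that
    field is the additivity of the weight. *)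
Definition weight (m : {poly nat}) : C :=
  \sum_(i < size m) (i%:R + 2%:R^-1) * (m`_i)%R%:R.

Lemma weight_wide N (m : {poly nat}) : (size m <= N)%N ->
  weight m = \sum_(i < N) (i%:R + 2%:R^-1) * (m`_i)%R%:R.
Proof.
move=> mN; rewrite /weight (big_ord_widen N (fun i => (i%:R + 2%:R^-1) * (m`_i)%R%:R) mN).
rewrite big_mkcond; apply: eq_bigr => i _; case: ltnP => // im.
by rewrite nth_default// mulr0.
Qed.

Lemma weightD (m m' : {poly nat}) : weight (m + m') = weight m + weight m'.
Proof.
pose N := maxn (size m) (size m').
rewrite !(@weight_wide N) ?leq_maxl ?leq_maxr //; last exact: size_polyD.
by rewrite -big_split; apply: eq_bigr => i _; rewrite coefD natrD mulrDr.
Qed.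

Lemma weightXn n : weight 'X^n = n%:R + 2%:R^-1.
Proof.
rewrite /weight size_polyXn big_ord_recr big1 /= => [|i _].
  by rewrite coefXn eqxx mulr1 add0r.
by rewrite coefXn ltn_eqF ?mulr0//=.
Qed.

Lemma scaling_fieldE f m : scaling_field f m = weight m * f m.
Proof.
rewrite -[LHS]/(\sum_(n \in [set: nat]) ((n%:R + 2%:R^-1) * (tvar C n * pd n f) m)).
rewrite -(fsbig_widen `I_(size m)) //; last first.
  move=> n [_ /negP]; rewrite -leqNgt => nm.
  change ((n%:R + 2%:R^-1) * (tvar C n * pd n f) m = 0).
  by rewrite tvarM_pd nth_default// mul0r mulr0.
rewrite -(fsbig_ord _ (size m) (fun i => (i%:R + 2%:R^-1) * (tvar C i * pd i f) m)) /weight mulr_suml; apply: eq_bigr => i _.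
by rewrite tvarM_pd mulrA.
Qed.

Lemma scaling_fieldM f g :
  scaling_field (f * g) = scaling_field f * g + f * scaling_field g.
Proof.
have sub (F : tser C) : gsupp (scaling_field F) `<=` gsupp F.
  move=> k; rewrite -[gsupp _ k]/(is_true (scaling_field F k != 0)) scaling_fieldE.
  by rewrite -[gsupp _ k]/(is_true (F k != 0)); apply: contra_neq => ->; rewrite mulr0.
apply: gserP => m; have [s [sm sE]] := gcoefM_sum f g m.
rewrite gcoefD scaling_fieldE (sE _ f g)// (sE _ (scaling_field f) g)//.
rewrite (sE _ f (scaling_field g))// mulr_sumr.
transitivity (\sum_(p <- s)
  (scaling_field f p.1 * g p.2 + f p.1 * scaling_field g p.2)); last by rewrite big_split.
apply: eq_big_seq => p /sm <-; rewrite !scaling_fieldE weightD; ring.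
Qed.

Section VField.
Context (sigma : C) (theta : {poly C}).
Local Notation X := (vfield sigma theta).

Lemma vfieldE f m :
  X f m = \sum_(n < size theta) theta`_n * pd n f m + sigma * (weight m * f m).
Proof. by rewrite gcoefD gcoef_sum gcoefZ scaling_fieldE. Qed.

Fact vfield_is_additive : zmod_morphism X.
Proof.
move=> f g; apply: gserP => m; rewrite [RHS]gcoefD [X in _ = _ + X]gcoefN !vfieldE gcoefD gcoefN.
under eq_bigr do rewrite raddfB gcoefD gcoefN mulrBr.
by rewrite sumrB; ring.
Qed.
HB.instance Definition _ :=
  GRing.isZmodMorphism.Build (tser C) (tser C) X vfield_is_additive.

Lemma vfieldM f g : X (f * g) = X f * g + f * X g.
Proof.
rewrite /vfield scaling_fieldM !mulrDl !mulrDr mulr_suml mulr_sumr.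
rewrite addrACA -big_split /= scalerDr -scalerAl -scalerAr; congr (_ + _).
by apply: eq_bigr => i _; rewrite pdM scalerDr -scalerAl -scalerAr.
Qed.

Lemma vfieldZ c f : X (c *: f) = c *: X f.
Proof.
apply: gserP => m; rewrite !(vfieldE, gcoefZ) mulrDr mulr_sumr.
by congr (_ + _); [apply: eq_bigr => i _; rewrite pdZ gcoefZ|]; ring.
Qed.

Lemma vfieldA c : X (c%:A) = 0.
Proof.
rewrite vfieldZ; have := vfieldM 1 1; rewrite !mul1r mulr1 => /eqP.
by rewrite -subr_eq subrr => /eqP <-; rewrite scaler0.
Qed.

(** Constant-coefficient derivatives commute with each other, so only the scaling part contributes,
    through the weight n + 1/2 of t_{2n+1}. *)
Lemma pd_vfield n f :
  pd n (X f) = X (pd n f) + (sigma * (n%:R + 2%:R^-1)) *: pd n f.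
Proof.
apply: gserP => m; rewrite gcoefD gcoefZ vfieldE.
rewrite -[LHS]/(X f (m + 'X^n) *+ (m`_n)%R.+1) vfieldE mulrnDl -sumrMnl.
rewrite -addrA; congr (_ + _).
  apply: eq_bigr => i _; rewrite -mulrnAr; congr (_ * _).
  by rewrite -[LHS]/(pd n (pd i f) m) pd_comm.
rewrite weightD weightXn -[pd n f m]/(f (m + 'X^n) *+ (m`_n)%R.+1); ring.
Qed.

Lemma ev0_vfield f : ev0 (X f) = \sum_(n < size theta) theta`_n * ev0 (pd n f).
Proof.
rewrite /ev0 vfieldE; suff -> : weight 0 = 0 by rewrite mul0r mulr0 addr0.
by rewrite /weight size_poly0 big_ord0.
Qed.

End VField.

(* m.[1] is the total degree of the monomial of exponent m. *)
Definition tvanish (d : nat) f := forall m : {poly nat}, (m.[1] < d)%N -> f m = 0.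

Lemma tvanishMr d f g : tvanish d f -> tvanish d (f * g).
Proof.
move=> fd m md; apply/eqP; apply: contraT => /gcoefM_neq0[p [q [pq]]].
rewrite fd ?eqxx//; move: md; rewrite -pq hornerD.
by apply: leq_ltn_trans; exact: leq_addr.
Qed.

Lemma tvanishD d f g : tvanish d f -> tvanish d g -> tvanish d (f + g).
Proof. by move=> fd gd m md; rewrite gcoefD fd// gd// addr0. Qed.

Lemma tvanishN d f : tvanish d f -> tvanish d (- f).
Proof. by move=> fd m md; rewrite gcoefN fd// oppr0. Qed.

Lemma tvanish0 d : tvanish d 0. Proof. by []. Qed.

Lemma tvanish_pd d f : ev0 f = 0 -> (forall n, tvanish d (pd n f)) -> tvanish d.+1 f.
Proof.
move=> f0 fd m md; have [->//|m0] := eqVneq m 0.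
have [n [m' mE]] := exp_neq0 m0; move: md; rewrite mE hornerD hornerXn expr1n => md.
apply: (@mulrnS_inj (m'`_n)%R); rewrite mul0rn.
by apply: (fd n m'); rewrite -ltnS -addn1.
Qed.

Lemma tvanish_eq0 f : (forall d, tvanish d f) -> f = 0.
Proof. by move=> fd; apply: gserP => m; exact: (fd m.[1].+1). Qed.

End TSeriesTheory.

Lemma ord2_ind (P : 'I_2 -> Prop) : P 0 -> P 1 -> forall i, P i.
Proof.
move=> P0 P1 [[|[|//]] i2].
  by rewrite (_ : Ordinal i2 = 0)//; apply: val_inj.
by rewrite (_ : Ordinal i2 = 1)//; apply: val_inj.
Qed.

(** * Loop matrices and the principal grading *)

Section LoopMatrices.
Context (A : comNzRingType).
Implicit Types (f g : laurent A) (X Y : 'M[laurent A]_2).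

Lemma gmonom_intM (a : A) n f k : (gmonom lsupports a n * f) k = a * f (k - n).
Proof.
apply: gmonomM => [|k' <-]; first by rewrite addrC subrK.
by rewrite addrAC subrr add0r.
Qed.

Lemma lamME f k : (lam A * f) k = f (k - 1).
Proof. by rewrite gmonom_intM mul1r. Qed.

Lemma lamVME f k : (lamV A * f) k = f (k + 1).
Proof. by rewrite gmonom_intM mul1r opprK. Qed.

Lemma lamXME n f k : (lam A ^+ n * f) k = f (k - n%:Z).
Proof.
elim: n k => [|n IHn] k; first by rewrite expr0 mul1r subr0.
by rewrite exprS -mulrA lamME IHn -addrA -opprD -intS.
Qed.

Lemma lamXE n k : (lam A ^+ n) k = (k == n%:Z)%:R.
Proof.
rewrite -[lam A ^+ n]mulr1 lamXME gcoef1 subr_eq0.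
by case: ifP.
Qed.

Lemma lamK : lam A * lamV A = 1.
Proof.
apply: gserP => k; rewrite lamME gcoef1 /= -subr_eq0 opprK subrK.
by [].
Qed.

Lemma laurentAE (a : A) k : (a%:A : laurent A) k = if k == 0 then a else 0.
Proof. by rewrite gcoefZ gcoef1; case: ifP; rewrite ?mulr1 ?mulr0. Qed.

Lemma laurentAM (a : A) f : (a%:A : laurent A) * f = a *: f.
Proof. by rewrite -scalerAl mul1r. Qed.

Lemma adj2 X : \adj X = mx2 (X 1 1) (- X 0 1) (- X 1 0) (X 0 0).
Proof.
apply/matrixP => i j; rewrite !mxE /cofactor.
have d1 (Z : 'M[laurent A]_1) : \det Z = Z 0 0 by exact: det_mx11.
rewrite d1 !mxE.
have l0 : lift 0 0 = 1 :> 'I_2 by exact: val_inj.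
have l1 : lift 1 0 = 0 :> 'I_2 by exact: val_inj.
by elim/ord2_ind: i; elim/ord2_ind: j; rewrite /= ?l0 ?l1 ?expr0 ?expr1 ?expr2
  ?mul1r ?mulN1r ?opprK ?mul1r.
Qed.

Lemma mulmx2E (X Y : 'M[laurent A]_2) i j :
  (X *m Y) i j = X i 0 * Y 0 j + X i 1 * Y 1 j.
Proof.
rewrite mxE !big_ord_recl big_ord0 addr0.
by rewrite (_ : lift ord0 ord0 = 1)//; apply: val_inj.
Qed.

Lemma mxBE (X Y : 'M[laurent A]_2) i j : (X - Y) i j = X i j - Y i j.
Proof. by rewrite !mxE. Qed.

Lemma mxgP X Y : (forall i j k, X i j k = Y i j k) -> X = Y.
Proof. by move=> XY; apply/matrixP => i j; apply: gserP. Qed.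

Lemma mxgD X Y i j k : (X + Y) i j k = X i j k + Y i j k.
Proof. by rewrite mxE. Qed.

Lemma mxgN X i j k : (- X) i j k = - X i j k.
Proof. by rewrite mxE. Qed.

Lemma mxgB X Y i j k : (X - Y) i j k = X i j k - Y i j k.
Proof. by rewrite mxgD mxgN. Qed.


(* The principal grading: E lambda^k, H lambda^k, F lambda^k have degrees
   2k + 1, 2k, 2k - 1; N^- and B^+ are the loops of degrees < 0 and >= 0. *)
Definition prdeg (i j : 'I_2) (k : int) : int := k *+ 2 + (j : nat)%:Z - (i : nat)%:Z.

Lemma prdegD i l j p q : prdeg i l p + prdeg l j q = prdeg i j (p + q).
Proof. by rewrite /prdeg; ring. Qed.

Definition dle (d : int) X := forall i j k, d < prdeg i j k -> X i j k = 0.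

Lemma dle_trans d e X : d <= e -> dle d X -> dle e X.
Proof. by move=> de Xd i j k ek; apply: Xd; exact: le_lt_trans ek. Qed.

Lemma dleD d X Y : dle d X -> dle d Y -> dle d (X + Y).
Proof. by move=> Xd Yd i j k dk; rewrite mxgD Xd// Yd// addr0. Qed.

Lemma dleN d X : dle d X -> dle d (- X).
Proof. by move=> Xd i j k dk; rewrite mxgN Xd// oppr0. Qed.

Lemma dleB d X Y : dle d X -> dle d Y -> dle d (X - Y).
Proof. by move=> Xd Yd; apply: dleD => //; exact: dleN. Qed.

Lemma mulmxgE X Y i j k : (X *m Y) i j k = \sum_l (X i l * Y l j) k.
Proof. by rewrite mxE gcoef_sum. Qed.

Lemma dleM d e X Y : dle d X -> dle e Y -> dle (d + e) (X *m Y).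
Proof.
move=> Xd Ye i j k dek; rewrite mulmxgE big1// => l _.
apply/eqP; apply: contraT => /gcoefM_neq0[p [q [pq Xp Yq]]].
move: dek; rewrite -pq -(prdegD i l) ltNge lerD// leNgt.
  by apply: contra_neqN Xp => /Xd.
by apply: contra_neqN Yq => /Ye.
Qed.

Lemma dle1 : dle 0 1%:M.
Proof.
move=> i j k; rewrite mxE /prdeg; case: eqVneq => [->|_ _]; last by [].
rewrite mulr1n gcoef1; case: eqP => // ->; by rewrite mul0rn add0r subrr ltxx.
Qed.

Lemma prdeg_ge0 i j k :
  (if (i == 1) && (j == 0) then 0 < k else 0 <= k) = (0 <= prdeg i j k).
Proof.
by rewrite /prdeg; elim/ord2_ind: i; elim/ord2_ind: j => /=; lia.
Qed.

Lemma PplusE X i j k : Pplus X i j k = if 0 <= prdeg i j k then X i j k else 0.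
Proof. by rewrite mxE /= prdeg_ge0. Qed.

Lemma PminusE X i j k : Pminus X i j k = if 0 <= prdeg i j k then 0 else X i j k.
Proof.
by rewrite mxgB PplusE; case: ifP; rewrite ?subrr ?subr0.
Qed.

Lemma Pplus_Pminus X : Pplus X + Pminus X = X.
Proof. by rewrite /Pminus addrC subrK. Qed.

Lemma PminusD X Y : Pminus (X + Y) = Pminus X + Pminus Y.
Proof.
apply: mxgP => i j k; rewrite [RHS]mxgD !PminusE mxgD.
by case: ifP; rewrite ?addr0.
Qed.

Lemma PminusN X : Pminus (- X) = - Pminus X.
Proof.
apply: mxgP => i j k; rewrite [RHS]mxgN !PminusE mxgN.
by case: ifP; rewrite ?oppr0.
Qed.

Lemma PminusB X Y : Pminus (X - Y) = Pminus X - Pminus Y.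
Proof. by rewrite PminusD PminusN. Qed.

Lemma dle_Pminus X : dle (-1) (Pminus X).
Proof. by move=> i j k d; rewrite PminusE ifT//; lia. Qed.

Lemma Pminus_id X : dle (-1) X -> Pminus X = X.
Proof.
move=> Xd; apply: mxgP => i j k; rewrite PminusE.
by case: ifP => // d; rewrite Xd//; lia.
Qed.

Lemma dle_adj d X : dle d X -> dle d (\adj X).
Proof.
move=> Xd i j k; rewrite adj2 mxE /prdeg.
elim/ord2_ind: i; elim/ord2_ind: j => /= dk; rewrite ?gcoefN Xd ?oppr0 // /prdeg /=; lia.
Qed.

Lemma det_adjK X : \det X = 1 -> X *m \adj X = 1%:M /\ \adj X *m X = 1%:M.
Proof. by move=> X1; rewrite mul_mx_adj mul_adj_mx X1. Qed.

Lemma NminusSL_dle X : NminusSL X -> dle (-1) (X - 1%:M).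
Proof.
move=> [Xk _ X00 X01 X11] i j k; rewrite mxgB /prdeg.
elim/ord2_ind: i; elim/ord2_ind: j => /= d; rewrite mxE ?mulr1n ?mulr0n ?gcoef1 ?gcoef0.
- have [->|k0] := eqVneq k 0; first by rewrite X00 subrr.
  by rewrite Xk ?subrr//; lia.
- have [->|k0] := eqVneq k 0; first by rewrite X01 subrr.
  by rewrite Xk ?subrr//; lia.
- by rewrite Xk ?subrr//; lia.
- have [->|k0] := eqVneq k 0; first by rewrite X11 subrr.
  by rewrite Xk ?subrr//; lia.
Qed.

(* NminusSL without the condition on the determinant. *)
Definition unip X := dle (-1) (X - 1%:M).

Lemma unip_dle X : unip X -> dle 0 X.
Proof.
move=> Xu; rewrite -[X](subrK 1%:M); apply: dleD dle1.
exact: dle_trans Xu.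
Qed.

Lemma unipM X Y : unip X -> unip Y -> unip (X *m Y).
Proof.
move=> Xu Yu; rewrite /unip -[X *m Y](subrK Y) -{2}[Y]mul1mx -mulmxBl -addrA.
apply: dleD => //; rewrite -[-1]addr0; apply: dleM => //; exact: unip_dle.
Qed.

Lemma unip_adj X : unip X -> unip (\adj X).
Proof.
move=> Xu; rewrite /unip (_ : \adj X - 1%:M = \adj (X - 1%:M)); first exact: dle_adj.
apply/matrixP => i j; rewrite !adj2 !mxE.
by elim/ord2_ind: i; elim/ord2_ind: j; rewrite /= ?mulr1n ?mulr0n ?subr0.
Qed.

Lemma JmxE : ((Jmx A 0 0 = 0) * (Jmx A 0 1 = 1) * (Jmx A 1 0 = lam A) *
  (Jmx A 1 1 = 0))%type.
Proof. by rewrite !mxE. Qed.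

Lemma lamJE n i j k :
  (lam A ^+ n *: Jmx A) i j k = (prdeg i j k == n.*2.+1%:Z)%:R.
Proof.
rewrite mxE /prdeg; elim/ord2_ind: i; elim/ord2_ind: j; rewrite JmxE.
- by rewrite mulr0 gcoef0; case: eqP => //; rewrite /=; lia.
- by rewrite mulr1 lamXE; congr (nat_of_bool _)%:R; rewrite /=; lia.
- by rewrite -exprSr lamXE; congr (nat_of_bool _)%:R; rewrite /=; lia.
- by rewrite mulr0 gcoef0; case: eqP => //; rewrite /=; lia.
Qed.

Lemma lamJ0E i j k : Jmx A i j k = (prdeg i j k == 1)%:R.
Proof. by rewrite -[Jmx A]scale1r -(expr0 (lam A)) lamJE. Qed.

Lemma dle_lamJ n : dle n.*2.+1%:Z (lam A ^+ n *: Jmx A).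
Proof. by move=> i j k dk; rewrite lamJE gt_eqF. Qed.

End LoopMatrices.

(** * Operators acting degree by degree on loops *)

Section GradedOps.
Context (A B : zmodType) (D : int -> {additive A -> B}).
Implicit Types (X Y : 'M[laurent A]_2).

Fact gop_small X i j : lsupports (gsupp (fun k => D (prdeg i j k) (X i j k))).
Proof.
apply: small_sub (gcoef_small (X i j)) => k; rewrite /gsupp /=.
by apply: contra_neq => ->; rewrite raddf0.
Qed.
(** The family D is indexed by the principal degree so that one construction covers the flows (D
    constant), the degree derivation and their combination X - delta; the graded Leibniz rule for D
    makes it a derivation of loops. *)
Definition gop X : 'M[laurent B]_2 := \matrix_(i, j) GSer (gop_small X i j).

Lemma gopE X i j k : gop X i j k = D (prdeg i j k) (X i j k).
Proof. by rewrite mxE. Qed.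

Lemma gopD X Y : gop (X + Y) = gop X + gop Y.
Proof.
apply/matrixP => i j; apply: gserP => k; rewrite gopE 3!mxE.
by rewrite 2!gcoefD raddfD !gopE.
Qed.

Lemma gopN X : gop (- X) = - gop X.
Proof.
apply/matrixP => i j; apply: gserP => k; rewrite gopE 2!mxE.
by rewrite 2!gcoefN raddfN !gopE.
Qed.

Lemma gopB X Y : gop (X - Y) = gop X - gop Y.
Proof. by rewrite gopD gopN. Qed.

End GradedOps.

Section GradedDerivations.
Context (A : comNzRingType) (D : int -> {additive A -> A}).
Implicit Types (X Y : 'M[laurent A]_2).
Hypothesis DM : forall d e a b, D (d + e) (a * b) = D d a * b + a * D e b.

Lemma gopM X Y : gop D (X *m Y) = gop D X *m Y + X *m gop D Y.
Proof.
apply: mxgP => i j k.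
rewrite gopE mulmxgE raddf_sum mxgD !mulmxgE -big_split /=.
apply: eq_bigr => l _; have [s [sm sE]] := gcoefM_sum (X i l) (Y l j) k; rewrite -!gcoefM.
have sub (Z : 'M[laurent A]_2) a b : gsupp (gop D Z a b) `<=` gsupp (Z a b).
  by move=> p; rewrite /gsupp -[_ p]/(is_true (gop D Z a b p != 0)) gopE; apply: contra_neq => ->; rewrite raddf0.
rewrite (sE _ (X i l) (Y l j))// (sE _ (gop D X i l) (Y l j))//.
rewrite (sE _ (X i l) (gop D Y l j))// raddf_sum -big_split /=.
by apply: eq_big_seq => p /sm <-; rewrite -(prdegD i l) DM !gopE.
Qed.

Lemma gop_Pminus X : gop D (Pminus X) = Pminus (gop D X).
Proof.
apply: mxgP => i j k; rewrite gopE !PminusE gopE.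
by case: ifP => //; rewrite raddf0.
Qed.

Lemma dle_gop d X : dle d X -> dle d (gop D X).
Proof. by move=> Xd i j k dk; rewrite gopE Xd// raddf0. Qed.

Lemma gop1 : gop D 1%:M = 0.
Proof.
by have := gopM 1%:M 1%:M; rewrite !mul1mx mulmx1 => /eqP; rewrite -subr_eq subrr => /eqP.
Qed.

End GradedDerivations.

Section GSerAdditive.
Context (A B : zmodType) (h : {additive A -> B}).

Fact gmap_is_additive : zmod_morphism (@gmap _ lsupports A B h).
Proof. by move=> f g; apply: gserP => m /=; rewrite raddfB. Qed.
HB.instance Definition _ := GRing.isZmodMorphism.Build (laurent A) (laurent B)
  (@gmap _ lsupports A B h) gmap_is_additive.

End GSerAdditive.

Section GSerDerivation.
Context (A : comNzRingType) (D : {additive A -> A}).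
Hypothesis DM : forall a b, D (a * b) = D a * b + a * D b.

Lemma gmap_derivation (f g : laurent A) :
  gmap D (f * g) = gmap D f * g + f * gmap D g.
Proof.
apply: gserP => k; have [s [sm sE]] := gcoefM_sum f g k.
have sub (F : laurent A) : gsupp (gmap D F) `<=` gsupp F.
  by move=> p; rewrite /gsupp /=; apply: contra_neq => ->; rewrite raddf0.
rewrite gcoefD (sE _ (gmap D f) g)// (sE _ f (gmap D g))//.
rewrite -[LHS]/(D ((f * g) k)) (sE _ f g)// raddf_sum -big_split.
by apply: eq_bigr => p _; rewrite DM.
Qed.

Lemma gmap_lam (f : laurent A) : gmap D (lam A * f) = lam A * gmap D f.
Proof. by apply: gserP => k; rewrite lamME -[LHS]/(D ((lam A * f) k)) lamME. Qed.

End GSerDerivation.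

Section GSerMorphisms.
Context (A B : comNzRingType) (h : {rmorphism A -> B}).

Fact gmap_is_monoid_morphism : monoid_morphism (@gmap _ lsupports A B h).
Proof.
split=> [|f g]; apply: gserP => m.
  rewrite -[LHS]/(h ((1 : laurent A) m)) !gcoef1.
  by case: ifP; rewrite ?rmorph1 ?raddf0.
have [s [sm sE]] := gcoefM_sum f g m.
have sub (F : laurent A) : gsupp (gmap h F) `<=` gsupp F.
  by move=> k; rewrite /gsupp /=; apply: contra_neq => ->; rewrite raddf0.
rewrite (sE _ (gmap h f) (gmap h g))// -[LHS]/(h ((f * g) m)) (sE _ f g)//.
by rewrite rmorph_sum; apply: eq_bigr => p _; rewrite rmorphM.
Qed.
HB.instance Definition _ := GRing.isMonoidMorphism.Build (laurent A) (laurent B)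
  (@gmap _ lsupports A B h) gmap_is_monoid_morphism.

End GSerMorphisms.

(** The computation behind [self_similar_comm], with a, p the inverse and direct dressing matrices
    and k the defect: the l terms cancel, and the intertwining hypotheses turn the commutator of u
    and k into one with j. *)
Lemma conj_commutator (R : pzRingType) n (a k p l u j : 'M[R]_n) :
  j *m a = a *m u -> p *m j = u *m p ->
  (- (a *m l) *m k + a *m (l *m k - k *m l - (k *m u - u *m k))) *m p
    + a *m k *m (l *m p)
  = j *m (a *m k *m p) - a *m k *m p *m j.
Proof.
move=> ja pj.
have -> : j *m (a *m k *m p) = a *m (u *m k) *m p by rewrite !mulmxA ja.
have -> : a *m k *m p *m j = a *m (k *m u) *m p by rewrite -!mulmxA pj.
have -> : a *m k *m (l *m p) = a *m (k *m l) *m p by rewrite !mulmxA.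
rewrite mulNmx -mulmxA -mulmxN -mulmxDr -mulmxDl -mulmxDr -mulmxBl -mulmxBr.
congr (_ *m _ *m _); move: (l *m k) (k *m l) (k *m u) (u *m k) => b c d e.
rewrite opprB !addrA addNr add0r addrC !addrA.
by rewrite addrAC subrK addrC.
Qed.

(** * Derivations of conjugates and leading powers *)

Section Conjugation.
Context (A : comNzRingType).
Implicit Types (psi X Y k : 'M[laurent A]_2).

Lemma AdM psi X Y : \det psi = 1 -> Ad psi (X *m Y) = Ad psi X *m Ad psi Y.
Proof. by move=> /det_adjK[_ K]; rewrite /Ad -!mulmxA (mulmxA _ psi) K mul1mx. Qed.

Lemma AdN psi X : Ad psi (- X) = - Ad psi X.
Proof. by rewrite /Ad mulmxN mulNmx. Qed.

Lemma AdZ psi (c : laurent A) X : Ad psi (c *: X) = c *: Ad psi X.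
Proof. by rewrite /Ad -scalemxAr -scalemxAl. Qed.

Lemma dle_Ad psi X d : unip psi -> dle d X -> dle d (Ad psi X).
Proof.
move=> psiu Xd; rewrite -[d]addr0; apply: dleM; last exact/dle_adj/unip_dle.
by rewrite -[d]add0r; apply: dleM => //; exact: unip_dle.
Qed.

Lemma mulmx_det1_inj psi X Y : \det psi = 1 -> X *m psi = Y *m psi -> X = Y.
Proof.
move=> /det_adjK[K _] /(congr1 (mulmx^~ (\adj psi))).
by rewrite -!mulmxA K !mulmx1.
Qed.

Lemma derivation_adj (D : 'M[laurent A]_2 -> 'M[laurent A]_2) psi k :
  (forall X Y, D (X *m Y) = D X *m Y + X *m D Y) ->
  \det psi = 1 -> D psi = k *m psi -> D (\adj psi) = - (\adj psi *m k).
Proof.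
move=> DM /det_adjK[psiK Kpsi] Dpsi.
have D1 : D 1%:M = 0.
  by have := DM 1%:M 1%:M; rewrite !mul1mx mulmx1 => /eqP; rewrite -subr_eq subrr => /eqP.
have : D (psi *m \adj psi) = 0 by rewrite psiK.
rewrite DM Dpsi -mulmxA psiK mulmx1 => /eqP; rewrite addrC addr_eq0 => /eqP E.
by rewrite -[LHS]mul1mx -Kpsi -mulmxA E mulmxN.
Qed.

Lemma derivation_Ad (D : 'M[laurent A]_2 -> 'M[laurent A]_2) psi k Y :
  (forall X Y, D (X *m Y) = D X *m Y + X *m D Y) ->
  \det psi = 1 -> D psi = k *m psi ->
  D (Ad psi Y) = k *m Ad psi Y - Ad psi Y *m k + Ad psi (D Y).
Proof.
move=> DM psi1 Dpsi; rewrite /Ad !DM (derivation_adj DM psi1 Dpsi) Dpsi.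
by rewrite mulmxN mulmxDl -!mulmxA addrAC.
Qed.

Lemma laurent_top (f : laurent A) : f != 0 ->
  exists N, f N != 0 /\ forall l, N < l -> f l = 0.
Proof.
move=> f0; have [M fM] := gcoef_small f.
have [k fk] : exists k : int, f k != 0.
  apply: contrapT => nf; case/eqP: f0; apply: gserP => k; apply/eqP.
  by apply: contrapT => /negP fk; apply: nf; exists k.
have kM : k <= M by exact: fM.
have ex : exists n : nat, f (M - n%:Z) != 0.
  by exists `|M - k|%N; rewrite gez0_abs ?subr_ge0// opprB addrC subrK.
case: (ex_minnP ex) => n fn nmin; exists (M - n%:Z); split=> // l nl.
apply/eqP; apply: contraT => fl; have lM : l <= M by exact: fM.
have Ml : M - `|M - l|%N%:Z = l by rewrite gez0_abs ?subr_ge0// subKr.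
by have := nmin `|M - l|%N; rewrite Ml => /(_ fl); lia.
Qed.

End Conjugation.

(** * The defect of self-similarity and its evolution *)

Section Evolution.
Context (C : numFieldType).
Local Notation LT := (laurent (tser C)).
Implicit Types (X Y K : 'M[LT]_2).

Definition pdop n : int -> {additive tser C -> tser C} := fun _ => @pd C n.
Definition evm X : 'M[laurent C]_2 := map_mx (gmap (@ev0 C)) X.

Lemma evmE X i j k : evm X i j k = ev0 (X i j k).
Proof. by rewrite mxE. Qed.

Lemma evmM X Y : evm (X *m Y) = evm X *m evm Y.
Proof. exact: map_mxM. Qed.

Lemma evmN X : evm (- X) = - evm X.
Proof. exact: map_mxN. Qed.

Lemma evmB X Y : evm (X - Y) = evm X - evm Y.
Proof. exact: map_mxB. Qed.

Lemma evm_adj X : evm (\adj X) = \adj (evm X).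
Proof. exact: map_mx_adj. Qed.

Lemma evm_Ad X Y : evm (Ad X Y) = Ad (evm X) (evm Y).
Proof. by rewrite /Ad !evmM evm_adj. Qed.

Lemma evm_lamJ n : evm (lam (tser C) ^+ n *: Jmx _) = lam C ^+ n *: Jmx C.
Proof.
by apply: mxgP => i j k; rewrite evmE !lamJE rmorph_nat.
Qed.

Definition mxvanish d X := forall i j k, tvanish d (X i j k).

Lemma tvanish_sum d (I : Type) (r : seq I) (F : I -> tser C) :
  (forall i, tvanish d (F i)) -> tvanish d (\sum_(i <- r) F i).
Proof.
move=> Fd; elim/big_rec: _ => [|i x _ xd]; first exact: tvanish0.
exact: tvanishD.
Qed.

Lemma mxvanishMr d X Y : mxvanish d X -> mxvanish d (X *m Y).
Proof.
move=> Xd i j k; rewrite mulmxgE; apply: tvanish_sum => l.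
have [s [_ sE]] := gcoefM_sum (X i l) (Y l j) k.
by rewrite (sE _ (X i l) (Y l j))//; apply: tvanish_sum => p; exact: tvanishMr.
Qed.

Lemma mxvanishMl d X Y : mxvanish d X -> mxvanish d (Y *m X).
Proof.
move=> Xd i j k; rewrite mulmxgE; apply: tvanish_sum => l.
rewrite mulrC; have [s [_ sE]] := gcoefM_sum (X l j) (Y i l) k.
by rewrite (sE _ (X l j) (Y i l))//; apply: tvanish_sum => p; exact: tvanishMr.
Qed.

(** The right-hand side is linear in K: if K vanishes to order d in t, so do all its derivatives,
    and K = 0 at t = 0 raises the order to d + 1. *)
Lemma evolution_unique (U : nat -> 'M[LT]_2) K :
  (forall n, gop (pdop n) K = Pminus (U n *m K - K *m U n)) -> evm K = 0 -> K = 0.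
Proof.
move=> KE K0; suff KV d : mxvanish d K.
  by apply: mxgP => i j k; rewrite mxE; apply: tvanish_eq0 => d; exact: KV.
elim: d => [|d IHd] i j k; first by move=> m; rewrite ltn0.
apply: tvanish_pd => [|n]; first by rewrite -evmE K0 mxE.
rewrite -[pd n _]/(pdop n (prdeg i j k) (K i j k)) -gopE KE PminusE.
case: ifP => _; first exact: tvanish0.
rewrite mxgB; apply: tvanishD; last apply: tvanishN.
  exact: mxvanishMl.
exact: mxvanishMr.
Qed.

Definition scl (c : C) : LT := (c%:A)%:A.

Lemma mxgZ c X i j k : (scl c *: X) i j k = c *: X i j k.
Proof. by rewrite mxE laurentAM gcoefZ -scalerAl mul1r. Qed.

Lemma Pminus_scl c X : Pminus (scl c *: X) = scl c *: Pminus X.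
Proof.
by apply: mxgP => i j k; rewrite mxgZ !PminusE mxgZ; case: ifP; rewrite ?scaler0.
Qed.

Lemma evm_lam : gmap (@ev0 C) (lam (tser C)) = lam C.
Proof.
apply: gserP => k; rewrite -[LHS]/(ev0 (lam (tser C) k)) -[lam _]expr1 lamXE.
by rewrite -[lam C]expr1 lamXE rmorph_nat.
Qed.

Lemma evm_commutant (Z : 'M[LT]_2) : Z 1 1 = Z 0 0 -> Z 1 0 = lam _ * Z 0 1 ->
  evm Z = (evm Z 0 0)%:M + evm Z 0 1 *: Jmx C.
Proof.
move=> Z11 Z10; apply/matrixP => i j; rewrite !mxE.
elim/ord2_ind: i; elim/ord2_ind: j; rewrite /= ?Z11 ?Z10 ?mulr0 ?mulr1 ?addr0 ?add0r//.
by rewrite rmorphM mulrC /= evm_lam.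
Qed.

(** The components d, e transversal to the centralizer of J satisfy d' = 2 e and e' = 2 lambda d, so
    d'' = 4 lambda d. Differentiation in t_1 does not raise the power of lambda, whereas the right
    side does; a leading coefficient of d is impossible. *)
Lemma commutator_flow (Z : 'M[LT]_2) :
  gop (pdop 0) Z = Jmx _ *m Z - Z *m Jmx _ ->
  Z 1 1 = Z 0 0 /\ Z 1 0 = lam _ * Z 0 1.
Proof.
move=> DZ; pose D : {additive LT -> LT} := gmap (@pd C 0).
have DE i j : D (Z i j) = (Jmx _ *m Z - Z *m Jmx _) i j.
  by rewrite -DZ; apply: gserP => k; rewrite gopE.
pose d := Z 0 0 - Z 1 1; pose e := Z 1 0 - lam _ * Z 0 1.
have Dd : D d = 2%:R * e.
  by rewrite raddfB !DE !mxBE !mulmx2E !JmxE /e; ring.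
have De : D e = 2%:R * (lam _ * d).
  rewrite raddfB [D (_ * _)]gmap_lam -[gmap _ _]/(D (Z 0 1)) !DE.
  by rewrite !mxBE !mulmx2E !JmxE /d; ring.
have Dn f n : D (n%:R * f) = n%:R * D f by rewrite !mulr_natl raddfMn.
have DDd : D (D d) = 4%:R * (lam _ * d) by rewrite Dd Dn De; ring.
have d0 : d = 0.
  apply/eqP; apply: contraT => /laurent_top[N [dN dgt]].
  have : D (D d) (N + 1) = (4%:R * (lam _ * d)) (N + 1) by rewrite DDd.
  rewrite mulr_natl gcoefMn lamME addrK -[LHS]/(pd 0 (pd 0 (d (N + 1)))).
  have pd0 : pd 0 (0 : tser C) = 0 by exact: raddf0.
  have dN1 : d (N + 1) = 0 by apply: dgt; lia.
  rewrite dN1 !pd0 => /esym E; case/eqP: dN.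
  by apply: gserP => m; apply: (@mulrnS_inj _ 3); rewrite mul0rn -gcoefMn E.
have e0 : e = 0.
  have : D d = 0 by rewrite d0 raddf0.
  rewrite Dd mulr_natl => E; apply: gserP => k; apply: gserP => m.
  apply: (@mulrnS_inj _ 1); rewrite mul0rn -gcoefMn -gcoefMn.
  by rewrite E.
by split; apply/eqP; [rewrite eq_sym|]; rewrite -subr_eq0; apply/eqP.
Qed.

Section Dilation.
Context (sigma : C) (theta : {poly C}).

Definition xop_fun (d : int) (a : tser C) : tser C :=
  vfield sigma theta a - (sigma * d%:~R / 2%:R) *: a.

Fact xop_is_additive d : zmod_morphism (xop_fun d).
Proof. by move=> a b; rewrite /xop_fun raddfB scalerBr; ring. Qed.
HB.instance Definition _ d :=
  GRing.isZmodMorphism.Build (tser C) (tser C) (xop_fun d) (xop_is_additive d).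
Definition xop : int -> {additive tser C -> tser C} := fun d => xop_fun d.
Local Notation XX := (gop xop).

Lemma xopM d e a b : xop (d + e) (a * b) = xop d a * b + a * xop e b.
Proof.
rewrite /= /xop_fun vfieldM mulrBl mulrBr addrACA -opprD; congr (_ - _).
rewrite -scalerAl -scalerAr -scalerDl; congr (_ *: _).
by rewrite rmorphD /=; ring.
Qed.

Lemma pdopM n d e a b : pdop n (d + e) (a * b) = pdop n d a * b + a * pdop n e b.
Proof. exact: pdM. Qed.

Lemma pdop_xop n X : gop (pdop n) (XX X) =
  XX (gop (pdop n) X) + scl (sigma * (n%:R + 2%:R^-1)) *: gop (pdop n) X.
Proof.
apply: mxgP => i j k; rewrite mxgD mxgZ !gopE /= /xop_fun.
by rewrite (raddfB (pd n)) /= pd_vfield pdZ addrAC.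
Qed.

(** lambda^n J has principal degree 2n + 1. The constant is the one in [pdop_xop] with opposite
    sign, which is why its contributions cancel in the evolution of the defect. *)
Lemma xop_lamJ n : XX (lam (tser C) ^+ n *: Jmx _) =
  - (scl (sigma * (n%:R + 2%:R^-1)) *: (lam (tser C) ^+ n *: Jmx _)).
Proof.
apply: mxgP => i j k; rewrite mxgN mxgZ gopE !lamJE.
case: eqP => [->|_]; last by rewrite raddf0 scaler0 oppr0.
rewrite -[1%:R]scale1r /= /xop_fun vfieldA sub0r scalerA mulr1; congr (- (_ *: _)).
  by rewrite -[n.*2.+1%:~R]/(n.*2.+1%:R) -addn1 -muln2 natrD natrM; field.
by rewrite scale1r.
Qed.

Context (psi : 'M[LT]_2).
Hypotheses (psiu : unip psi) (psi1 : \det psi = 1).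
Let Lam n := Ad psi (lam (tser C) ^+ n *: Jmx _).
Let U n := Pplus (Lam n).
Let L n := - Pminus (Lam n).
Hypothesis psiE : forall n, gop (pdop n) psi = L n *m psi.

Definition defect := XX psi *m \adj psi.
Local Notation K := defect.

Lemma xop_psi : XX psi = K *m psi.
Proof. by rewrite -mulmxA (det_adjK psi1).2 mulmx1. Qed.

Lemma dle_defect : dle (-1) K.
Proof.
rewrite -[-1]addr0; apply: dleM.
  rewrite (_ : XX psi = XX (psi - 1%:M)); last by rewrite gopB (gop1 xopM) subr0.
  exact: dle_gop.
exact/dle_adj/unip_dle.
Qed.

Lemma xop_Lam n : XX (Lam n) =
  K *m Lam n - Lam n *m K - scl (sigma * (n%:R + 2%:R^-1)) *: Lam n.
Proof.
rewrite /Lam (derivation_Ad _ (gopM xopM) psi1 xop_psi) xop_lamJ; congr (_ + _).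
by rewrite AdN AdZ.
Qed.

(** The compatibility condition of d_n psi = L_n psi with (X - delta) psi = K psi: both orders of
    differentiation are compared, and psi is cancelled on the right. *)
Lemma defect_evolution_gen n :
  gop (pdop n) K = L n *m K - K *m L n - Pminus (K *m Lam n - Lam n *m K).
Proof.
set s := scl (sigma * (n%:R + 2%:R^-1)).
have E1 : gop (pdop n) (XX psi) = gop (pdop n) K *m psi + K *m (L n *m psi).
  by rewrite xop_psi (gopM (@pdopM n)) psiE.
have XL : XX (L n) = - Pminus (K *m Lam n - Lam n *m K) - s *: L n.
  rewrite /L gopN gop_Pminus xop_Lam PminusB Pminus_scl -/s opprB scalerN opprK.
  by rewrite addrC.
have E2 : gop (pdop n) (XX psi) = (XX (L n) + L n *m K + s *: L n) *m psi.
  rewrite pdop_xop psiE (gopM xopM) xop_psi mulmxA -!mulmxDl -/s.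
  by rewrite scalemxAl -mulmxDl.
have : (gop (pdop n) K + K *m L n) *m psi = (XX (L n) + L n *m K + s *: L n) *m psi.
  by rewrite -E2 E1 mulmxDl mulmxA.
move=> /(mulmx_det1_inj psi1) E; apply: (addIr (K *m L n)); rewrite E XL.
by rewrite [- _ - _ + L n *m K]addrAC subrK [RHS]addrAC subrK addrC.
Qed.

Lemma Lam_split n : Lam n = U n - L n.
Proof. by rewrite opprK Pplus_Pminus. Qed.

Lemma dle_L n : dle (-1) (L n).
Proof. by apply: dleN; exact: dle_Pminus. Qed.

Lemma dle_comm d e X Y : dle d X -> dle e Y -> dle (d + e) (X *m Y - Y *m X).
Proof. by move=> Xd Ye; apply: dleB; [|rewrite addrC]; exact: dleM. Qed.

(** The commutator of L_n and K has negative degree, hence is fixed by [Pminus] and cancels against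
    the same term coming from Lam_n = U_n - L_n. What remains is in the form required by
    [evolution_unique]. *)
Lemma defect_evolution n : gop (pdop n) K = Pminus (U n *m K - K *m U n).
Proof.
rewrite defect_evolution_gen Lam_split mulmxBr mulmxBl.
rewrite (_ : L n *m K - K *m L n = Pminus (L n *m K - K *m L n)); last first.
  rewrite Pminus_id//; apply: dle_trans (dle_comm (dle_L n) dle_defect).
  by rewrite /=; lia.
rewrite -PminusB; congr Pminus.
move: (L n *m K) (K *m L n) (U n *m K) (K *m U n) => a b c d.
by apply: mxgP => i j k; rewrite !(mxgD, mxgN); ring.
Qed.

(** Ad psi Z commutes with Lam_n because Z commutes with J, so its commutators with L_n and U_n
    coincide and it solves the system of the defect. *)
Lemma conj_evolution n Z : gop (pdop n) Z = 0 -> dle (-1) Z ->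
  Z *m Jmx _ = Jmx _ *m Z ->
  gop (pdop n) (Ad psi Z) = Pminus (U n *m Ad psi Z - Ad psi Z *m U n).
Proof.
move=> DZ Zd ZJ; have ZL : Ad psi Z *m Lam n = Lam n *m Ad psi Z.
  by rewrite /Lam -!AdM// -scalemxAr -scalemxAl ZJ.
have Ad0 : Ad psi 0 = 0 by rewrite /Ad mulmx0 mul0mx.
have E := derivation_Ad Z (gopM (@pdopM n)) psi1 (psiE n).
rewrite DZ Ad0 addr0 in E.
have UE : U n = L n + Lam n by rewrite Lam_split addrC subrK.
have -> : U n *m Ad psi Z - Ad psi Z *m U n = gop (pdop n) (Ad psi Z).
  by rewrite E UE mulmxDl mulmxDr ZL opprD addrACA subrr addr0.
by rewrite Pminus_id//; apply: dle_gop; exact: dle_Ad.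
Qed.

Lemma defect_conj Z : (forall n, gop (pdop n) Z = 0) -> dle (-1) Z ->
  Z *m Jmx _ = Jmx _ *m Z -> evm K = evm (Ad psi Z) -> K = Ad psi Z.
Proof.
move=> DZ Zd ZJ K0; apply/eqP; rewrite -subr_eq0; apply/eqP.
apply: (@evolution_unique U) => [n|]; last by rewrite evmB K0 subrr.
rewrite gopB defect_evolution conj_evolution// -PminusB; congr Pminus.
rewrite mulmxBr mulmxBl; move: (_ *m K) (K *m _) (_ *m Ad _ _) (Ad _ _ *m _) => a b c d.
by rewrite !opprB addrACA [RHS]addrACA [- b - c]addrC.
Qed.

Context (v : tser C).
Hypothesis psiv : Pplus (Ad psi (Jmx _)) = mx2 (- v%:A) 1 (lam (tser C)) v%:A.

Lemma Lam0 : Lam 0 = Ad psi (Jmx _).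
Proof. by rewrite /Lam expr0 scale1r. Qed.

Lemma Lam_diag : (Lam 0 0 0 0 = - v) * (Lam 0 1 1 0 = v).
Proof.
have E i j k : 0 <= prdeg i j k -> Lam 0 i j k =
    (mx2 (- v%:A) 1 (lam (tser C)) v%:A) i j k.
  by move=> d; rewrite Lam0 -psiv PplusE d.
split; rewrite E// mxE.
  by rewrite -[LHS]/((- v%:A : LT) 0) gcoefN laurentAE.
by rewrite -[LHS]/((v%:A : LT) 0) laurentAE.
Qed.

(** Once K = Ad psi Z commutes with Lam_0, [xop_Lam] makes Lam_0 an eigenvector of X - delta for
    -sigma/2; its diagonal at lambda^0 carries v in degree 0, where X - delta is X. *)
Lemma self_similar_defect Z : (forall n, gop (pdop n) Z = 0) -> dle (-1) Z ->
  Z *m Jmx _ = Jmx _ *m Z -> evm K = evm (Ad psi Z) -> self_similar sigma theta v.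
Proof.
move=> DZ Zd ZJ /(defect_conj DZ Zd ZJ) KE.
have := xop_Lam 0; rewrite KE {2 3}Lam0 -!AdM// ZJ subrr sub0r.
move=> /(congr1 (fun X : 'M[LT]_2 => X 0 0 0)).
rewrite gopE mxgN mxgZ Lam_diag /= /xop_fun /prdeg /= mul0rn addr0 subr0 mulr0z.
rewrite mulr0 mul0r scale0r subr0 raddfN add0r scalerN /self_similar => E.
by apply/eqP; rewrite addr_eq0 -eqr_oppLR E opprK.
Qed.

Lemma self_similar_comm : self_similar sigma theta v ->
  gop (pdop 0) (\adj psi *m K *m psi) =
  Jmx _ *m (\adj psi *m K *m psi) - (\adj psi *m K *m psi) *m Jmx _.
Proof.
move=> ss; have [psiK Kpsi] := det_adjK psi1.
(* Degrees -1 and 1 give degree at most 0. In degree 0 only diagonal entries at lambda^0 occur, and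
   they are (X + sigma/2) v up to sign. *)
have dc : dle (-1) (K *m Lam 0 - Lam 0 *m K).
  have d0 : dle 0 (K *m Lam 0 - Lam 0 *m K).
    apply: (@dle_comm (-1) 1) => //; first exact: dle_defect.
    by apply: dle_Ad => //; exact: (@dle_lamJ _ 0).
  have E := xop_Lam 0; set X := K *m Lam 0 - _ in E d0 *.
  have {}E i j k : X i j k = XX (Lam 0) i j k + (sigma / 2%:R) *: Lam 0 i j k.
    by rewrite E [in RHS]mxgB [in RHS]mxgZ add0r subrK.
  move=> i j k d; have [d1|] := ltP 0 (prdeg i j k); first exact: d0.
  move=> d1; have {d d1} d : prdeg i j k = 0 by lia.
  rewrite E gopE d /= /xop_fun mulr0z mulr0 mul0r scale0r subr0.
  move: d; rewrite /prdeg; elim/ord2_ind: i; elim/ord2_ind: j => /= d; try lia.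
    have -> : k = 0 by lia.
    by rewrite Lam_diag raddfN scalerN -opprD ss oppr0.
  have -> : k = 0 by lia.
  by rewrite Lam_diag ss.
have := defect_evolution_gen 0; rewrite Pminus_id// => DK.
have DM := gopM (@pdopM 0).
rewrite (DM (\adj psi *m K) psi) (DM (\adj psi) K).
rewrite (derivation_adj DM psi1 (psiE 0)) psiE.
have JL : Jmx _ *m \adj psi = \adj psi *m Lam 0.
  by rewrite Lam0 /Ad !mulmxA Kpsi mul1mx.
have LJ : psi *m Jmx _ = Lam 0 *m psi.
  by rewrite Lam0 /Ad -!mulmxA Kpsi mulmx1.
rewrite DK; exact: conj_commutator.
Qed.

Lemma self_similar_conj : self_similar sigma theta v ->
  exists x y : laurent C,
    [/\ forall k, 0 <= k -> x k = 0, negative_powers y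
      & evm K = Ad (evm psi) (x%:M + y *: Jmx C)].
Proof.
move=> /self_similar_comm; set Kt := _ *m psi => DK.
have Ktd : dle (-1) Kt.
  rewrite /Kt -[-1]add0r -[0 + _]addr0; apply: dleM; last exact: unip_dle.
  by apply: dleM; [exact/dle_adj/unip_dle|exact: dle_defect].
have [K11 K10] := commutator_flow DK.
exists (evm Kt 0 0), (evm Kt 0 1); split=> [k k0|k k0|].
- by rewrite evmE Ktd ?raddf0// /prdeg /=; lia.
- by rewrite evmE Ktd ?raddf0// /prdeg /=; lia.
have -> : K = Ad psi Kt.
  have [psiK _] := det_adjK psi1.
  by rewrite /Ad /Kt !mulmxA psiK mul1mx -mulmxA psiK mulmx1.
by rewrite evm_Ad; congr Ad; exact: evm_commutant.
Qed.
End Dilation.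

End Evolution.

(** * Jet interpolation and digit expansions *)

Section Polynomials.
Context (C : numFieldType).
Implicit Types (p w : {poly C}).

Lemma poly_eq0_nat p : (forall n : nat, p.[n%:R] = 0) -> p = 0.
Proof.
move=> p0; apply/eqP; apply: contraT => pn0.
have := @max_poly_roots _ p [seq n%:R | n <- iota 0 (size p)] pn0.
rewrite size_map size_iota ltnn; apply.
  by apply/allP => _ /mapP[n _ ->]; apply/rootP.
by rewrite map_inj_uniq ?iota_uniq// => i j /eqP; rewrite eqr_nat => /eqP.
Qed.

Lemma deriv_eq0 p : p^`() = 0 -> p = (p`_0)%:P.
Proof.
move=> p0; apply/polyP => -[|i]; rewrite coefC //=.
by apply: (@mulrnS_inj _ i); rewrite -coef_deriv p0 coef0 mul0rn.
Qed.

Lemma derivn_XsubC_exp c (j i : nat) p : (i < j)%N ->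
  exists q, (('X - c%:P) ^+ j * p)^`(i) = ('X - c%:P) ^+ (j - i) * q.
Proof.
elim: i => [|i IHi] ij; first by exists p; rewrite subn0.
have [q qE] := IHi (ltnW ij); rewrite derivnS qE.
have -> : (j - i = (j - i.+1).+1)%N by lia.
exists (q *+ (j - i.+1).+1 + ('X - c%:P) * q^`()).
rewrite derivM deriv_exp derivXsubC mul1r /= exprS -mulr_natr -[q *+ _]mulr_natr; ring.
Qed.

Lemma jet_interpolation (k : nat) (a : nat -> C) : exists w,
  forall i, (i < k)%N -> w^`(i).[0] = a i /\ w^`(i).[1] = 0.
Proof.
(* p is the Taylor polynomial with the wanted jet at 0; e is 1 modulo X^k and divisible by (X -
   1)^k, so e p keeps the jet at 0 and has zero jet at 1. *)
pose p := \poly_(i < k) (a i / (i`!)%:R).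
pose e : {poly C} := (1 - 'X^k) ^+ k.
exists (e * p) => i ik; split.
  have [r eE] : exists r, e = 1 + 'X^k * r.
    pose r := \sum_(j < k) (1 - 'X^k : {poly C}) ^+ j.
    exists (- r); have := subrX1 (1 - 'X^k : {poly C}) k; rewrite -/e -/r => E.
    by rewrite -[LHS](subrK 1) E addrC addrAC subrr add0r mulNr mulrN.
  rewrite horner_coef0 coef_derivn addn0 eE mulrDl mul1r coefD coef_poly ik.
  by rewrite -mulrA coefXnM ik addr0 ffactnn -[_ *+ _]mulr_natr divfK// pnatr_eq0 -lt0n fact_gt0.
have [s eE] : exists s, e = ('X - 1%:P) ^+ k * s.
  exists ((- \sum_(j < k) 'X^j) ^+ k); rewrite -exprMn; congr (_ ^+ _).
  by rewrite mulrN polyC1 -subrX1 opprB.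
rewrite eE -mulrA; have [q ->] := @derivn_XsubC_exp 1 k i (s * p) ik.
by rewrite hornerM horner_exp hornerXsubC subrr expr0n subn_eq0 leqNgt ik mul0r.
Qed.

(** Ensures that Kronecker substitution sends distinct exponent vectors to distinct powers. *)
Lemma digits_inj (B k : nat) (a b : nat -> nat) :
  (forall i, i < k -> a i < B)%N -> (forall i, i < k -> b i < B)%N ->
  (\sum_(i < k) a i * B ^ i = \sum_(i < k) b i * B ^ i)%N ->
  forall i, (i < k)%N -> a i = b i.
Proof.
elim: k a b => [|k IHk] a b aB bB; first by move=> _ i; rewrite ltn0.
rewrite !big_ord_recl !expn0 !muln1 => E.
have S (c : nat -> nat) : (\sum_(i < k) c (bump 0 i) * B ^ bump 0 i =
    (\sum_(i < k) c i.+1 * B ^ i) * B)%N.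
  by rewrite big_distrl; apply: eq_bigr => i _; rewrite expnSr mulnA.
rewrite !S in E.
have E0 : a 0%N = b 0%N.
  have /(congr1 (modn^~ B)) := E; rewrite ![(_ + _ * B)%N]addnC !modnMDl.
  by rewrite !modn_small ?aB ?bB.
have B0 : (0 < B)%N by apply: leq_ltn_trans (aB 0%N _).
move: E; rewrite E0 => /addnI/eqP; rewrite eqn_pmul2r// => /eqP E.
case=> [//|i] ik; apply: (IHk (a \o succn) (b \o succn)) => // j jk /=.
  exact: aB.
exact: bB.
Qed.

End Polynomials.

(** * Differential polynomials with zero derivative *)

Section DifferentialPolynomials.
Import mpoly.
Context (C : numFieldType).
Implicit Types (F G : tser C -> tser C).

(** An inductive form of [differential_polynomial], convenient for closure under derivation and
    products; [dpol_mmap] returns to an actual polynomial. *)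
Inductive dpol : (tser C -> tser C) -> Prop :=
| dpol_const c : dpol (fun=> c%:A)
| dpol_jet i : dpol (fun u => iter i (pd 0) u)
| dpol_add F G : dpol F -> dpol G -> dpol (fun u => F u + G u)
| dpol_mul F G : dpol F -> dpol G -> dpol (fun u => F u * G u).

Lemma dpol_scale c F : dpol F -> dpol (fun u => c *: F u).
Proof.
move=> /(dpol_mul (dpol_const c)); congr dpol; apply/funext => u.
by rewrite -scalerAl mul1r.
Qed.

Lemma dpol_opp F : dpol F -> dpol (fun u => - F u).
Proof.
by move=> /(dpol_scale (-1)); congr dpol; apply/funext => u; rewrite scaleN1r.
Qed.

Lemma dpol_sum I (r : seq I) (F : I -> tser C -> tser C) :
  (forall i, dpol (F i)) -> dpol (fun u => \sum_(i <- r) F i u).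
Proof.
move=> Fd; elim: r => [|i r IHr].
  have := dpol_const 0; congr dpol; apply/funext => u.
  by rewrite big_nil scale0r.
have := dpol_add (Fd i) IHr; congr dpol; apply/funext => u.
by rewrite big_cons.
Qed.

Lemma dpol_prod I (r : seq I) (F : I -> tser C -> tser C) :
  (forall i, dpol (F i)) -> dpol (fun u => \prod_(i <- r) F i u).
Proof.
move=> Fd; elim: r => [|i r IHr].
  have := dpol_const 1; congr dpol; apply/funext => u.
  by rewrite big_nil scale1r.
have := dpol_mul (Fd i) IHr; congr dpol; apply/funext => u.
by rewrite big_cons.
Qed.

Lemma dpol_exp n F : dpol F -> dpol (fun u => F u ^+ n).
Proof.
move=> Fd; have := @dpol_prod 'I_n (index_enum 'I_n) (fun=> F) (fun=> Fd); congr dpol.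
by apply/funext => u; rewrite prodr_const card_ord.
Qed.

Lemma dpol_pd F : dpol F -> dpol (fun u => pd 0 (F u)).
Proof.
elim=> {F} [c|i|F G _ IHF _ IHG|F G Fd IHF Gd IHG].
- have := dpol_const 0; congr dpol; apply/funext => u.
  by rewrite pdA scale0r.
- exact: (dpol_jet i.+1).
- have := dpol_add IHF IHG; congr dpol; apply/funext => u.
  by rewrite raddfD.
- have := dpol_add (dpol_mul IHF Gd) (dpol_mul Fd IHG); congr dpol.
  by apply/funext => u; rewrite pdM.
Qed.

Lemma differential_polynomial_dpol F : differential_polynomial F -> dpol F.
Proof.
move=> [k [P FP]]; have -> : F = fun u =>
    mpoly.mmap (fun c : C => c%:A) (fun i : 'I_k => iter i (pd 0) u) P.
  exact/funext.
rewrite /mpoly.mmap; apply: dpol_sum => m; apply: dpol_mul; first exact: dpol_const.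
rewrite /mpoly.mmap1; apply: dpol_prod => i; apply: dpol_exp; exact: dpol_jet.
Qed.

Lemma mmap_rmorph (S T : comNzRingType) (phi : {rmorphism S -> T}) k
    (f : C -> S) (f' : C -> T) (h : 'I_k -> S) (h' : 'I_k -> T) (P : mpoly.mpoly k C) :
  (forall c, phi (f c) = f' c) -> (forall i, phi (h i) = h' i) ->
  phi (mpoly.mmap f h P) = mpoly.mmap f' h' P.
Proof.
move=> ff hh; rewrite /mpoly.mmap rmorph_sum; apply: eq_bigr => m _.
rewrite rmorphM ff /mpoly.mmap1 rmorph_prod; congr (_ * _).
by apply: eq_bigr => i _; rewrite rmorphXn hh.
Qed.

(** Allowing every sufficiently large number of jet variables lets the polynomials of two operands
    be taken in the same ring. *)
Lemma dpol_mmap F : dpol F -> exists k0, forall k, (k0 <= k)%N ->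
  exists P : mpoly.mpoly k C, forall u, F u =
    mpoly.mmap (in_alg (tser C)) (fun i : 'I_k => iter i (pd 0) u) P.
Proof.
elim=> {F} [c|i|F G _ [k1 F1] _ [k2 G2]|F G _ [k1 F1] _ [k2 G2]].
- exists 0%N => k _; exists (mpoly.mpolyC k c) => u.
  by rewrite mpoly.mmapC.
- exists i.+1 => k ik; exists (mpoly.mpolyX C (mpoly.mnm1 (Ordinal ik))) => u.
  by rewrite mpoly.mmapX mpoly.mmap1U.
- exists (maxn k1 k2) => k; rewrite geq_max => /andP[/F1[P FP] /G2[Q GQ]].
  by exists (P + Q) => u; rewrite FP GQ mpoly.mmapD.
- exists (maxn k1 k2) => k; rewrite geq_max => /andP[/F1[P FP] /G2[Q GQ]].
  exists (P * Q) => u; rewrite FP GQ; apply/esym.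
  exact: (rmorphM (mpoly.mmap (in_alg (tser C)) _)).
Qed.


Local Notation iota1 := (horner_alg (tvar C 0)).

Lemma pd_tvar n : pd n (tvar C n) = 1.
Proof.
apply: gserP => m; rewrite -[tvar C n]mulr1 -[LHS]/((tvar C n * 1) (m + 'X^n) *+ (m`_n)%R.+1).
rewrite tvarME gcoef1; case: eqP => [->|_]; last by rewrite mul0rn.
by rewrite coef0.
Qed.

Lemma pd_horner_alg (w : {poly C}) : pd 0 (iota1 w) = iota1 w^`().
Proof.
elim/poly_ind: w => [|p c IHp]; first by rewrite deriv0 !rmorph0 raddf0.
rewrite derivMXaddC !rmorphD !rmorphM /= !horner_algC !horner_algX.
by rewrite raddfD /= pdA addr0 pdM pd_tvar mulr1 IHp addrC.
Qed.

Lemma iter_pd_horner_alg i (w : {poly C}) : iter i (pd 0) (iota1 w) = iota1 w^`(i).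
Proof. by elim: i => // i IHi; rewrite iterS IHi pd_horner_alg -derivnS. Qed.

Lemma ev0_horner_alg (w : {poly C}) : ev0 (iota1 w) = w.[0].
Proof.
elim/poly_ind: w => [|p c IHp]; first by rewrite !rmorph0 horner0.
rewrite !rmorphD !rmorphM /= !horner_algC !horner_algX hornerMXaddC mulr0.
rewrite ev0A (_ : ev0 (tvar C 0) = 0) ?mulr0//.
rewrite /ev0 /tvar /= (_ : _ == _ = false)//; apply/eqP => /polyP/(_ 0%N).
by rewrite coef0 coefXn.
Qed.

Lemma horner_alg_inj (w : {poly C}) : iota1 w = 0 -> w = 0.
Proof.
move=> w0; apply/polyP => i; rewrite coef0.
have : ev0 (iter i (pd 0) (iota1 w)) = 0.
  rewrite w0; elim: i => [|i IHi]; first exact: rmorph0.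
  by rewrite iterSr (_ : pd 0 (0 : tser C) = 0)//; exact: raddf0.
rewrite iter_pd_horner_alg ev0_horner_alg horner_coef0 coef_derivn addn0 ffactnn.
by rewrite -(prednK (fact_gt0 i)) => E; apply: (@mulrnS_inj _ (i`!).-1); rewrite mul0rn.
Qed.

(* Interpolating arbitrary jets at t_1 = 0 by a polynomial in t_1 with zero
   jets at t_1 = 1 shows that the underlying polynomial is constant on C^k;
   Kronecker substitution then shows that it has no nonconstant monomial. *)
Lemma dpol_const_of_pd F : dpol F -> (forall u, pd 0 (F u) = 0) -> forall u, F u = F 0.
Proof.
move=> /dpol_mmap[k0 /(_ k0 (leqnn _))[P FP]] F0.
set k := k0 in P FP.
pose mev (a : 'I_k -> C) : C := mpoly.mmap idfun a P.
have jets (a : nat -> C) : mev (fun i => a i) = mev (fun=> 0).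
  have [w wa] := jet_interpolation k a.
  pose Q : {poly C} := mpoly.mmap polyC (fun i : 'I_k => w^`(i)) P.
  have QE c : Q.[c] = mev (fun i : 'I_k => w^`(i).[c]).
    rewrite -[Q.[c]]/(horner_eval c Q); apply: mmap_rmorph => [b|i].
      exact: hornerC.
    by [].
  have FQ : F (iota1 w) = iota1 Q.
    rewrite FP; apply/esym/mmap_rmorph => [b|i]; first exact: horner_algC.
    by rewrite iter_pd_horner_alg.
  have /deriv_eq0 Qc : Q^`() = 0.
    by apply: horner_alg_inj; rewrite -pd_horner_alg -FQ F0.
  have -> : mev (fun i => a i) = Q.[0].
    by rewrite QE; congr mev; apply/funext => i; have [->] := wa i (ltn_ord i).
  have -> : mev (fun=> 0) = Q.[1].
    by rewrite QE; congr mev; apply/funext => i; have [_ ->] := wa i (ltn_ord i).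
  by rewrite Qc !hornerC.
pose B := msize P.
pose e (m : 'X_{1..k}) : nat := (\sum_(i < k) m i * B ^ i)%N.
have lt_B (m : 'X_{1..k}) i : m \in msupp P -> (m i < B)%N.
  move=> /msize_mdeg_lt; apply: leq_ltn_trans.
  by rewrite mdegE (bigD1 i)//= leq_addr.
have e_inj m m' : m \in msupp P -> m' \in msupp P -> e m = e m' -> m = m'.
  move=> mP m'P; pose ext (l : 'X_{1..k}) (i : nat) :=
    if insub i is Some j then l j else 0%N.
  have extE l (i : 'I_k) : ext l i = l i by rewrite /ext valK.
  have eE l : e l = (\sum_(i < k) ext l i * B ^ i)%N.
    by apply: eq_bigr => i _; rewrite extE.
  rewrite !eE => /digits_inj E; apply/mnmP => i; rewrite -!extE; apply: E => // {i}l lk.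
    by rewrite -[l]/(val (Ordinal lk)) extE lt_B.
  by rewrite -[l]/(val (Ordinal lk)) extE lt_B.
pose Q : {poly C} := mmap polyC (fun i : 'I_k => 'X^(B ^ i)) P.
have QE : Q = \sum_(m <- msupp P) P@_m *: 'X^(e m).
  apply: eq_bigr => m _; rewrite mul_polyC; congr (_ *: _).
  rewrite /mmap1 /e; elim/big_rec2: _ => [|i x y _ ->]; first by rewrite expr0.
  by rewrite exprD mulnC exprM.
have Qc : Q = (mev (fun=> 0))%:P.
  apply/eqP; rewrite -subr_eq0; apply/eqP; apply: poly_eq0_nat => n.
  rewrite hornerD hornerN hornerC -(jets (fun i => n%:R ^+ (B ^ i))).
  apply/eqP; rewrite subr_eq0; apply/eqP.
  rewrite -[Q.[_]]/(horner_eval n%:R Q); apply: mmap_rmorph => [b|i].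
    exact: hornerC.
  by rewrite /= /horner_eval hornerXn.
have supp0 m : m \in msupp P -> m = 0%MM.
  move=> mP; apply/eqP; apply: contraT => m0.
  have : Q`_(e m) = P@_m.
    rewrite QE coef_sum (bigD1_seq m) ?msupp_uniq//= coefZ coefXn eqxx mulr1.
    rewrite big1_seq ?addr0// => m' /andP[m'm m'P]; rewrite coefZ coefXn.
    by case: eqP => [/(e_inj _ _ mP m'P) E|]; [rewrite E eqxx in m'm|rewrite mulr0].
  rewrite Qc coefC; case: eqP => [em0|_].
    case/eqP: m0; apply/mnmP => i; rewrite mnm0E; move/eqP: em0.
    rewrite sum_nat_eq0 => /forallP/(_ i) /=; rewrite muln_eq0 expn_eq0.
    by have := lt_B _ i mP; case: (B) => // b _; rewrite orbF => /eqP.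
  by move=> /esym/eqP; rewrite mcoeff_eq0 mP.
move=> u; rewrite !FP /mmap; apply: eq_big_seq => m /supp0 ->.
by rewrite !mmap11.
Qed.

End DifferentialPolynomials.

(** * Degree bounds for Laurent series *)

Section LaurentDegree.
Context (A : comNzRingType).
Implicit Types f g : laurent A.

Definition ldeg (d : int) f := forall k, d < k -> f k = 0.

Lemma gcoef_comb3 (a b c : laurent A) (m n : nat) k :
  (a + m%:R * b + n%:R * c) k = a k + m%:R * b k + n%:R * c k.
Proof. by rewrite !gcoefD !gcoefnM. Qed.

Lemma gcoef_comb4 (a b c d : laurent A) (m n l : nat) k :
  (m%:R * a - n%:R * b + c - l%:R * d) k =
  m%:R * a k - n%:R * b k + c k - l%:R * d k.
Proof. by rewrite !gcoefD !gcoefN !gcoefnM. Qed.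

Lemma ldegD d f g : ldeg d f -> ldeg d g -> ldeg d (f + g).
Proof. by move=> fd gd k dk; rewrite gcoefD fd// gd// addr0. Qed.

Lemma ldegN d f : ldeg d f -> ldeg d (- f).
Proof. by move=> fd k dk; rewrite gcoefN fd// oppr0. Qed.

Lemma ldeg_trans d e f : d <= e -> ldeg d f -> ldeg e f.
Proof. by move=> de fd k ek; apply: fd; exact: le_lt_trans ek. Qed.

Lemma ldegM d e f g : ldeg d f -> ldeg e g -> ldeg (d + e) (f * g).
Proof.
move=> fd ge k dek; apply/eqP; apply: contraT => /gcoefM_neq0[p [q [pq fp gq]]].
move: dek; rewrite -pq ltNge lerD// leNgt.
  by apply: contra_neqN fp => /fd.
by apply: contra_neqN gq => /ge.
Qed.

Lemma ldegM_top d e f g : ldeg d f -> ldeg e g -> (f * g) (d + e) = f d * g e.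
Proof.
move=> fd ge; rewrite gcoefM /conv -(fsbig_widen [set (d, e)]).
- by rewrite fsbig_set1.
- by move=> _ ->.
- move=> [p q] [/= pq pn]; apply/eqP; apply: contraT => pq0; exfalso; apply: pn => /=.
  have pd : p <= d by rewrite leNgt; apply: contra_neqN pq0 => /fd ->; rewrite mul0r.
  have qe : q <= e by rewrite leNgt; apply: contra_neqN pq0 => /ge ->; rewrite mulr0.
  by congr pair; lia.
Qed.

Lemma ldeg_gmap (D : {additive A -> A}) d f : ldeg d f -> ldeg d (gmap D f).
Proof. by move=> fd k dk; rewrite -[LHS]/(D (f k)) fd// raddf0. Qed.

Lemma ldegA (a : A) : ldeg 0 (a%:A).
Proof. by move=> k k0; rewrite laurentAE gt_eqF. Qed.

Lemma ldegMn d f n : ldeg d f -> ldeg d (f *+ n).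
Proof. by move=> fd k dk; rewrite gcoefMn fd// mul0rn. Qed.

Lemma gcoefM_le0 f g (n : nat) : ldeg 0 f -> ldeg 0 g ->
  (f * g) (- n%:Z) = \sum_(i < n.+1) f (- i%:Z) * g (- (n - i)%:Z).
Proof.
move=> f0 g0; rewrite gcoefM /conv.
rewrite (fsbig_ord _ n.+1 (fun i : nat => f (- i%:Z) * g (- (n - i)%:Z))).
pose S := [set p | exists2 i : nat, (i < n.+1)%N & p = (- i%:Z, - (n - i)%:Z)].
rewrite -(fsbig_widen S).
- rewrite (reindex_fsbig (fun i : nat => (- i%:Z, - (n - i)%:Z)) `I_n.+1)//.
  split=> [i /= ik|i j _ _ /= [/oppr_inj[]]//|_ [i ik ->]]; first by exists i.
  by exists i.
- by move=> _ [i ik ->] /=; lia.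
- move=> [p q] [/= pq npq]; apply/eqP; apply: contraT => pq0; exfalso; apply: npq.
  have p0 : p <= 0 by rewrite leNgt; apply: contra_neqN pq0 => /f0 ->; rewrite mul0r.
  have q0 : q <= 0 by rewrite leNgt; apply: contra_neqN pq0 => /g0 ->; rewrite mulr0.
  by exists `|p|%N; [lia|congr pair; lia].
Qed.
End LaurentDegree.

(** * The quadratic equation of the Gel'fand-Dickii generating series *)

Section Quadratic.
Context (C : numFieldType).
Local Notation LT := (laurent (tser C)).
Local Notation D := (@gmap _ lsupports _ _ (@pd C 0)).
Local Notation lm := (lam (tser C)).
Implicit Types (u : tser C) (b : LT).

Lemma gmap_pdM b b' : D (b * b') = D b * b' + b * D b'.
Proof. exact: (gmap_derivation (pdM 0)). Qed.

Lemma gmap_pdD b b' : D (b + b') = D b + D b'. Proof. exact: raddfD. Qed.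
Lemma gmap_pdB b b' : D (b - b') = D b - D b'. Proof. exact: raddfB. Qed.
Lemma gmap_pd0 : D 0 = 0. Proof. exact: raddf0. Qed.

Lemma gmap_pdA u : D (u%:A) = (pd 0 u)%:A.
Proof.
apply: gserP => k; rewrite -[LHS]/(pd 0 ((u%:A : LT) k)) !laurentAE.
by case: ifP => // _; exact: raddf0.
Qed.

Lemma gmap_pdE b k : D b k = pd 0 (b k). Proof. by []. Qed.

(* Four times the first integral of the linear third order equation satisfied
   by the resolvent of the Schroedinger operator. *)
Definition quad u b : LT :=
  4%:R * (lm * b * b) - 2%:R * (b * D (D b)) + D b * D b - 4%:R * (u%:A * b * b).

(** If e = b - b' has leading power N, the term 4 lambda e (b + b') has coefficient 8 e_N at
    lambda^(N+1), as b + b' starts with 2; every other term of the difference stops at lambda^N. *)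
Lemma quad_unique u b b' : ldeg 0 b -> ldeg 0 b' -> b 0 = 1 -> b' 0 = 1 ->
  quad u b = quad u b' -> b = b'.
Proof.
move=> b0 b'0 b1 b'1 Q; apply/eqP; rewrite -subr_eq0; apply: contraT.
set e := b - b' => /laurent_top[N [eN egt]].
have bE : b = b' + e by rewrite /e addrC subrK.
have e0 : ldeg 0 e by apply: ldegD => //; exact: ldegN.
have sE : 4%:R * (lm * (e * (b + b'))) = 2%:R * (e * D (D b) + b' * D (D e))
    - (D e * (D b + D b')) + 4%:R * (u%:A * (e * (b + b'))).
  have De : D b = D b' + D e by rewrite bE raddfD.
  have DDe : D (D b) = D (D b') + D (D e) by rewrite De raddfD.
  have : quad u b - quad u b' = 0 by rewrite Q subrr.
  rewrite /quad DDe De; move: bE => ->.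
  move: (D (D b')) (D (D e)) (D b') (D e) => x y z w E.
  by apply/eqP; rewrite -subr_eq0 -E; apply/eqP; ring.
have sN : (4%:R * (lm * (e * (b + b')))) (N + 1) = 0.
  rewrite sE; suff F (f : LT) : ldeg N f -> f (N + 1) = 0.
    have DN d (f : LT) : ldeg d f -> ldeg d (D f) by exact: ldeg_gmap.
    have DDN d (f : LT) : ldeg d f -> ldeg d (D (D f)) by move=> /DN/DN.
    apply: F; rewrite !mulr_natl; apply: ldegD; first apply: ldegD.
    - apply: ldegMn; apply: ldegD; last by rewrite -[N]add0r; apply: ldegM => //; exact: DDN.
      by rewrite -[N]addr0; apply: ldegM => //; exact: DDN.
    - apply: ldegN; rewrite -[N]addr0; apply: ldegM; first exact: DN.
      by apply: ldegD; exact: DN.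
    - apply: ldegMn; rewrite -[N]add0r; apply: ldegM; first exact: ldegA.
      by rewrite -[N]addr0; apply: ldegM => //; exact: ldegD.
  by apply; rewrite ltrDl.
have bb0 : ldeg 0 (b + b') by exact: ldegD.
have bb2 : (b + b') 0 = 2%:R by rewrite gcoefD b1 b'1.
move: sN; rewrite gcoefnM lamME addrK.
have := ldegM_top egt bb0; rewrite addr0 bb2 => -> E; case/eqP: eN; apply: gserP => m.
apply: (@mulrnS_inj _ 7); rewrite mul0rn -gcoefMn.
rewrite -[RHS]/((0 : tser C) m) -E; congr (gcoef _ m).
by move: (e N) => x; rewrite -[LHS]mulr_natl; ring.
Qed.

Section GelfandDickii.
Context (GD : nat -> tser C -> tser C).
Hypothesis GDP : gelfand_dickii GD.

Fact gd_small u : lsupports (gsupp (fun k : int =>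
  if k <= 0 then 2%:R * GD `|k|%N u else 0)).
Proof.
exists 0 => k; rewrite /gsupp /=; case: ifP => //; by rewrite eqxx.
Qed.
(** The factor 2 normalizes the leading coefficient to 1, and [rho] n becomes the part of lambda^n
    [gdser] in nonnegative powers. *)
Definition gdser u : LT := GSer (gd_small u).

Lemma gdserE u (k : nat) : gdser u (- k%:Z) = 2%:R * GD k u.
Proof. by rewrite /= oppr_le0 lez_nat leq0n abszN absz_nat. Qed.

Lemma ldeg_gdser u : ldeg 0 (gdser u).
Proof. by move=> k k0; rewrite /= leNgt k0. Qed.

Lemma gdser0 u : gdser u 0 = 1.
Proof.
have [_ G0 _ _] := GDP; rewrite -[0 in LHS]oppr0 gdserE G0 mulr_natl -[_ *+ 2]scaler_nat.
by rewrite scalerA mulfV ?scale1r// pnatr_eq0.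
Qed.

Lemma nat_neg_ind (P : int -> Prop) : (forall k, 0 < k -> P k) ->
  (forall n : nat, P (- n%:Z)) -> forall k, P k.
Proof.
move=> Pp Pn k; have [/Pp//|k0] := ltP 0 k.
by rewrite -[k]opprK -(gez0_abs (_ : 0 <= - k)) ?oppr_ge0.
Qed.

(** The recursion summed over n; the coefficient of lambda^1 expresses that R_0 is constant. *)
Lemma gdser_linear u : 4%:R * (lm * D (gdser u)) =
  D (D (D (gdser u))) + 4%:R * (u%:A * D (gdser u)) + 2%:R * ((pd 0 u)%:A * gdser u).
Proof.
have [_ G0 GS _] := GDP; have pd0 : pd 0 (0 : tser C) = 0 by exact: raddf0.
apply: gserP => k; rewrite gcoefnM gcoef_comb3 lamME !laurentAM !gcoefZ !gmap_pdE.
elim/nat_neg_ind: k => [k k0|n].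
  have [->|k1] := eqVneq k 1.
    rewrite subrr gdser0 pd1 !(ldeg_gdser u) ?pd0//.
    by rewrite !mulr0 !addr0.
  rewrite !(ldeg_gdser u) ?pd0 ?mulr0 ?addr0//; lia.
have -> : - n%:Z - 1 = - n.+1%:Z by lia.
rewrite !gdserE.
have p2 (f : tser C) : pd 0 (2%:R * f) = 2%:R * pd 0 f.
  by rewrite !mulr_natl raddfMn.
rewrite !p2 GS /=.
have s4 (f : tser C) : 4%:R * (4%:R^-1 *: f) = f.
  by rewrite mulr_natl -scaler_nat scalerA mulfV ?scale1r// pnatr_eq0.
have s2 (f : tser C) : 2%:R * (2%:R^-1 *: f) = f.
  by rewrite mulr_natl -scaler_nat scalerA mulfV ?scale1r// pnatr_eq0.
move: (s4 (pd 0 (pd 0 (pd 0 (GD n u))))) (s2 (pd 0 u * GD n u)).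
move: (4%:R^-1 *: _) (2%:R^-1 *: _) => x z <- E.
have -> : 2%:R * (pd 0 u * (2%:R * GD n u)) = 4%:R * (pd 0 u * GD n u) by ring.
by rewrite -E; ring.
Qed.

(** The factor 2 b is an integrating factor: D ([quad] u b) equals 2 b times the difference of the
    two sides of [gdser_linear]. *)
Lemma pd_quad_gdser u : D (quad u (gdser u)) = 0.
Proof.
have L := gdser_linear u; move: (gdser u) L => b L.
have Dn (n : nat) (f : LT) : D (n%:R * f) = n%:R * D f by rewrite !mulr_natl raddfMn.
have Dl (f : LT) : D (lm * f) = lm * D f by exact: gmap_lam.
have Dc (x y z w : LT) : D (4%:R * x - 2%:R * y + z - 4%:R * w) =
    4%:R * D x - 2%:R * D y + D z - 4%:R * D w.
  by rewrite gmap_pdB gmap_pdD gmap_pdB !Dn.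
have D1 : D (lm * b * b) = lm * (D b * b + b * D b) by rewrite -mulrA Dl gmap_pdM.
have D2 : D (u%:A * b * b) = (pd 0 u)%:A * b * b + u%:A * (D b * b + b * D b).
  by rewrite -mulrA gmap_pdM gmap_pdM gmap_pdA mulrA.
rewrite /quad Dc D1 D2 (gmap_pdM b) (gmap_pdM (D b)).
have -> : 4%:R * (lm * (D b * b + b * D b)) = 2%:R * b * (4%:R * (lm * D b)) by ring.
rewrite L; move: (D b) (D (D b)) (D (D (D b))) u%:A (pd 0 u)%:A => b1 b2 b3 x y.
ring.
Qed.

Lemma dpol_GD n : dpol (GD n).
Proof. by have [GDd _ _ _] := GDP; exact: differential_polynomial_dpol. Qed.

Lemma dpol_coef (F G : tser C -> LT) n :
  (forall u, ldeg 0 (F u)) -> (forall u, ldeg 0 (G u)) ->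
  (forall k : nat, dpol (fun u => F u (- k%:Z))) ->
  (forall k : nat, dpol (fun u => G u (- k%:Z))) ->
  dpol (fun u => (F u * G u) (- n%:Z)).
Proof.
move=> F0 G0 Fd Gd; rewrite (_ : (fun u => _) = fun u =>
    \sum_(i < n.+1) F u (- i%:Z) * G u (- (n - i)%:Z)); last first.
  by apply/funext => u; rewrite gcoefM_le0.
by apply: dpol_sum => i; exact: dpol_mul.
Qed.

Lemma dpol_natM (n : nat) F : dpol F -> dpol (fun u => n%:R * F u).
Proof.
move=> /(dpol_scale n%:R); congr dpol; apply/funext => u.
by rewrite scaler_nat mulr_natl.
Qed.

(** Each coefficient is a finite sum because [gdser] and its derivatives have no positive powers;
    this makes [dpol_const_of_pd] applicable coefficientwise. *)
Lemma quad_dpol k : dpol (fun u => quad u (gdser u) k).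
Proof.
have d0 : dpol (fun=> 0 : tser C).
  rewrite (_ : (fun=> 0) = fun=> 0%:A); first exact: dpol_const.
  by apply/funext => u; rewrite scale0r.
have bd (i : nat) : dpol (fun u => gdser u (- i%:Z)).
  rewrite (_ : (fun u => _) = fun u => 2%:R * GD i u).
    exact/dpol_natM/dpol_GD.
  by apply/funext => u; rewrite gdserE.
have Db u : ldeg 0 (D (gdser u)) by exact/ldeg_gmap/ldeg_gdser.
have DDb u : ldeg 0 (D (D (gdser u))) by exact/ldeg_gmap.
have bb i : dpol (fun u => (gdser u * gdser u) (- i%:Z)).
  by apply: dpol_coef => // u; exact: ldeg_gdser.
have Ad u : ldeg 0 (u%:A : LT) by exact: ldegA.
have lt1 : ldeg 1 (lm) by move=> l l1; rewrite -[lm]expr1 lamXE gt_eqF.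
have quadE u : quad u (gdser u) k = 4%:R * (gdser u * gdser u) (k - 1)
    - 2%:R * (gdser u * D (D (gdser u))) k + (D (gdser u) * D (gdser u)) k
    - 4%:R * (u%:A * (gdser u * gdser u)) k.
  by rewrite /quad gcoef_comb4 -!mulrA lamME.
rewrite (funext quadE).
have [k2|k1] := ltP 1 k.
  rewrite (_ : (fun u => _) = fun=> 0)//; apply/funext => u; rewrite -quadE.
  have E : ldeg 1 (quad u (gdser u)).
    have L0 := @ldeg_gdser u.
    have up f : ldeg 0 f -> ldeg 1 f by exact: ldeg_trans.
    rewrite /quad !mulr_natl; apply: ldegD; last first.
      apply/ldegN/ldegMn/up; rewrite -[0]addr0; apply: ldegM => //.
      by rewrite -[0]addr0; apply: ldegM.
    apply: ldegD; last by apply: up; rewrite -[0]addr0; apply: ldegM.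
    apply: ldegD.
      apply: ldegMn; rewrite -[1]addr0; apply: ldegM => //.
      by rewrite -[1]addr0; apply: ldegM.
    by apply/ldegN/ldegMn/up; rewrite -[0]addr0; apply: ldegM.
  exact: E.
have kE : k - 1 = - `|1 - k|%N%:Z by lia.
have b0 := ldeg_gdser.
have Dd (i : nat) : dpol (fun u => D (gdser u) (- i%:Z)) by exact: dpol_pd (bd i).
have DDd (i : nat) : dpol (fun u => D (D (gdser u)) (- i%:Z)) by exact: dpol_pd (Dd i).
have ud (i : nat) : dpol (fun u => (u%:A : LT) (- i%:Z)).
  case: i => [|i]; last first.
    by move: d0; congr dpol; apply/funext => u; rewrite laurentAE.
  by have := dpol_jet C 0; congr dpol; apply/funext => u; rewrite laurentAE oppr0 eqxx.
have bb0 u : ldeg 0 (gdser u * gdser u) by rewrite -[0]addr0; exact: ldegM.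
apply: dpol_add; last first.
  apply/dpol_opp/dpol_natM; have [k0|] := ltP 0 k.
    move: d0; congr dpol; apply/funext => u.
    by have := ldegM (Ad u) (bb0 u); rewrite addr0 => ->.
  move=> k0; have {kE} -> : k = - `|k|%N%:Z by lia.
  exact: dpol_coef.
apply: dpol_add; last first.
  have [k0|] := ltP 0 k.
    move: d0; congr dpol; apply/funext => u.
    by have := ldegM (Db u) (Db u); rewrite addr0 => ->.
  move=> k0; have {kE} -> : k = - `|k|%N%:Z by lia.
  exact: dpol_coef.
apply: dpol_add; first by rewrite kE; apply: dpol_natM; exact: bb.
apply/dpol_opp/dpol_natM; have [k0|] := ltP 0 k.
  move: d0; congr dpol; apply/funext => u.
  by have := ldegM (b0 u) (DDb u); rewrite addr0 => ->.
move=> k0; have {kE} -> : k = - `|k|%N%:Z by lia.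
exact: dpol_coef.
Qed.

(** Every coefficient is a differential polynomial with zero t_1-derivative, so it takes its value
    at u = 0, where the condition R_{n+1}[0] = 0 reduces [gdser] to 1. *)
Lemma quad_gdser u : quad u (gdser u) = 4%:R * lm.
Proof.
have g0 : gdser 0 = 1.
  have [_ _ _ GS0] := GDP; apply: gserP => k; rewrite gcoef1.
  elim/nat_neg_ind: k => [k k0|[|n]].
  - by rewrite ldeg_gdser// gt_eqF.
  - by rewrite oppr0 eqxx gdser0.
  - by rewrite gdserE GS0 mulr0.
apply: gserP => k.
rewrite (dpol_const_of_pd (quad_dpol k)); last first.
  by move=> w; rewrite -gmap_pdE pd_quad_gdser.
rewrite /quad g0 (_ : D 1 = 0); last by rewrite -[1]scale1r gmap_pdA pd1 scale0r.
by rewrite gmap_pd0 scale0r !mul0r !mulr0 !mulr1 subr0 addr0 subr0.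
Qed.
End GelfandDickii.
End Quadratic.

Section PolynomialLoops.
Context (A : comNzRingType).
Implicit Types p : {poly A}.

Fact pemb_small p : lsupports (gsupp (fun k : int => if 0 <= k then p`_`|k|%N else 0)).
Proof.
exists (size p)%:Z => k; rewrite /gsupp /=; case: ifP => [k0|_]; last by rewrite eqxx.
by move=> pk; rewrite leNgt; apply: contra_neqN pk => sk; rewrite nth_default//; lia.
Qed.
Definition pemb p : laurent A := GSer (pemb_small p).

Lemma pembE p (k : int) : pemb p k = if 0 <= k then p`_`|k|%N else 0.
Proof. by []. Qed.

End PolynomialLoops.

Lemma commB_self (R : pzRingType) n (x y : 'M[R]_n) :
  (x - y) *m y - y *m (x - y) = x *m y - y *m x.
Proof. by rewrite mulmxBl mulmxBr opprB addrA subrK. Qed.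

(** * Identification of the projected flows with the matrices [ell] *)

Section Lax.
Context (C : numFieldType).
Local Notation LT := (laurent (tser C)).
Local Notation D := (@gmap _ lsupports _ _ (@pd C 0)).
Local Notation lm := (lam (tser C)).

Lemma mx2E (A : Type) (a b c d : A) : ((mx2 a b c d 0 0 = a) * (mx2 a b c d 0 1 = b) *
  (mx2 a b c d 1 0 = c) * (mx2 a b c d 1 1 = d))%type.
Proof. by rewrite !mxE. Qed.

Lemma lax_coords (V : LT) (X : 'M[LT]_2) :
  gop (pdop C 0) X = mx2 (- V) 1 lm V *m X - X *m mx2 (- V) 1 lm V ->
  X 1 1 = - X 0 0 ->
  2%:R * X 0 0 = - (D (X 0 1) + 2%:R * V * X 0 1) /\
  X 1 0 = lm * X 0 1 + D (X 0 0).
Proof.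
move=> XE X11.
have DXE i j : D (X i j) = (mx2 (- V) 1 lm V *m X - X *m mx2 (- V) 1 lm V) i j.
  by rewrite -XE; apply: gserP => k; rewrite gopE.
rewrite !DXE !mxBE !mulmx2E X11 !mx2E.
move: (X 0 0) (X 0 1) (X 1 0) => a b c.
by split; ring.
Qed.

(** The Lax equation expresses a and c through b; eliminating them from the determinant condition
    leaves the quadratic equation, with V entering only through the Miura expression u. *)
Lemma lax_quad (V a b c : LT) (u : tser C) : u%:A = D V - V * V -> a * a + b * c = lm ->
  2%:R * a = - (D b + 2%:R * V * b) -> c = lm * b + D a -> quad u b = 4%:R * lm.
Proof.
move=> uE detE aE cE.
have Da : 2%:R * D a = - (D (D b) + 2%:R * (D V * b + V * D b)).
  have D2 (f : LT) : D (2%:R * f) = 2%:R * D f by rewrite !mulr_natl raddfMn.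
  have DN (f : LT) : D (- f) = - D f by exact: raddfN.
  by rewrite -D2 aE DN gmap_pdD -mulrA D2 gmap_pdM.
have lmE : 4%:R * lm = (2%:R * a) * (2%:R * a) + 4%:R * (lm * b * b) + 2%:R * b * (2%:R * D a).
  by rewrite -{1}detE cE; ring.
rewrite lmE aE Da /quad uE.
move: (D (D b)) (D b) (D V) => b2 b1 V1.
ring.
Qed.

End Lax.

Section ResolventIsEll.
Context (C : numFieldType) (GD : nat -> tser C -> tser C) (v : tser C).
Hypothesis GDP : gelfand_dickii GD.
Local Notation LT := (laurent (tser C)).
Local Notation D := (@gmap _ lsupports _ _ (@pd C 0)).
Local Notation lm := (lam (tser C)).
Context (psi : 'M[LT]_2).
Hypothesis psi1 : \det psi = 1.
Let Lam n := Ad psi (lam (tser C) ^+ n *: Jmx _).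
Hypothesis psiE : gop (pdop C 0) psi = - Pminus (Lam 0) *m psi.
Hypothesis psiv : Pplus (Ad psi (Jmx _)) = mx2 (- v%:A) 1 (lam (tser C)) v%:A.
Let u := miura v.
Let V : LT := v%:A.
Let La := Ad psi (Jmx _).

Lemma Lam_La n i j k : Lam n i j k = La i j (k - n%:Z).
Proof. by rewrite /Lam AdZ mxE lamXME. Qed.

Lemma La_trace : La 1 1 = - La 0 0.
Proof.
have : \tr La = 0.
  rewrite /La /Ad mxtrace_mulC mulmxA (det_adjK psi1).2 mul1mx.
  by rewrite /mxtrace !big_ord_recl big_ord0 !mxE addr0 addr0.
rewrite /mxtrace !big_ord_recl big_ord0 addr0 (_ : lift ord0 ord0 = 1); last exact: val_inj.
by rewrite addrC => /eqP; rewrite addr_eq0 => /eqP.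
Qed.

Lemma det2 (A : comNzRingType) (X : 'M[laurent A]_2) :
  \det X = X 0 0 * X 1 1 - X 0 1 * X 1 0.
Proof.
have := congr1 (fun Y : 'M[laurent A]_2 => Y 0 0) (mul_mx_adj X).
by rewrite mulmx2E adj2 !mxE /= mulr1n mulrN => <-.
Qed.

Lemma La_det : La 0 0 * La 0 0 + La 0 1 * La 1 0 = lm.
Proof.
have : \det La = - lm.
  rewrite /La /Ad !det_mulmx psi1 mul1r [X in _ * X](_ : _ = 1) ?mulr1; last first.
    by have := congr1 determinant (det_adjK psi1).1; rewrite det_mulmx psi1 mul1r det1.
  by rewrite det2 !JmxE !mul0r mul1r sub0r.
rewrite det2 La_trace => /(congr1 -%R); rewrite opprK => <-.
by rewrite mulrN opprD !opprK.
Qed.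

Lemma La_evolution : gop (pdop C 0) La =
  mx2 (- V) 1 lm V *m La - La *m mx2 (- V) 1 lm V.
Proof.
have E := derivation_Ad (Jmx _) (gopM (@pdopM C 0)) psi1 psiE.
have J0 : gop (pdop C 0) (Jmx _) = 0.
  apply: mxgP => i j k; rewrite gopE lamJ0E mxE gcoef0.
  by case: eqP => _; [exact: pd1|exact: raddf0].
rewrite {}E J0 /Ad mulmx0 mul0mx addr0 -/(Ad psi (Jmx _)) -/La.
have -> : Lam 0 = La by rewrite /Lam expr0 scale1r.
have UE : - Pminus La = mx2 (- V) 1 lm V - La.
  by rewrite -psiv -/La; apply/esym/eqP; rewrite subr_eq addrC -subr_eq opprK Pplus_Pminus.
by rewrite UE; exact: commB_self.
Qed.

Lemma La_coords : 2%:R * La 0 0 = - (D (La 0 1) + 2%:R * V * La 0 1) /\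
  La 1 0 = lm * La 0 1 + D (La 0 0).
Proof. by apply: lax_coords; [exact: La_evolution|exact: La_trace]. Qed.

Lemma La_quad : quad u (La 0 1) = 4%:R * lm.
Proof.
have uE : u%:A = D V - V * V :> LT.
  rewrite /V gmap_pdA /u /miura expr2 scalerBl; congr (_ - _).
  by rewrite -scalerAl mul1r scalerA.
by have [aE cE] := La_coords; have := lax_quad uE La_det aE cE.
Qed.

Lemma La01 : La 0 1 = gdser GD u.
Proof.
have E k : 0 <= prdeg 0 1 k -> La 0 1 k = (1 : LT) k.
  by move=> k0; rewrite -(mx2E (- V) 1 lm V).1.1.2 -psiv PplusE k0.
apply: (@quad_unique _ u).
- move=> k k0; rewrite E ?gcoef1 ?gt_eqF//; rewrite /prdeg /=; lia.
- exact: ldeg_gdser.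
- by rewrite E.
- exact: gdser0.
- by rewrite La_quad quad_gdser.
Qed.

Lemma coef_rho n (j : nat) : (rho GD v n)`_j = if (j <= n)%N then 2%:R * GD (n - j)%N u else 0.
Proof.
rewrite /rho mulr_natl coefMn -/u.
rewrite -(poly_def n.+1 (fun m => GD (n - m)%N u)) coef_poly ltnS.
by case: ifP; rewrite ?mul0rn// mulr_natl.
Qed.

Lemma La01_rho n (j : nat) : La 0 1 (j%:Z - n%:Z) = (rho GD v n)`_j.
Proof.
rewrite La01 coef_rho; case: leqP => jn.
  by rewrite -gdserE (_ : j%:Z - n%:Z = - (n - j)%N%:Z)//; lia.
by rewrite ldeg_gdser//; lia.
Qed.

Lemma coef_pd1_2v (p : {poly tser C}) j : (pd1_2v v p)`_j = pd 0 p`_j + 2%:R * v * p`_j.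
Proof. by rewrite coefD coefZ coef_map. Qed.

Lemma halfE (x y : tser C) : 2%:R * x = y -> x = (2%:R^-1)%:A * y.
Proof.
move=> <-; rewrite -scalerAl mul1r mulr_natl -scaler_nat scalerA mulVf ?scale1r//.
by rewrite pnatr_eq0.
Qed.

Lemma La00_coef k : La 0 0 k =
  - ((2%:R^-1)%:A * (pd 0 (La 0 1 k) + 2%:R * v * La 0 1 k)).
Proof.
have [aE _] := La_coords; apply/eqP; rewrite -eqr_oppLR; apply/eqP.
apply: halfE; rewrite mulrN -gcoefnM aE -mulrA gcoefN opprK gcoefD gcoefnM.
by rewrite laurentAM gcoefZ gmap_pdE mulrA.
Qed.

Lemma ell_coef00 n (l : nat) : (ell GD v n 0 0)`_l = La 0 0 (l%:Z - n%:Z).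
Proof. by rewrite /ell mx2E coefN coefZ coef_pd1_2v La00_coef La01_rho. Qed.

Lemma ell_coef10 n (l : nat) :
  (ell GD v n 1 0)`_l = if l is 0 then 0 else La 1 0 (l%:Z - n%:Z).
Proof.
have pd0 : pd 0 (0 : tser C) = 0 by exact: raddf0.
rewrite /ell mx2E coefB coefXM /pd1_poly coef_map /= coef_pd1_2v coefB coefZ coefC.
case: l => [|l] /=.
  (* At lambda^0 the subtracted R_n cancels the constant term of rho_n / 2, in agreement with the
     strict condition on the lower left entry of B^+. *)
  rewrite coef_rho leq0n subn0 -/u -(halfE (erefl (2%:R * GD n u))) subrr.
  by rewrite pd0 mulr0 addr0 pd0 subr0.
rewrite (La_coords).2 gcoefD lamME gmap_pdE La00_coef !La01_rho.
have -> : l.+1%:Z - n%:Z - 1 = l%:Z - n%:Z by lia.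
rewrite La01_rho raddfN; congr (_ + _); congr (- pd 0 _).
by rewrite subr0 pdM pdA mul0r add0r; ring.
Qed.

Lemma Pplus_ell n i j : Pplus (Lam n) i j = pemb (ell GD v n i j).
Proof.
apply: gserP => k; rewrite PplusE Lam_La pembE.
have [k0|k0] := ltP k 0.
  by rewrite ifF// /prdeg; elim/ord2_ind: i; elim/ord2_ind: j => /=; lia.
rewrite -[in LHS](gez0_abs k0); move: (`|k|%N) => l {k0 k}.
elim/ord2_ind: i; elim/ord2_ind: j.
- have -> : 0 <= prdeg 0 0 l%:Z by rewrite /prdeg /=; lia.
  by rewrite ell_coef00.
- have -> : 0 <= prdeg 0 1 l%:Z by rewrite /prdeg /=; lia.
  by rewrite /ell mx2E La01_rho.
- rewrite ell_coef10; case: l => [|l]; first by rewrite /prdeg /=.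
  by have -> : 0 <= prdeg 1 0 l.+1%:Z by rewrite /prdeg /=; lia.
- have -> : 0 <= prdeg 1 1 l%:Z by rewrite /prdeg /=; lia.
  by rewrite La_trace gcoefN -ell_coef00 /ell !mx2E coefN opprK.
Qed.


End ResolventIsEll.

(** * Separation and cancellation by principal degree *)

Section PrincipalDegree.
Context (A : comNzRingType).
Implicit Types X Y Z : 'M[laurent A]_2.

Lemma dle_eq0 X : (forall n : nat, dle (- n%:Z) X) -> X = 0.
Proof.
move=> Xd; apply: mxgP => i j k; rewrite mxE gcoef0.
by apply: (Xd `|prdeg i j k|.+1); lia.
Qed.

Lemma dle_bounded X : exists d : nat, dle d%:Z X.
Proof.
have bd i j : exists N : int, forall k, N < k -> X i j k = 0.
  have [N XN] := gcoef_small (X i j); exists N => k Nk; apply/eqP.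
  by apply: contraT => /XN; rewrite leNgt Nk.
have [N00 B00] := bd 0 0; have [N01 B01] := bd 0 1.
have [N10 B10] := bd 1 0; have [N11 B11] := bd 1 1.
exists (`|N00| + `|N01| + `|N10| + `|N11|).*2.+1%N => i j k; rewrite /prdeg.
elim/ord2_ind: i; elim/ord2_ind: j => /= dk.
- by apply: B00; lia.
- by apply: B01; lia.
- by apply: B10; lia.
- by apply: B11; lia.
Qed.

(** Y = -(X - 1) Y lowers any degree bound of Y by one, indefinitely; no inverse of X enters. *)
Lemma unip_cancel X Y : unip X -> X *m Y = 0 -> Y = 0.
Proof.
move=> Xu XY; have YE : Y = - ((X - 1%:M) *m Y) by rewrite mulmxBl XY mul1mx sub0r opprK.
have [d Yd] := dle_bounded Y.
suff Yn (n : nat) : dle (d%:Z - n%:Z) Y.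
  by apply: dle_eq0 => n; apply: dle_trans (Yn (d + n)%N); lia.
elim: n => [|n IHn]; first by rewrite subr0.
rewrite YE; apply: dleN; have := dleM Xu IHn; apply: dle_trans; lia.
Qed.

Lemma cJE (c : laurent A) : (((c *: Jmx A) 0 0 = 0) * ((c *: Jmx A) 0 1 = c) *
  ((c *: Jmx A) 1 0 = (lam A * c)%R) * ((c *: Jmx A) 1 1 = 0))%type.
Proof.
have E i j : (c *: Jmx A) i j = c * Jmx A i j by rewrite mxE.
by rewrite !E !JmxE !mulr0 mulr1 mulrC.
Qed.

Lemma dle_cJ (c : laurent A) : (forall k : int, 0 <= k -> c k = 0) -> dle (-1) (c *: Jmx A).
Proof.
move=> c0 i j k; elim/ord2_ind: i; elim/ord2_ind: j; rewrite cJE ?gcoef0 ?lamME// /prdeg /= => kd.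
  by apply: c0; lia.
by apply: c0; lia.
Qed.

Lemma mulmxJC (c : laurent A) : (c *: Jmx A) *m Jmx A = Jmx A *m (c *: Jmx A).
Proof. by rewrite -scalemxAl -scalemxAr. Qed.

Lemma adjD X Y : \adj (X + Y) = \adj X + \adj Y.
Proof.
apply/matrixP => i j; rewrite !adj2; elim/ord2_ind: i; elim/ord2_ind: j;
  rewrite !mxE /= ?opprD//.
Qed.

Lemma adjN X : \adj (- X) = - \adj X.
Proof. by apply/matrixP => i j; rewrite !adj2; elim/ord2_ind: i; elim/ord2_ind: j; rewrite !mxE. Qed.

Lemma adjM X Y : \adj (X *m Y) = \adj Y *m \adj X.
Proof.
apply/matrixP => i j; rewrite mulmx2E !adj2.
elim/ord2_ind: i; elim/ord2_ind: j; rewrite !mx2E !mulmx2E; ring.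
Qed.

Lemma adj_trace0 X : X 1 1 = - X 0 0 -> \adj X = - X.
Proof.
move=> X11; apply/matrixP => i j; rewrite adj2.
by elim/ord2_ind: i; elim/ord2_ind: j; rewrite mx2E mxE // X11 opprK.
Qed.

Lemma gop_adj (D : int -> {additive A -> A}) X : gop D (\adj X) = \adj (gop D X).
Proof.
apply: mxgP => i j k; rewrite gopE !adj2.
by elim/ord2_ind: i; elim/ord2_ind: j; rewrite !mx2E ?gcoefN ?raddfN gopE /prdeg /=
  ?addrK ?subr0 ?addr0.
Qed.

End PrincipalDegree.

(** * The degree derivation *)

Section Scaling.
Context (C : numFieldType) (sigma : C).
Local Notation H := (laurent C).
Implicit Types X Y G : 'M[H]_2.

Definition dop_fun (d : int) (a : C) : C := sigma * d%:~R / 2%:R * a.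
Fact dop_is_additive d : zmod_morphism (dop_fun d).
Proof. by move=> a b; rewrite /dop_fun mulrBr. Qed.
HB.instance Definition _ d := GRing.isZmodMorphism.Build C C (dop_fun d) (dop_is_additive d).
Definition dop : int -> {additive C -> C} := fun d => dop_fun d.
Local Notation delta := (gop dop).

Lemma dopM d e a b : dop (d + e) (a * b) = dop d a * b + a * dop e b.
Proof. by rewrite /= /dop_fun rmorphD /=; ring. Qed.

Lemma deltaE X i j k : delta X i j k = sigma * (prdeg i j k)%:~R / 2%:R * X i j k.
Proof. by rewrite gopE. Qed.

Lemma deltaZ (c : C) X : delta (c%:A *: X) = c%:A *: delta X.
Proof.
apply: mxgP => i j k; rewrite deltaE [in RHS]mxE [in LHS]mxE !laurentAM !gcoefZ deltaE.
by rewrite mulrCA.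
Qed.

Fact jweight_small (a : H) : lsupports (gsupp (fun k => sigma * (k%:~R + 2%:R^-1) * a k)).
Proof.
apply: small_sub (gcoef_small a) => k; rewrite /gsupp /=.
by apply: contra_neq => ->; rewrite mulr0.
Qed.
(** lambda^k J has principal degree 2k + 1, which sigma/2 turns into sigma (k + 1/2). *)
Definition jweight (a : H) : H := GSer (jweight_small a).

Lemma delta_aJ (a : H) : delta (a *: Jmx C) = jweight a *: Jmx C.
Proof.
apply: mxgP => i j k; rewrite deltaE.
elim/ord2_ind: i; elim/ord2_ind: j; rewrite !cJE ?gcoef0 ?mulr0// ?lamME /=.
  rewrite (_ : prdeg 0 1 k = k * 2 + 1); last by rewrite /prdeg /=; lia.
  by rewrite rmorphD rmorphM /=; congr (_ * _); field.
rewrite (_ : prdeg 1 0 k = (k - 1) * 2 + 1); last by rewrite /prdeg /=; lia.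
by rewrite rmorphD rmorphM /=; congr (_ * _); field.
Qed.



End Scaling.

(** * Exponentials of loops of negative degree *)

Section Exponential.
Context (C : numFieldType).
Local Notation H := (laurent C).
Implicit Types X Y G : 'M[H]_2.

Definition expsum X (n : nat) : 'M[H]_2 := \sum_(p < n) (((p`!)%:R^-1)%:A : H) *: X ^+ p.

Lemma expsumS X n : expsum X n.+1 = expsum X n + (((n`!)%:R^-1)%:A : H) *: X ^+ n.
Proof. by rewrite /expsum big_ord_recr. Qed.

Lemma dle_expn X p : dle (-1) X -> dle (- p%:Z) (X ^+ p).
Proof.
move=> Xd; elim: p => [|p IHp]; first by rewrite oppr0 expr0; exact: dle1.
by rewrite exprS -mulmxE (_ : - p.+1%:Z = -1 - p%:Z); [exact: dleM|lia].
Qed.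

Lemma dleZ d (c : C) X : dle d X -> dle d ((c%:A : H) *: X).
Proof. by move=> Xd i j k dk; rewrite mxE laurentAM gcoefZ Xd// mulr0. Qed.

Lemma expsum_sub X m n : dle (-1) X -> (m <= n)%N -> dle (- m%:Z) (expsum X n - expsum X m).
Proof.
move=> Xd /subnKC <-; elim: (n - m)%N => [|l IHl].
  by rewrite addn0 subrr => i j k _; rewrite mxE.
rewrite addnS expsumS addrAC; apply: dleD => //; apply: dleZ.
apply: (@dle_trans _ (- (m + l)%N%:Z)); first lia.
exact: dle_expn.
Qed.

Lemma mxexpP X G : dle (-1) X -> is_mxexp X G -> forall n : nat, dle (- n%:Z) (G - expsum X n).
Proof.
move=> Xd GX n i j k nk; have [N GN] := GX i j k.
have := expsum_sub Xd (leq_maxr N n) nk; rewrite !mxgB => <-; congr (_ - _).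
by rewrite -(GN (maxn N n)) ?leq_maxl.
Qed.

(** Since X^p has degree at most -p, the coefficient in degree d is final after |d| + 1 terms, which
    gives the exponential explicitly. *)
Fact mxexp_small X i j : dle (-1) X ->
  lsupports (gsupp (fun k => expsum X `|prdeg i j k|.+1 i j k)).
Proof.
move=> Xd; exists 1 => k; rewrite /gsupp /=; apply: contra_neqT; rewrite -ltNge => k1.
have := expsum_sub Xd (leq0n `|prdeg i j k|.+1); rewrite /expsum big_ord0 subr0; apply.
by rewrite /prdeg; elim/ord2_ind: i; elim/ord2_ind: j => /=; lia.
Qed.

Lemma mxexp_exists X : dle (-1) X -> exists G, is_mxexp X G.
Proof.
move=> Xd; exists (\matrix_(i, j) GSer (mxexp_small i j Xd)) => i j k.
exists `|prdeg i j k|.+1 => n Nn; rewrite mxE /=.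
have := expsum_sub Xd Nn; move=> /(_ i j k); rewrite mxgB => E; apply/eqP.
by rewrite -subr_eq0 E//; lia.
Qed.

Lemma mxexp_unip X G : dle (-1) X -> is_mxexp X G -> unip G.
Proof.
move=> Xd /(mxexpP Xd)/(_ 1%N); rewrite /expsum big_ord1 expr0 fact0 invr1 scale1r.
by rewrite /unip scale1r.
Qed.

Lemma expsum_comm X Y n : X *m Y = Y *m X -> expsum X n *m Y = Y *m expsum X n.
Proof.
move=> XY; rewrite /expsum mulmx_suml mulmx_sumr; apply: eq_bigr => p _.
rewrite -scalemxAl -scalemxAr; congr (_ *: _).
by apply/esym/commrX; rewrite /GRing.comm -!mulmxE.
Qed.

Lemma mxexp_comm X Y G : dle (-1) X -> is_mxexp X G -> X *m Y = Y *m X ->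
  G *m Y = Y *m G.
Proof.
move=> Xd /(mxexpP Xd) GX XY; apply/eqP; rewrite -subr_eq0; apply/eqP.
have [d Yd] := dle_bounded Y; apply: dle_eq0 => n.
have -> : G *m Y - Y *m G = (G - expsum X (n + d)) *m Y - Y *m (G - expsum X (n + d)).
  rewrite mulmxBl mulmxBr opprB expsum_comm//; apply/eqP.
  by rewrite addrA subrK.
apply: dleB.
  by have := dleM (GX (n + d)%N) Yd; apply: dle_trans; lia.
by have := dleM Yd (GX (n + d)%N); apply: dle_trans; lia.
Qed.

Lemma fact_scalar n :
  (((n.+1)`!%:R^-1)%:A : H) * n.+1%:R = ((n`!)%:R^-1)%:A.
Proof.
have -> : n.+1%:R = (n.+1%:R)%:A :> H by rewrite scaler_nat.
rewrite -scalerAl mul1r scalerA; congr (_ *: _).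
by rewrite factS natrM invfM mulrAC mulVf ?mul1r// pnatr_eq0.
Qed.

(** As X commutes with its derivative Y, the derivative of the partial sum with n + 1 terms is Y
    times the one with n terms; both sides therefore agree above degree -n for every n. *)
Lemma delta_mxexp sigma X G : dle (-1) X -> is_mxexp X G ->
  X *m gop (dop sigma) X = gop (dop sigma) X *m X ->
  gop (dop sigma) G = gop (dop sigma) X *m G.
Proof.
move=> Xd /(mxexpP Xd) GX; set Y := gop _ X => XY.
have Yd : dle (-1) Y by exact: dle_gop.
have dM := gopM (@dopM _ sigma).
have dX p : gop (dop sigma) (X ^+ p.+1) = p.+1%:R *: (Y *m X ^+ p).
  elim: p => [|p IHp]; first by rewrite expr1 expr0 scale1r mulmx1.
  rewrite exprS -mulmxE dM IHp -/Y -[X in _ + X]scalemxAr mulmxA XY -mulmxA.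
  have EX : X *m X ^+ p = X ^+ p.+1 by rewrite exprS.
  have -> : p.+2%:R = 1 + p.+1%:R :> H by rewrite addrC natr1.
  by rewrite EX scalerDl scale1r.
have dE n : gop (dop sigma) (expsum X n.+1) = Y *m expsum X n.
  elim: n => [|n IHn].
    rewrite /expsum big_ord1 big_ord0 mulmx0 expr0 deltaZ.
    by rewrite (gop1 (@dopM _ sigma)) scaler0.
  rewrite expsumS gopD IHn expsumS mulmxDr deltaZ dX -scalemxAr scalerA.
  by rewrite fact_scalar.
apply/eqP; rewrite -subr_eq0; apply/eqP; apply: dle_eq0 => n.
have -> : gop (dop sigma) G - Y *m G =
    gop (dop sigma) (G - expsum X n.+1) - Y *m (G - expsum X n).
  by rewrite gopB dE mulmxBr opprB addrA subrK.
apply: dleB.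
  by apply: dle_gop; apply: dle_trans (GX n.+1); lia.
by have := dleM Yd (GX n); apply: dle_trans; lia.
Qed.


End Exponential.

(** * Spans with prescribed leading powers, and flags *)

Section GradedSpans.
Context (C : numFieldType).
Local Notation H := (laurent C).
Implicit Types (f h w : H) (B : set H).

Lemma lspan0 B : lspan B 0.
Proof.
exists 0%N, (fun=> 0), (fun=> 0); split=> [[]//|].
by rewrite big_ord0.
Qed.

Lemma lspan_gen B h : B h -> lspan B h.
Proof.
move=> Bh; exists 1%N, (fun=> 1), (fun=> h); split=> //.
by rewrite big_ord1 scale1r.
Qed.

Lemma lspan_lin B (a : C) x y : lspan B x -> lspan B y -> lspan B (a *: x + y).
Proof.
move=> [k [s [b [Bb ->]]]] [l [t [c [Bc ->]]]].
exists (k + l)%N, (fun i => match fintype.split i with inl j => a * s j | inr j => t j end).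
exists (fun i => match fintype.split i with inl j => b j | inr j => c j end); split=> [i|].
  by case: (fintype.split i).
rewrite big_split_ord scaler_sumr; congr (_ + _); apply: eq_bigr => i _.
  by rewrite (unsplitK (inl i)) scalerA.
by rewrite (unsplitK (inr i)).
Qed.

Lemma lspan_sub B W : W 0 -> (forall (a : C) x y, W x -> W y -> W (a *: x + y)) ->
  B `<=` W -> lspan B `<=` W.
Proof.
move=> W0 Wl BW _ [k [a [b [Bb ->]]]].
elim: k a b Bb => [|k IHk] a b Bb; first by rewrite big_ord0.
rewrite big_ord_recl; apply: Wl; first exact/BW/Bb.
exact: (IHk (fun i => a (lift ord0 i)) (fun i => b (lift ord0 i))).
Qed.

Lemma lspan_image (f : H -> H) B :
  (forall a x y, f (a *: x + y) = a *: f x + f y) ->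
  f @` lspan B = lspan (f @` B).
Proof.
move=> fl.
have f0 : f 0 = 0.
  have := fl (-1) 0 0; rewrite scaler0 addr0 scaleN1r => E.
  by rewrite {1}E addNr.
have fsum k (a : 'I_k -> C) (b : 'I_k -> H) :
    f (\sum_(i < k) a i *: b i) = \sum_(i < k) a i *: f (b i).
  elim: k a b => [|k IHk] a b; first by rewrite !big_ord0.
  by rewrite !big_ord_recl fl IHk.
apply/seteqP; split=> [_ [_ [k [a [b [Bb ->]]]] <-]|_ [k [a [b [Bb ->]]]]].
  exists k, a, (f \o b); split=> [i|]; first by exists (b i).
  exact: fsum.
have Bx i : exists x, B x /\ f x = b i by have [x Bx xE] := Bb i; exists x.
have [c cP] := choice Bx.
exists (\sum_(i < k) a i *: c i).
  by exists k, a, c; split=> // i; have [] := cP i.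
by rewrite fsum; apply: eq_bigr => i _; have [_ ->] := cP i.
Qed.

Section Family.
Context (b : nat -> H).
Hypotheses (b1 : forall n : nat, b n n%:Z = 1)
  (b0 : forall (n : nat) (k : int), n%:Z < k -> b n k = 0).

Lemma lspan_range h : lspan (range b) h -> exists N (c : nat -> C),
  h = \sum_(n < N) c n *: b n.
Proof.
apply: (@lspan_sub _ (fun h => exists N (c : nat -> C), h = \sum_(n < N) c n *: b n)).
- by exists 0%N, (fun=> 0); rewrite big_ord0.
- move=> a _ _ [N [c ->]] [M [d ->]].
  have wide K (e : nat -> C) L : (K <= L)%N -> \sum_(n < K) e n *: b n =
      \sum_(n < L) (if (n < K)%N then e n else 0) *: b n.
    move=> KL; rewrite (big_ord_widen L (fun n => e n *: b n) KL) big_mkcond.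
    by apply: eq_bigr => i _; case: ifP => //; rewrite scale0r.
  rewrite (wide N c _ (leq_maxl N M)) (wide M d _ (leq_maxr N M)).
  exists (maxn N M), (fun n => a * (if (n < N)%N then c n else 0) +
    (if (n < M)%N then d n else 0)).
  rewrite scaler_sumr -big_split; apply: eq_bigr => i _.
  by rewrite scalerDl scalerA.
- move=> _ [n _ <-]; exists n.+1, (fun m => (m == n)%:R).
  rewrite big_ord_recr /= eqxx scale1r big1 ?add0r// => i _.
  by rewrite ltn_eqF ?scale0r.
Qed.

Lemma graded_span_neg h : lspan (range b) h -> negative_powers h -> h = 0.
Proof.
move=> /lspan_range[N [c ->]]; elim: N => [|N IHN]; first by rewrite big_ord0.
rewrite big_ord_recr /= => neg.
have cN : c N = 0.
  have := neg N%:Z isT; rewrite gcoefD gcoef_sum big1 => [|i _].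
    by rewrite add0r gcoefZ b1 mulr1.
  by rewrite gcoefZ b0 ?mulr0// ltz_nat.
by rewrite cN scale0r addr0 in neg *; exact: IHN.
Qed.

Lemma graded_span_complement h : exists2 w, lspan (range b) w & negative_powers (h - w).
Proof.
have [M hM] : exists M : nat, forall k : int, M%:Z <= k -> h k = 0.
  have [N hN] := gcoef_small h; exists `|N|.+1 => k Nk; apply/eqP.
  apply: contraT => /hN; lia.
elim: M h hM => [|M IHM] h hM; first by exists 0; [exact: lspan0|rewrite subr0].
have [|w Ww wn] := IHM (h - h M%:Z *: b M).
  move=> k Mk; rewrite gcoefD gcoefN gcoefZ.
  have [->|kM] := eqVneq k M%:Z; first by rewrite b1 mulr1 subrr.
  by rewrite (hM k) ?(b0 (n := M)) ?mulr0 ?subr0//; lia.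
exists (h M%:Z *: b M + w); last by rewrite opprD addrA.
by apply: lspan_lin => //; apply: lspan_gen; exists M.
Qed.

(** One generator with leading term lambda^n for each n >= 0 makes the span a complement of the
    negative powers: the big cell, with zero kernel and cokernel. *)
Lemma graded_span_sato : sato_grassmannian (lspan (range b)).
Proof.
split; [exact: lspan0|by move=> *; exact: lspan_lin|].
exists 0%N, (fun=> 0), (fun=> 0); split.
- by move=> a _ [].
- move=> h; split=> [[Wh hn]|[a ->]].
    by exists (fun=> 0); rewrite big_ord0; exact: graded_span_neg.
  by rewrite big_ord0; split; [exact: lspan0|].
- by move=> a _ [].
- move=> h; exists (fun=> 0); rewrite big_ord0 subr0.
  exact: graded_span_complement.
Qed.


End Family.

Section Flag.
Context (phi tphi : H).
Hypotheses (phi1 : phi 1 = 1) (phi0 : forall k : int, 1 < k -> phi k = 0).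
Hypotheses (tphi1 : tphi 0 = 1) (tphi0 : forall k : int, 0 < k -> tphi k = 0).

(** [wbasis] and [vbasis] list the generators of W and V by leading power: phi starts at lambda and
    tphi at 1, so exactly one generator has leading power n. *)
Definition wbasis (n : nat) : H :=
  if odd n then lam C ^+ n.-1 * phi else lam C ^+ n * tphi.
Definition vbasis (n : nat) : H :=
  if n is m.+1 then if odd n then lam C ^+ n * tphi else lam C ^+ m * phi
  else lamV C * phi.

Lemma wbasis1 n : wbasis n n%:Z = 1.
Proof.
rewrite /wbasis; case: ifP => on; rewrite lamXME; last by rewrite subrr.
by rewrite (_ : n%:Z - n.-1%:Z = 1)//; case: n on => //= n; lia.
Qed.

Lemma wbasis0 n k : n%:Z < k -> wbasis n k = 0.
Proof.
move=> nk; rewrite /wbasis; case: ifP => on; rewrite lamXME ?phi0 ?tphi0//; last by lia.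
by case: n on nk => //= n; lia.
Qed.

Lemma vbasis1 n : vbasis n n%:Z = 1.
Proof.
case: n => [|n]; first by rewrite /vbasis lamVME.
rewrite /vbasis; case: ifP => _; rewrite lamXME ?subrr//.
by rewrite (_ : n.+1%:Z - n%:Z = 1)//; lia.
Qed.

Lemma vbasis0 n k : n%:Z < k -> vbasis n k = 0.
Proof.
case: n => [|n] nk; first by rewrite /vbasis lamVME phi0//; lia.
by rewrite /vbasis; case: ifP => _; rewrite lamXME ?phi0 ?tphi0//; lia.
Qed.

Lemma Wspan_graded : Wspan phi tphi = lspan (range wbasis).
Proof.
rewrite /Wspan; congr lspan; apply/seteqP; split=> [h [n [->|->]]|_ [n _ <-]] /=.
- by exists n.*2.+1 => //; rewrite /wbasis /= odd_double.
- by exists n.*2 => //; rewrite /wbasis /= odd_double.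
- exists n./2; rewrite /wbasis; case: ifP => on; [left|right].
    by rewrite -{1}(odd_double_half n) on.
  by rewrite -{1}(odd_double_half n) on.
Qed.

Lemma Vspan_graded : Vspan phi tphi = lspan (range vbasis).
Proof.
rewrite /Vspan; congr lspan; apply/seteqP; split=> [h [->|[n [->|->]]]|_ [n _ <-]] /=.
- by exists 0%N.
- by exists n.*2.+2 => //; rewrite /vbasis /= odd_double.
- by exists n.*2.+1 => //; rewrite /vbasis /= odd_double.
- case: n => [|n]; [by left|right; exists n./2].
  rewrite /vbasis /=; case: ifP => on; [right|left].
    by rewrite -{1}(odd_double_half n) (negbTE on).
  by rewrite -{1}(odd_double_half n) (negbFE on).
Qed.

Lemma flag2_span : flag2 (Vspan phi tphi) (Wspan phi tphi).
Proof.
split.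
- rewrite Vspan_graded; apply: graded_span_sato; [exact: vbasis1|exact: vbasis0].
- rewrite Wspan_graded; apply: graded_span_sato; [exact: wbasis1|exact: wbasis0].
- have lin2 a (x y : H) : lam C ^+ 2 * (a *: x + y) = a *: (lam C ^+ 2 * x) + lam C ^+ 2 * y.
    by rewrite mulrDr -scalerAr.
  have lin1 a (x y : H) : lam C * (a *: x + y) = a *: (lam C * x) + lam C * y.
    by rewrite mulrDr -scalerAr.
  rewrite (lspan_image _ lin2) (lspan_image _ lin1); apply: lspan_sub.
  + exact: lspan0.
  + by move=> *; exact: lspan_lin.
  + move=> _ [h [n [->|->]] <-]; apply: lspan_gen.
      exists (lam C ^+ n.*2.+1 * phi); first by right; exists n; left.
      by rewrite !mulrA -exprS -exprD.
    exists (lam C ^+ n.*2.+1 * tphi); first by right; exists n; right.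
    by rewrite !mulrA -exprS -exprD.
- have lin1 a (x y : H) : lam C * (a *: x + y) = a *: (lam C * x) + lam C * y.
    by rewrite mulrDr -scalerAr.
  rewrite (lspan_image _ lin1); apply: lspan_sub.
  + exact: lspan0.
  + by move=> *; exact: lspan_lin.
  + move=> _ [h [->|[n [->|->]]] <-]; apply: lspan_gen.
    * by exists 0%N; left; rewrite mulrA lamK !mul1r.
    * by exists n.+1; left; rewrite mulrA -exprS doubleS.
    * by exists n.+1; right; rewrite mulrA -exprS doubleS.
Qed.

End Flag.

(** lambda^-1 (phi - phi') lies in V and tphi - tphi' in W; equal leading terms leave only negative
    powers, and neither space contains a nonzero such series. *)
Lemma flag_generators_unique (phi tphi phi' tphi' : H) :
  phi 1 = 1 -> (forall k : int, 1 < k -> phi k = 0) ->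
  tphi 0 = 1 -> (forall k : int, 0 < k -> tphi k = 0) ->
  phi' 1 = 1 -> (forall k : int, 1 < k -> phi' k = 0) ->
  tphi' 0 = 1 -> (forall k : int, 0 < k -> tphi' k = 0) ->
  Vspan phi tphi = Vspan phi' tphi' -> Wspan phi tphi = Wspan phi' tphi' ->
  phi = phi' /\ tphi = tphi'.
Proof.
move=> a1 a0 b1 b0 a1' a0' b1' b0' VE WE.
have Vn h : Vspan phi tphi h -> negative_powers h -> h = 0.
  rewrite Vspan_graded; apply: graded_span_neg; first exact: vbasis1.
  exact: vbasis0.
have Wn h : Wspan phi tphi h -> negative_powers h -> h = 0.
  rewrite Wspan_graded; apply: graded_span_neg; first exact: wbasis1.
  exact: wbasis0.
have lB (B : set H) x y : lspan B x -> lspan B y -> lspan B (x - y).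
  by move=> Bx By; rewrite addrC -scaleN1r; exact: lspan_lin.
split; apply/eqP; rewrite -subr_eq0; apply/eqP.
  have : lamV C * (phi - phi') = 0.
    apply: Vn => [|k k0]; last first.
      rewrite lamVME gcoefD gcoefN.
      have [->|k1] := eqVneq k 0; first by rewrite add0r a1 a1' subrr.
      by rewrite a0 ?a0' ?subrr//; lia.
    rewrite mulrBr; apply: lB; first by apply: lspan_gen; left.
    by rewrite -/(Vspan phi tphi) VE; apply: lspan_gen; left.
  by move=> /(congr1 (fun h => lam C * h)); rewrite mulrA lamK mul1r mulr0.
apply: Wn => [|k k0].
  apply: lB; first by apply: lspan_gen; exists 0%N; right; rewrite expr0 mul1r.
  by rewrite -/(Wspan phi tphi) WE; apply: lspan_gen; exists 0%N; right; rewrite expr0 mul1r.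
rewrite gcoefD gcoefN; have [->|k1] := eqVneq k 0; first by rewrite b1 b1' subrr.
by rewrite b0 ?b0' ?subrr//; lia.
Qed.

End GradedSpans.

(** * Transport of loops and of the string operator by T *)

Section LoopVectors.
Context (C : numFieldType).
Local Notation H := (laurent C).
Implicit Types (Phi : 'cV[H]_2) (h f : H) (M G : 'M[H]_2).

Lemma parity_ind (P : int -> Prop) :
  (forall k, P (k * 2)) -> (forall k, P (k * 2 + 1)) -> forall k, P k.
Proof.
move=> P0 P1 k; have kE := divz_eq k 2.
have m0 : 0 <= (k %% 2)%Z by exact: modz_ge0.
have m2 : (k %% 2)%Z < 2 by exact: ltz_pmod.
have [m|m] : (k %% 2)%Z = 0 \/ (k %% 2)%Z = 1 by lia.
  by rewrite kE m addr0; exact: P0.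
by rewrite kE m; exact: P1.
Qed.

Lemma lsquare_even f k : lsquare f (k * 2) = f k.
Proof. by rewrite /= dvdz_mull// mulzK. Qed.

Lemma lsquare_odd f k : lsquare f (k * 2 + 1) = 0.
Proof.
by rewrite /= dvdzE /=; case: ifP => //; lia.
Qed.

Lemma Tmap_odd Phi k : Tmap Phi (k * 2 + 1) = Phi 0 0 k.
Proof. by rewrite gcoefD lamME lsquare_odd addr0 addrK lsquare_even. Qed.

Lemma Tmap_even Phi k : Tmap Phi (k * 2) = Phi 1 0 k.
Proof.
rewrite gcoefD lamME lsquare_even (_ : k * 2 - 1 = (k - 1) * 2 + 1); last lia.
by rewrite lsquare_odd add0r.
Qed.

Lemma Tmap_inj Phi Phi' : Tmap Phi = Tmap Phi' -> Phi = Phi'.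
Proof.
move=> E; apply/matrixP => i j; rewrite (ord1 j); apply: gserP => k.
by elim/ord2_ind: i; rewrite -?Tmap_odd -?Tmap_even E.
Qed.

Lemma Tmap_surj h : exists Phi, Tmap Phi = h.
Proof.
have S1 : lsupports (gsupp (fun k : int => h (k * 2 + 1))).
  by have [N hN] := gcoef_small h; exists `|N| => k /hN; lia.
have S0 : lsupports (gsupp (fun k : int => h (k * 2))).
  by have [N hN] := gcoef_small h; exists `|N| => k /hN; lia.
exists (\col_i (if i == 0 then GSer S1 else GSer S0)); apply: gserP => k.
by elim/parity_ind: k => k; rewrite ?Tmap_odd ?Tmap_even mxE.
Qed.

Lemma TmapD Phi Phi' : Tmap (Phi + Phi') = Tmap Phi + Tmap Phi'.
Proof.
by apply: gserP => k; rewrite gcoefD; elim/parity_ind: k => k;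
  rewrite ?Tmap_odd ?Tmap_even mxE gcoefD.
Qed.

Lemma TmapZ (c : C) Phi : Tmap (c%:A *: Phi) = c *: Tmap Phi.
Proof.
by apply: gserP => k; rewrite gcoefZ; elim/parity_ind: k => k;
  rewrite ?Tmap_odd ?Tmap_even mxE laurentAM gcoefZ.
Qed.

Lemma Tmap0 : Tmap (0 : 'cV[H]_2) = 0.
Proof. by have := TmapZ 0 0; rewrite scaler0 scale0r. Qed.

Lemma Tmap_sum I (r : seq I) (F : I -> 'cV[H]_2) :
  Tmap (\sum_(i <- r) F i) = \sum_(i <- r) Tmap (F i).
Proof. by elim/big_rec2: _ => [|i x y _ <-]; [exact: Tmap0|rewrite TmapD]. Qed.

Lemma Tmap_J Phi : Tmap (Jmx C *m Phi) = lam C * Tmap Phi.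
Proof.
have E i : (Jmx C *m Phi) i 0 = Jmx C i 0 * Phi 0 0 + Jmx C i 1 * Phi 1 0.
  rewrite mxE !big_ord_recl big_ord0 addr0.
  by rewrite (_ : lift ord0 ord0 = 1)//; exact: val_inj.
apply: gserP => k; rewrite lamME; elim/parity_ind: k => k.
  rewrite Tmap_even E !JmxE mul0r addr0 lamME (_ : k * 2 - 1 = (k - 1) * 2 + 1); last lia.
  by rewrite Tmap_odd.
by rewrite Tmap_odd E !JmxE mul0r add0r mul1r addrK Tmap_even.
Qed.

Lemma Tmap_lamX n Phi : Tmap (lam C ^+ n *: Phi) = lam C ^+ n.*2 * Tmap Phi.
Proof.
apply: gserP => k; rewrite lamXME; elim/parity_ind: k => k.
  rewrite Tmap_even mxE lamXME (_ : k * 2 - n.*2%:Z = (k - n%:Z) * 2) ?Tmap_even//; lia.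
rewrite Tmap_odd mxE lamXME (_ : k * 2 + 1 - n.*2%:Z = (k - n%:Z) * 2 + 1) ?Tmap_odd//.
lia.
Qed.

Lemma pemb_sum (p : {poly C}) : pemb p = \sum_(m < size p) (p`_m)%:A * lam C ^+ m.
Proof.
apply: gserP => k; rewrite pembE gcoef_sum.
under eq_bigr do rewrite laurentAM gcoefZ lamXE.
case: ifP => k0; last first.
  by rewrite big1// => i _; rewrite (_ : _ == _ = false) ?mulr0//; apply/eqP; lia.
have [kp|kp] := ltnP `|k|%N (size p); last first.
  rewrite nth_default// big1// => i _; rewrite (_ : _ == _ = false) ?mulr0//.
  by apply/eqP => kE; move: kp (ltn_ord i); rewrite kE /=; lia.
rewrite (bigD1 (Ordinal kp))//= gez0_abs// eqxx mulr1 big1 ?addr0// => i ik.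
rewrite (_ : _ == _ = false) ?mulr0//; apply/eqP => kE; case/eqP: ik.
by apply: val_inj; rewrite /= kE.
Qed.

Lemma Tmap_pemb p Phi : Tmap (pemb p *: Phi) = at_square p * Tmap Phi.
Proof.
rewrite pemb_sum scaler_suml Tmap_sum /at_square.
rewrite -[map_poly _ p]/(map_poly (in_alg H) p) horner_coef size_map_poly mulr_suml.
apply: eq_bigr => m _; rewrite -scalerA TmapZ Tmap_lamX coef_map /=.
by rewrite -exprM mul2n -mulrA laurentAM.
Qed.


Lemma col_mul M G i : col i (G *m M) = G *m col i M.
Proof. by apply/matrixP => a b; rewrite !mxE; apply: eq_bigr => l _; rewrite !mxE. Qed.

Lemma col_mulr M G i : col i (M *m G) = \sum_(j < 2) G j i *: col j M.
Proof.
apply/matrixP => a b; rewrite !mxE summxE; apply: eq_bigr => l _.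
by rewrite !mxE mulrC.
Qed.

Section Action.
Context (G : 'M[H]_2).
Hypothesis GJ : G *m Jmx C = Jmx C *m G.

(** Bijectivity of T makes the action the image under one linear map, and commutation with J makes
    this map commute with lambda; spans then go to spans generator by generator. *)
Lemma loop_act_ex : exists f : H -> H,
  [/\ forall Phi, f (Tmap Phi) = Tmap (G *m Phi),
      forall a x y, f (a *: x + y) = a *: f x + f y,
      forall x, f (lam C * x) = lam C * f x
    & forall V, loop_act G V = f @` V].
Proof.
have [T' TK] := choice Tmap_surj.
pose f h := Tmap (G *m T' h).
have fT Phi : f (Tmap Phi) = Tmap (G *m Phi).
  by rewrite /f; congr (Tmap (_ *m _)); apply: Tmap_inj; rewrite TK.
exists f; split=> // [a x y|x|V].
- rewrite -(TK x) -(TK y) -TmapZ -TmapD !fT.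
  by rewrite mulmxDr -scalemxAr TmapD TmapZ.
- by rewrite -(TK x) -Tmap_J !fT mulmxA GJ -mulmxA Tmap_J.
- apply/seteqP; split=> [_ [Phi VPhi <-]|_ [h Vh <-]].
    by exists (Tmap Phi).
  by exists (T' h); rewrite /= ?TK.
Qed.

Lemma loop_act_spans (Phi Psi : 'cV[H]_2) :
  loop_act G (Vspan (Tmap Phi) (Tmap Psi)) = Vspan (Tmap (G *m Phi)) (Tmap (G *m Psi)) /\
  loop_act G (Wspan (Tmap Phi) (Tmap Psi)) = Wspan (Tmap (G *m Phi)) (Tmap (G *m Psi)).
Proof.
have [f [fT fl fJ fV]] := loop_act_ex.
have fX n x : f (lam C ^+ n * x) = lam C ^+ n * f x.
  elim: n => [|n IHn]; first by rewrite !mul1r.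
  by rewrite exprS -!mulrA fJ IHn.
have fV' x : f (lamV C * x) = lamV C * f x.
  have E : lam C * f (lamV C * x) = f x by rewrite -fJ mulrA lamK mul1r.
  by rewrite -E mulrA (mulrC (lamV C) (lam C)) lamK mul1r.
split; rewrite fV (lspan_image _ fl) -!fT; congr lspan; apply/seteqP; split.
- move=> _ [h [->|[n [->|->]]] <-]; rewrite ?fV' ?fX; first by left.
    by right; exists n; left.
  by right; exists n; right.
- move=> h [->|[n [->|->]]]; rewrite -?fV' -?fX.
  + by exists (lamV C * Tmap Phi) => //; left.
  + by exists (lam C ^+ n.*2.+1 * Tmap Phi) => //; right; exists n; left.
  + by exists (lam C ^+ n.*2.+1 * Tmap Psi) => //; right; exists n; right.
- move=> _ [h [n [->|->]] <-]; rewrite ?fX; exists n; first by left.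
  by right.
- move=> h [n [->|->]]; rewrite -?fX.
  + by exists (lam C ^+ n.*2 * Tmap Phi) => //; exists n; left.
  + by exists (lam C ^+ n.*2 * Tmap Psi) => //; exists n; right.
Qed.

End Action.

Lemma unip_Tmap M : unip M <->
  (Tmap (col 0 M) 1 = 1 /\ forall k : int, 1 < k -> Tmap (col 0 M) k = 0) /\
  (Tmap (col 1 M) 0 = 1 /\ forall k : int, 0 < k -> Tmap (col 1 M) k = 0).
Proof.
have one (i j : 'I_2) k : (1%:M : 'M[H]_2) i j k = ((i == j) && (k == 0))%:R.
  rewrite mxE; case: (i == j); rewrite ?mulr1n ?mulr0n ?gcoef0// gcoef1.
  by case: (k == 0).
have T1 i : Tmap (col i M) 1 = M 0 i 0 by rewrite -[1]/(0 * 2 + 1 : int) Tmap_odd mxE.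
have T0 i : Tmap (col i M) 0 = M 1 i 0 by rewrite -[0 in LHS]/(0 * 2 : int) Tmap_even mxE.
split=> [Mu|[[a1 a0] [b1 b0]]].
  have ME i j k : 0 <= prdeg i j k -> M i j k = ((i == j) && (k == 0))%:R.
    by move=> d; apply/eqP; rewrite -one -subr_eq0 -mxgB Mu//; lia.
  have Z i j k : 0 < prdeg i j k -> M i j k = 0.
    move=> d; rewrite ME ?ltW//; move: d; rewrite /prdeg.
    by elim/ord2_ind: i; elim/ord2_ind: j => //= d; rewrite (_ : _ == _ = false)//;
       apply/eqP; lia.
  split; split.
  - by rewrite T1 ME.
  - by elim/parity_ind => k k0; rewrite ?Tmap_odd ?Tmap_even mxE Z// /prdeg /=; lia.
  - by rewrite T0 ME.
  - by elim/parity_ind => k k0; rewrite ?Tmap_odd ?Tmap_even mxE Z// /prdeg /=; lia.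
move=> i j k; rewrite mxgB one /prdeg; elim/ord2_ind: i; elim/ord2_ind: j => /= d.
- have [->|k0] := eqVneq k 0; first by rewrite -T1 a1 subrr.
  have := a0 (k * 2 + 1); rewrite Tmap_odd mxE => -> //; first by rewrite subrr.
  by lia.
- by have := b0 (k * 2 + 1); rewrite Tmap_odd mxE => -> //; [rewrite subrr|lia].
- by have := a0 (k * 2); rewrite Tmap_even mxE => -> //; [rewrite subrr|lia].
- have [->|k0] := eqVneq k 0; first by rewrite -T0 b1 subrr.
  have := b0 (k * 2); rewrite Tmap_even mxE => -> //; first by rewrite subrr.
  by lia.
Qed.

Section StringOperator.
Context (sigma : C) (theta : {poly C}) (GD : nat -> tser C -> tser C) (v : tser C).

(* The string operator transported by T: column i of M stands for phi or tphi. *)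
Definition Bmx : 'M[H]_2 := \matrix_(i, j)
  \sum_(n < size theta) (theta`_n)%:A * pemb (map_poly (@ev0 C) (ell GD v n i j)).

Definition string_mx M : 'M[H]_2 :=
  gop (dop sigma) M - (pemb theta *: Jmx C) *m M + M *m Bmx.

(** The entry of M at (i, j, k) contributes to column j the power 2k + 1 - i of lambda. Applying
    lambda d/dlambda and subtracting 1 on phi, 0 on tphi, gives 2k + j - i: the shift (1 + H)/2
    produces exactly the principal degree. *)
Lemma string_operatorE M i : string_operator sigma theta GD v
    (\col_i (if i == 0 then Tmap (col 0 M) else Tmap (col 1 M))) i 0
  = Tmap (col i (string_mx M)).
Proof.
set Y := \col_i _; have YE j : Y j 0 = Tmap (col j M).
  by rewrite mxE; elim/ord2_ind: j.
have lu : ((1%:M + Hmx C) *m Y) i 0 = (if i == 0 then 2%:R else 0) * Tmap (col i M).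
  rewrite mxE !big_ord_recl big_ord0 addr0 (_ : lift ord0 ord0 = 1); last exact: val_inj.
  rewrite !YE !mxE; elim/ord2_ind: i => /=; rewrite ?mulr1n ?mulr0n; ring.
rewrite /string_operator.
have colD M1 M2 : Tmap (col i (M1 + M2)) = Tmap (col i M1) + Tmap (col i M2).
  by rewrite -TmapD; congr Tmap; apply/matrixP => a b; rewrite !mxE.
have colN M1 : Tmap (col i (- M1)) = - Tmap (col i M1).
  rewrite -[RHS]scaleN1r -TmapZ; congr Tmap; apply/matrixP => a b; rewrite !mxE.
  by rewrite scaleN1r mulNr mul1r.
have scE (c : H) (Z : 'cV[H]_2) : (c *: Z) i 0 = c * Z i 0 by rewrite mxE.
have i01 : i = 0 \/ i = 1 by elim/ord2_ind: (i); [left|right].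
have subE (Z Z' : 'cV[H]_2) : (Z - Z') i 0 = Z i 0 - Z' i 0 by rewrite !mxE.
have colE2 a k : col i M a 0 k = M a i k by rewrite mxE.
have colE3 a k : col i (gop (dop sigma) M) a 0 k = gop (dop sigma) M a i k by rewrite mxE.
rewrite /string_mx !colD colN mxE [X in X + _]mxE; congr (_ + _ + _).
- rewrite scE subE scE lu [map_mx _ _ _ _]mxE YE.
  apply: gserP => k; rewrite laurentAM gcoefZ gcoefD gcoefN laurentAM gcoefZ.
  have -> : ((if i == 0 then 2%:R else 0) * Tmap (col i M)) k =
      (if i == 0 then 2%:R else 0) * Tmap (col i M) k.
    by case: ifP => _; [rewrite gcoefnM|rewrite !mul0r].
  rewrite -[leuler _ _]/(Tmap (col i M) k *~ k) -mulrzr.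
  elim/parity_ind: k => k; rewrite ?Tmap_odd ?Tmap_even colE2 colE3 deltaE.
    case: i01 => -> /=.
      rewrite (_ : prdeg 1 0 k = k * 2 - 1); last by rewrite /prdeg /=; lia.
      by rewrite rmorphB rmorphM /=; field.
    rewrite (_ : prdeg 1 1 k = k * 2); last by rewrite /prdeg /=; lia.
    by rewrite rmorphM /=; field.
  case: i01 => -> /=.
    rewrite (_ : prdeg 0 0 k = k * 2); last by rewrite /prdeg /=; lia.
    by rewrite rmorphD rmorphM /=; field.
  rewrite (_ : prdeg 0 1 k = k * 2 + 1); last by rewrite /prdeg /=; lia.
  by rewrite rmorphD rmorphM /=; field.
- rewrite mxE scE YE col_mul -scalemxAl Tmap_pemb Tmap_J; congr (- _).
  by rewrite mulrCA mulrA.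
- rewrite summxE col_mulr Tmap_sum.
  have E n : ((theta`_n)%:A *: ((map_mx (fun p => at_square (map_poly (@ev0 C) p))
      (ell GD v n))^T *m Y)) i 0 = \sum_(j < 2) (theta`_n)%:A *
      (at_square (map_poly (@ev0 C) (ell GD v n j i)) * Tmap (col j M)).
    by rewrite scE mxE mulr_sumr; apply: eq_bigr => j _; rewrite mxE mxE YE.
  under eq_bigr do rewrite E.
  rewrite exchange_big; apply: eq_bigr => j _ /=.
  rewrite mxE scaler_suml Tmap_sum; apply: eq_bigr => n _.
  by rewrite -scalerA TmapZ Tmap_pemb laurentAM.
Qed.

Lemma string_solutionP phi tphi : string_solution sigma theta GD v phi tphi <->
  exists M, [/\ unip M, string_mx M = 0, phi = Tmap (col 0 M) & tphi = Tmap (col 1 M)].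
Proof.
split=> [[S A0 A1]|[M [Mu SM -> ->]]].
  have [Phi PhiE] := Tmap_surj phi; have [Psi PsiE] := Tmap_surj tphi.
  pose M : 'M[H]_2 := \matrix_(i, j) (if j == 0 then Phi i 0 else Psi i 0).
  have M0 : Tmap (col 0 M) = phi.
    by rewrite -PhiE; congr Tmap; apply/matrixP => a b; rewrite !mxE (ord1 b).
  have M1 : Tmap (col 1 M) = tphi.
    by rewrite -PsiE; congr Tmap; apply/matrixP => a b; rewrite !mxE (ord1 b).
  exists M; split=> //; first by apply/unip_Tmap; rewrite M0 M1.
  have Z i : col i (string_mx M) = 0.
    by apply: Tmap_inj; rewrite -string_operatorE M0 M1 S mxE Tmap0.
  apply/matrixP => a b; have := congr1 (fun X : 'cV[H]_2 => X a 0) (Z b).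
  by rewrite mxE [RHS]mxE => ->; rewrite mxE.
have /unip_Tmap[A0 A1] := Mu; split=> //.
apply/matrixP => i j; rewrite (ord1 j) string_operatorE SM [RHS]mxE.
rewrite -Tmap0; congr Tmap; by apply/matrixP => a b; rewrite !mxE.
Qed.


End StringOperator.
End LoopVectors.

Lemma comm_combine (R : pzRingType) n (a b x y : 'M[R]_n) :
  (a *m x - x *m b) *m y + x *m (- (y *m a) + b *m y) = a *m (x *m y) - x *m y *m a.
Proof.
by rewrite mulmxBl mulmxDr mulmxN !mulmxA addrA [_ - _ - _]addrAC subrK.
Qed.

(** * The string equation: change under Gamma_- and uniqueness *)

Section LoopAlgebra.
Context (C : numFieldType).
Local Notation H := (laurent C).
Implicit Types (f h : H) (X Y M G : 'M[H]_2).

Lemma laurent_mulf_eq0 f h : f * h = 0 -> f = 0 \/ h = 0.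
Proof.
move=> fh; have [->|/laurent_top[N [fN fgt]]] := eqVneq f 0; first by left.
have [->|/laurent_top[M [hM hgt]]] := eqVneq h 0; first by right.
have := ldegM_top fgt hgt; rewrite fh gcoef0 => /esym/eqP.
by rewrite mulf_eq0 (negbTE fN) (negbTE hM).
Qed.

Lemma laurent_double_eq0 f : f + f = 0 -> f = 0.
Proof.
move=> ff; apply: gserP => k; apply: (@mulrnS_inj _ 1).
by rewrite mul0rn -[RHS]/((0 : H) k) -ff gcoefD mulr2n.
Qed.

Lemma trace2 X : \tr X = X 0 0 + X 1 1.
Proof.
rewrite /mxtrace !big_ord_recl big_ord0 addr0.
by rewrite (_ : lift ord0 ord0 = 1)//; exact: val_inj.
Qed.

Lemma trace_adjC X Y : \tr (X *m \adj Y) = \tr (Y *m \adj X).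
Proof.
have E (Z W : 'M[H]_2) : \tr (Z *m \adj W) =
    Z 0 0 * W 1 1 - Z 0 1 * W 1 0 + (- (Z 1 0 * W 0 1) + Z 1 1 * W 0 0).
  by rewrite trace2 !mulmx2E adj2 !mx2E !mulrN.
rewrite !E; move: (X 0 0) (X 0 1) (X 1 0) (X 1 1) (Y 0 0) (Y 0 1) (Y 1 0) (Y 1 1).
by move=> a b c d a' b' c' d'; ring.
Qed.

(** The logarithmic derivative of the determinant: differentiating X adj X = 1 yields two terms of
    equal trace. *)
Lemma trace_delta_adj sigma X : \det X = 1 -> \tr (gop (dop sigma) X *m \adj X) = 0.
Proof.
move=> /det_adjK[XK _]; have := congr1 (gop (dop sigma)) XK.
rewrite (gopM (@dopM _ sigma)) (gop1 (@dopM _ sigma)) gop_adj.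
move: (gop (dop sigma) X : 'M[H]_2) => Y /(congr1 mxtrace); rewrite mxtraceD mxtrace0.
rewrite trace_adjC.
exact: laurent_double_eq0.
Qed.

Lemma unip_top X : unip X -> ldeg 0 (\det X) /\ (\det X : H) 0 = 1.
Proof.
move=> Xu.
have XE i j k : 0 <= prdeg i j k -> X i j k = (1%:M : 'M[H]_2) i j k.
  by move=> d; apply/eqP; rewrite -subr_eq0 -mxgB Xu//; lia.
have X0 i j : ldeg 0 (X i j).
  move=> k k0; rewrite XE; last by rewrite /prdeg; elim/ord2_ind: i; elim/ord2_ind: j => /=; lia.
  by rewrite mxE; case: (i == j); rewrite ?mulr1n ?mulr0n ?gcoef0// gcoef1 gt_eqF.
have XX i j i' j' : ldeg 0 (X i j * X i' j') by rewrite -[0]addr0; apply: ldegM.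
rewrite det2; split; first by apply: ldegD => //; exact: ldegN.
have top i j i' j' : (X i j * X i' j') 0 = X i j 0 * X i' j' 0.
  by have := ldegM_top (X0 i j) (X0 i' j'); rewrite addr0.
rewrite gcoefD gcoefN !top (XE 0 0)// (XE 1 1)// (XE 0 1)// ![(1%:M : 'M[H]_2) _ _]mxE /=.
by rewrite mul0r subr0 mulr1.
Qed.

Definition tlift (f : H) : laurent (tser C) := gmap (in_alg (tser C)) f.

Lemma evm_tlift f : gmap (@ev0 C) (tlift f) = f.
Proof. by apply: gserP => k; rewrite -[LHS]/(ev0 ((f k)%:A)) ev0A. Qed.

Lemma evm_tliftJ f : evm (tlift f *: Jmx _) = f *: Jmx C.
Proof.
apply/matrixP => i j; rewrite [LHS]mxE.
elim/ord2_ind: i; elim/ord2_ind: j; rewrite !cJE.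
- exact: raddf0.
- exact: evm_tlift.
- by rewrite rmorphM; congr (_ * _); [exact: evm_lam|exact: evm_tlift].
- exact: raddf0.
Qed.

Lemma pd_tliftJ n f : gop (pdop C n) (tlift f *: Jmx _) = 0.
Proof.
have pd0 : pd n (0 : tser C) = 0 by exact: raddf0.
apply: mxgP => i j k; rewrite gopE [in RHS]mxE gcoef0 /= /pdop.
elim/ord2_ind: i; elim/ord2_ind: j; rewrite cJE ?gcoef0 ?lamME ?pd0//;
  exact: pdA.
Qed.

Lemma dle_tliftJ f : negative_powers f -> dle (-1) (tlift f *: Jmx _).
Proof.
move=> fn; apply: dle_cJ => k k0; rewrite -[LHS]/((f k)%:A) fn//.
exact: scale0r.
Qed.

Lemma evm_xop sigma (theta : {poly C}) (X : 'M[laurent (tser C)]_2) :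
  evm (gop (xop sigma theta) X) =
  \sum_(n < size theta) (theta`_n)%:A *: evm (gop (pdop C n) X) - gop (dop sigma) (evm X).
Proof.
have ev0B a b : ev0 (a - b) = ev0 a - ev0 b :> C by [].
apply: mxgP => i j k; rewrite mxgB evmE gopE deltaE evmE.
rewrite -[xop _ _ _ _]/(xop_fun sigma theta (prdeg i j k) (X i j k)) /xop_fun ev0B.
rewrite ev0_vfield ev0Z summxE gcoef_sum; congr (_ - _); apply: eq_bigr => n _.
by rewrite mxE laurentAM gcoefZ evmE gopE.
Qed.

Lemma evm_pemb (p : {poly tser C}) : gmap (@ev0 C) (pemb p) = pemb (map_poly (@ev0 C) p).
Proof.
apply: gserP => k; rewrite -[LHS]/(ev0 (pemb p k)) !pembE coef_map.
by case: ifP => // _; exact: raddf0.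
Qed.

Lemma pemb_J (theta : {poly C}) : pemb theta *: Jmx C =
  \sum_(n < size theta) (theta`_n)%:A *: (lam C ^+ n *: Jmx C).
Proof.
by rewrite pemb_sum scaler_suml; apply: eq_bigr => n _; rewrite scalerA.
Qed.

Lemma Bmx_trace0 (theta : {poly C}) GD v : Bmx theta GD v 1 1 = - Bmx theta GD v 0 0.
Proof.
rewrite !mxE -sumrN; apply: eq_bigr => n _; rewrite -mulrN; congr (_ * _).
have -> : ell GD v n 1 1 = - ell GD v n 0 0 by rewrite /ell !mx2E opprK.
apply: gserP => k; rewrite gcoefN !pembE !coef_map coefN raddfN.
by case: ifP; rewrite ?oppr0.
Qed.

(* The two equations are incompatible with the leading powers of lambda in d, e. *)
Lemma skew_flow_eq0 (sigma : C) (q d e : H) : sigma != 0 ->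
  (forall k : int, k < 0 -> q k = 0) -> d 0 = 0 ->
  (forall k, sigma * k%:~R * d k = 2%:R * (q * e) k) ->
  (forall k, sigma * (k%:~R - 2%:R^-1) * e k = 2%:R * (lam C * (q * d)) k) ->
  d = 0 /\ e = 0.
Proof.
move=> s0 q0 d0 dE eE.
have two : 2%:R != 0 :> C by rewrite pnatr_eq0.
have half (k : int) : k%:~R - 2%:R^-1 != 0 :> C.
  rewrite subr_eq0; apply/eqP => kE.
  have : (k * 2)%:~R = 1%:~R :> C by rewrite intrM kE mulVf.
  by move=> /intr_inj; lia.
have [q00|/laurent_top[P [qP qgt]]] := eqVneq q 0.
  split; apply: gserP => k; apply/eqP; rewrite gcoef0.
    have [->|k0] := eqVneq k 0; first by rewrite d0.
    move/eqP: (dE k); rewrite q00 mul0r gcoef0 mulr0 mulf_eq0 mulf_eq0 (negbTE s0).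
    by rewrite intr_eq0 (negbTE k0).
  move/eqP: (eE k); rewrite q00 mul0r mulr0 gcoef0 mulr0 mulf_eq0 mulf_eq0 (negbTE s0).
  by rewrite (negbTE (half k)).
have P0 : 0 <= P by rewrite leNgt; apply: contra_neqN qP => /q0.
have qe_top (M : int) : e M != 0 -> (forall k, M < k -> e k = 0) -> d (P + M) != 0.
  move=> eM egt; apply: contra_neq eM => dPM.
  have := dE (P + M); rewrite dPM mulr0 (ldegM_top qgt egt) => /esym/eqP.
  by rewrite !mulf_eq0 (negbTE two) (negbTE qP) => /eqP.
have d00 : d = 0.
  apply/eqP; apply: contraT => /laurent_top[N [dN dgt]].
  have eN : e (P + N + 1) != 0.
    apply: contra_neq dN => eN; have := eE (P + N + 1).
    rewrite eN mulr0 lamME addrK (ldegM_top qgt dgt) => /esym/eqP.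
    by rewrite !mulf_eq0 (negbTE two) (negbTE qP) => /eqP.
  have /laurent_top[M [eM egt]] : e != 0.
    by apply: contra_neq eN => ->; rewrite gcoef0.
  have MN : P + N + 1 <= M by rewrite leNgt; apply: contra_neqN eN => /egt.
  by have := qe_top M eM egt; rewrite dgt ?eqxx//; lia.
split=> //; apply/eqP; apply: contraT => /laurent_top[M [eM egt]].
by have := qe_top M eM egt; rewrite d00 gcoef0 eqxx.
Qed.

Lemma cJ_commutator (q : H) X : let Z := (q *: Jmx C) *m X - X *m (q *: Jmx C) in
  [/\ Z 0 0 = q * (X 1 0 - lam C * X 0 1), Z 1 1 = - (q * (X 1 0 - lam C * X 0 1)),
      Z 0 1 = - (q * (X 0 0 - X 1 1)) & Z 1 0 = lam C * (q * (X 0 0 - X 1 1))].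
Proof.
move=> Z; rewrite /Z !mxBE !mulmx2E !cJE; move: (X 0 0) (X 0 1) (X 1 0) (X 1 1) => a b c d.
by split; ring.
Qed.

Section String.
Context (sigma : C) (theta : {poly C}) (GD : nat -> tser C -> tser C) (v : tser C).
Local Notation S := (string_mx sigma theta GD v).
Local Notation B := (Bmx theta GD v).
Local Notation A := (pemb theta *: Jmx C).
Local Notation delta := (gop (dop sigma)).

(** G commutes with theta J, and B acts from the right, so only the derivative of G contributes; it
    is the degree derivative of a J times G. *)
Lemma string_mx_exp (a : H) G X : negative_powers a -> is_mxexp (a *: Jmx C) G ->
  S (G *m X) = G *m ((jweight sigma a *: Jmx C) *m X + S X).
Proof.
move=> an GX; have ad : dle (-1) (a *: Jmx C) by exact: dle_cJ.
have cJJ (b c : H) : (b *: Jmx C) *m (c *: Jmx C) = (c *: Jmx C) *m (b *: Jmx C).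
  by rewrite -!scalemxAl -!scalemxAr !scalerA mulrC.
have GJ c : G *m (c *: Jmx C) = (c *: Jmx C) *m G by apply: (mxexp_comm ad GX); exact: cJJ.
have dG : delta G = (jweight sigma a *: Jmx C) *m G.
  by rewrite (delta_mxexp ad GX) delta_aJ.
rewrite /string_mx (gopM (@dopM _ sigma)) dG -GJ mulmxDr mulmxDr mulmxBr.
by rewrite !mulmxA -GJ !addrA.
Qed.

(** Since B is traceless, adj Y solves the dual equation, B drops out and h = X adj Y satisfies
    delta h = [theta J, h]. [skew_flow_eq0] forces h to commute with J, hence delta h = 0, and only
    degree 0 survives. *)
Lemma string_mx_det_unique X Y : unip X -> unip Y -> sigma != 0 -> S X = 0 -> S Y = 0 ->
  X *m \adj Y = 1%:M.
Proof.
move=> Xu Yu s0 SX SY; set h := X *m \adj Y.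
have hu : unip h by apply: unipM => //; exact: unip_adj.
have A11 : A 1 1 = - A 0 0 by rewrite cJE cJE oppr0.
have dE Z : S Z = 0 -> delta Z = A *m Z - Z *m B.
  by rewrite /string_mx => /eqP; rewrite addr_eq0 subr_eq addrC => /eqP.
have dh : delta h = A *m h - h *m A.
  rewrite /h (gopM (@dopM _ sigma)) gop_adj !dE// adjD adjN !adjM.
  rewrite (adj_trace0 A11) (adj_trace0 (Bmx_trace0 _ _ _)) mulmxN mulNmx opprK.
  exact: comm_combine.
have hE i j k : 0 <= prdeg i j k -> h i j k = (1%:M : 'M[H]_2) i j k.
  by move=> k0; apply/eqP; rewrite -subr_eq0 -mxgB hu//; lia.
have one (i j : 'I_2) k : (1%:M : 'M[H]_2) i j k = ((i == j) && (k == 0))%:R.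
  rewrite mxE; case: (i == j); rewrite ?mulr1n ?mulr0n ?gcoef0// gcoef1.
  by case: (k == 0).
have dhE i j k : sigma * (prdeg i j k)%:~R / 2%:R * h i j k =
    (A *m h - h *m A) i j k by rewrite -dh deltaE.
set q := pemb theta in dhE *.
pose x := h 0 0; pose y := h 0 1; pose z := h 1 0; pose w := h 1 1.
pose d := x - w; pose e := z - lam C * y.
have [R00 R11 R01 R10] := cJ_commutator q h.
have E00 k : sigma * k%:~R * x k = (q * e) k.
  rewrite -R00 -dhE (_ : prdeg 0 0 k = k * 2); last by rewrite /prdeg /=; lia.
  by rewrite rmorphM /= -/x; field.
have E11 k : sigma * k%:~R * w k = - (q * e) k.
  rewrite -gcoefN -R11 -dhE (_ : prdeg 1 1 k = k * 2); last by rewrite /prdeg /=; lia.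
  by rewrite rmorphM /= -/w; field.
have E01 k : sigma * (k%:~R + 2%:R^-1) * y k = - (q * d) k.
  rewrite -gcoefN -R01 -dhE (_ : prdeg 0 1 k = k * 2 + 1); last by rewrite /prdeg /=; lia.
  by rewrite rmorphD rmorphM /= -/y; field.
have E10 k : sigma * (k%:~R - 2%:R^-1) * z k = (lam C * (q * d)) k.
  rewrite -R10 -dhE (_ : prdeg 1 0 k = k * 2 - 1); last by rewrite /prdeg /=; lia.
  by rewrite rmorphB rmorphM /= -/z; field.
(* The shift by lambda gives y the same factor k - 1/2 as z, so the two combine into an equation for
   e. *)
have E01' k : sigma * (k%:~R - 2%:R^-1) * y (k - 1) = - (q * d) (k - 1).
  by rewrite -E01 rmorphB /=; congr (_ * _ * _); field.
have x0 : x 0 = 1 by rewrite /x hE ?one.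
have w0 : w 0 = 1 by rewrite /w hE ?one.
have [d0 e0] : d = 0 /\ e = 0.
  apply: (@skew_flow_eq0 sigma q) => //.
  - by move=> k k0; rewrite pembE leNgt k0.
  - by rewrite gcoefD gcoefN x0 w0 subrr.
  - move=> k; rewrite gcoefD gcoefN mulrBr E00 E11 opprK.
    by move: ((q * e) k) => t; ring.
  - move=> k; have -> : e k = z k - y (k - 1) by rewrite gcoefD gcoefN lamME.
    rewrite mulrBr E10 E01' opprK !lamME.
    by move: ((q * d) (k - 1)) => t; ring.
have xw : x = w by apply/eqP; rewrite -subr_eq0 -/d d0.
have zy : z = lam C * y by apply/eqP; rewrite -subr_eq0 -/e e0.
have k0 (k : int) (f : H) : k != 0 -> sigma * k%:~R * f k = 0 -> f k = 0.
  by move=> kn /eqP; rewrite !mulf_eq0 (negbTE s0) intr_eq0 (negbTE kn) => /eqP.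
have x1 : x = 1.
  apply: gserP => k; rewrite gcoef1; case: eqVneq => [->//|kn].
  by apply: k0 => //; rewrite E00 e0 mulr0 gcoef0.
have y1 : y = 0.
  apply: gserP => k; rewrite gcoef0; apply/eqP; have /eqP := E01 k.
  rewrite d0 mulr0 gcoef0 oppr0 !mulf_eq0 (negbTE s0) /= => /orP[/eqP kE|//].
  have : (k * 2)%:~R = (-1)%:~R :> C.
    rewrite intrM (_ : k%:~R = - 2%:R^-1); last first.
      by apply/eqP; rewrite -addr_eq0 kE.
    by rewrite mulNr mulVf ?pnatr_eq0// rmorphN.
  by move=> /intr_inj; lia.
apply/matrixP => i j; rewrite [RHS]mxE.
elim/ord2_ind: i; elim/ord2_ind: j => /=.
- exact: x1.
- exact: y1.
- by rewrite -/z zy y1 mulr0.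
- by rewrite -/w -xw x1.
Qed.

Lemma string_mx_unique X Y : unip X -> unip Y -> sigma != 0 -> S X = 0 -> S Y = 0 -> X = Y.
Proof.
move=> Xu Yu s0 SX SY.
have XY := string_mx_det_unique Xu Yu s0 SX SY.
(* Taking both solutions equal to Y shows that adj Y is the inverse of Y. *)
have /mulmx1C YY := string_mx_det_unique Yu Yu s0 SY SY.
by rewrite -[LHS]mulmx1 -YY mulmxA XY mul1mx.
Qed.

Lemma string_solution_unique phi tphi phi' tphi' : sigma <> 0 ->
  string_solution sigma theta GD v phi tphi ->
  string_solution sigma theta GD v phi' tphi' -> phi = phi' /\ tphi = tphi'.
Proof.
move=> /eqP s0 /string_solutionP[X [Xu SX -> ->]] /string_solutionP[Y [Yu SY -> ->]].
by rewrite (string_mx_unique Xu Yu).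
Qed.

(** * Self-similarity and the string equation for a given solution *)

Section Solution.
Hypothesis GDP : gelfand_dickii GD.
Context (g : 'M[H]_2) (psi : 'M[laurent (tser C)]_2).
Hypotheses (gS : NminusSL g) (gpsi : dressing g psi).
Hypothesis psiv : Pplus (Ad psi (Jmx _)) = mx2 (- v%:A) 1 (lam (tser C)) v%:A.

Let gu : unip g. Proof. exact: NminusSL_dle. Qed.
Let g1 : \det g = 1. Proof. by case: gS. Qed.
Let psiu : unip psi. Proof. by case: gpsi => /NminusSL_dle. Qed.
Let psi1 : \det psi = 1. Proof. by case: gpsi => -[]. Qed.
Let Qg : evm psi *m g = 1%:M. Proof. by case: gpsi. Qed.
Let gQ : g *m evm psi = 1%:M. Proof. exact: mulmx1C Qg. Qed.
Let adjQ : \adj (evm psi) = g.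
Proof.
rewrite -[LHS]mulmx1 -Qg mulmxA mul_adj_mx.
by rewrite det_map_mx psi1 rmorph1 mul1mx.
Qed.
Let adjg : \adj g = evm psi.
Proof. by rewrite -[LHS]mulmx1 -gQ mulmxA mul_adj_mx g1 mul1mx. Qed.

Let psiE n : gop (pdop C n) psi = - Pminus (Ad psi (lam _ ^+ n *: Jmx _)) *m psi.
Proof.
have [_ _ /(_ n) <-] := gpsi.
rewrite -mulmxA (det_adjK psi1).2 mulmx1.
by apply: mxgP => i j k; rewrite gopE mxE.
Qed.

Let evm_Lam n : evm (Ad psi (lam _ ^+ n *: Jmx _)) =
  evm psi *m (lam C ^+ n *: Jmx C) *m g.
Proof. by rewrite evm_Ad evm_lamJ /Ad adjQ. Qed.

Let BmxE : B = \sum_(n < size theta) (theta`_n)%:A *: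
  evm (Pplus (Ad psi (lam _ ^+ n *: Jmx _))).
Proof.
apply/matrixP => i j; rewrite mxE summxE; apply: eq_bigr => n _.
rewrite [RHS]mxE; congr (_ * _); rewrite [RHS]mxE.
rewrite (Pplus_ell GDP psi1 _ psiv) ?evm_pemb//; exact: psiE.
Qed.

Lemma evm_defect : evm (defect sigma theta psi) = evm psi *m S g.
Proof.
rewrite /defect evmM evm_adj adjQ evm_xop mulmxBl mulmx_suml.
have dQ : delta (evm psi) *m g = - (evm psi *m delta g).
  have := congr1 delta Qg.
  rewrite (gopM (@dopM _ sigma)) (gop1 (@dopM _ sigma)) => /eqP.
  by rewrite addr_eq0 => /eqP.
rewrite dQ opprK /string_mx mulmxDr mulmxBr mulmxA Qg mul1mx.
(* For each n, minus the P_- part of Lam_n is its P_+ part minus Lam_n itself; at t = 0 the former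
   sums to B and the latter to theta J conjugated by g^-1. *)
rewrite BmxE pemb_J mulmx_suml mulmx_sumr addrC addrAC -addrA -sumrB addrC.
rewrite addrC; congr (_ + _); apply: eq_bigr => n _; rewrite psiE.
set X := Ad psi _; have XE : evm X = evm psi *m (lam C ^+ n *: Jmx C) *m g by exact: evm_Lam.
have PE : evm (Pplus X) = evm X - evm (Pminus X).
  by rewrite -evmB; congr evm; rewrite -{2}(Pplus_Pminus X) addrK.
rewrite -[LHS]scalemxAl PE XE.
have -> : evm (- Pminus X *m psi) *m g = - evm (Pminus X).
  by rewrite evmM evmN -mulmxA Qg mulmx1.
move: (evm (Pminus X)) (evm psi) (lam C ^+ n *: Jmx C) => P Q Y.
rewrite scalerBr -scalemxAl -scalemxAr mulmxA addrAC subrr add0r scalerN.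
by [].
Qed.

Lemma string_given_self_similar (a : H) G M : negative_powers a ->
  is_mxexp (a *: Jmx C) G -> unip M -> S M = 0 -> G *m g = M -> self_similar sigma theta v.
Proof.
move=> an GX Mu SM GM; have ad : dle (-1) (a *: Jmx C) by exact: dle_cJ.
set c := jweight sigma a.
have cn : negative_powers (- c).
  by move=> k k0; rewrite gcoefN /= an// mulr0 oppr0.
have SgE : S g = (- c) *: Jmx C *m g.
  (* The unipotent factor G cancels, leaving S(g) = -c J g; the t-independent lift of -c J is then
     the matrix Z required below. *)
  rewrite -GM (string_mx_exp _ an GX) in SM.
  have /eqP := unip_cancel (mxexp_unip ad GX) SM.
  by rewrite addrC addr_eq0 => /eqP ->; rewrite scaleNr mulNmx.
apply: (self_similar_defect psiu psi1 psiE psiv (Z := tlift (- c) *: Jmx _)).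
- by move=> n; exact: pd_tliftJ.
- exact: dle_tliftJ.
- exact: mulmxJC.
- by rewrite evm_defect SgE evm_Ad evm_tliftJ /Ad adjQ mulmxA.
Qed.

(** Coefficientwise division by sigma (k + 1/2), which is nonzero because k is an integer. *)
Lemma jweight_surj (y : H) : sigma != 0 -> negative_powers y ->
  exists2 a : H, negative_powers a & jweight sigma a = - y.
Proof.
move=> s0 yn.
have aS : lsupports (gsupp (fun k => - y k / (sigma * (k%:~R + 2%:R^-1)))).
  apply: small_sub (gcoef_small y) => k; rewrite /gsupp /=.
  by apply: contra_neq => ->; rewrite oppr0 mul0r.
exists (GSer aS) => [k k0|]; first by rewrite /= yn// oppr0 mul0r.
apply: gserP => k; rewrite /= mulrC divfK// mulf_neq0//.
apply/eqP => /eqP; rewrite addr_eq0 => /eqP kE.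
have : (k * 2)%:~R = (-1)%:~R :> C.
  by rewrite intrM kE mulNr mulVf ?pnatr_eq0// rmorphN.
by move=> /intr_inj; lia.
Qed.

Lemma self_similar_string : self_similar sigma theta v ->
  exists2 y : H, negative_powers y & S g = (y *: Jmx C) *m g.
Proof.
move=> /(self_similar_conj psiu psi1 psiE psiv)[x [y [_ yn]]].
rewrite evm_defect /Ad adjQ => E.
have SgE : S g = (x%:M + y *: Jmx C) *m g.
  by rewrite -[LHS]mul1mx -gQ -mulmxA E -mulmxA mulmxA gQ mul1mx.
suff x0 : x = 0 by exists y => //; rewrite SgE x0 raddf0 add0r.
(* The right side is 2 x. On the left every term of S(g) g^-1 is traceless: det g = 1 settles the
   derivative, and J and B have trace 0. *)
have : \tr (S g *m evm psi) = \tr (x%:M + y *: Jmx C) by rewrite SgE -mulmxA gQ mulmx1.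
rewrite mxtraceD mxtrace_scalar [\tr (y *: _)]trace2 !cJE !addr0 mulr2n.
rewrite /string_mx mulmxDl mulmxBl !mxtraceD raddfN /=.
have [gK Kg] := det_adjK g1.
rewrite -adjg trace_delta_adj//.
have -> : \tr (A *m g *m \adj g) = 0 by rewrite -mulmxA gK mulmx1 trace2 !cJE addr0.
have -> : \tr (g *m B *m \adj g) = 0.
  by rewrite mxtrace_mulC mulmxA Kg mul1mx trace2 Bmx_trace0 subrr.
by rewrite subrr addr0 => /esym; exact: laurent_double_eq0.
Qed.

(* At sigma = 0 the two sides have determinants -lambda (theta + y)^2 and
   -lambda theta^2, with y in negative powers. *)
Lemma string_sigma0 (y : H) M : sigma = 0 -> negative_powers y ->
  S g = (y *: Jmx C) *m g -> unip M -> S M = 0 -> y = 0.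
Proof.
move=> s0 yn Sg Mu SM; set q := pemb theta in Sg SM *.
have d0 X : delta X = 0.
  by apply: mxgP => i j k; rewrite deltaE s0 !mul0r mxE.
have gB : g *m B = ((q + y) *: Jmx C) *m g.
  by move: Sg; rewrite /string_mx d0 sub0r scalerDl mulmxDl => <-; rewrite addNKr.
have MB : M *m B = (q *: Jmx C) *m M.
  by move: SM; rewrite /string_mx d0 sub0r addrC => /eqP; rewrite subr_eq0 => /eqP.
have dJ c : \det (c *: Jmx C) = - (lam C * (c * c)).
  by rewrite det2 !cJE; ring.
have detB : \det B = - (lam C * ((q + y) * (q + y))).
  by have := congr1 determinant gB; rewrite !det_mulmx g1 mul1r mulr1 dJ.
have [_ M1] := unip_top Mu.
have detB' : \det B = - (lam C * (q * q)).
  have := congr1 determinant MB; rewrite !det_mulmx dJ => /eqP.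
  rewrite [X in _ == X]mulrC -subr_eq0 -mulrBr => /eqP/laurent_mulf_eq0[M0|/eqP].
    by move: M1; rewrite M0 gcoef0 => /esym/eqP; rewrite oner_eq0.
  by rewrite subr_eq0 => /eqP.
have : lam C * (y * (q + q + y)) = 0.
  have -> : lam C * (y * (q + q + y)) = - (- (lam C * ((q + y) * (q + y)))) + - (lam C * (q * q)).
    by ring.
  by rewrite -detB -detB' addNr.
move=> /laurent_mulf_eq0[l0|/laurent_mulf_eq0[//|E]].
  have := lamK C; rewrite l0 mul0r => /esym/eqP; by rewrite oner_eq0.
apply: gserP => k; rewrite gcoef0; have [/yn//|k0] := leP 0 k.
have : (q + q + y) k = 0 by rewrite E.
rewrite !gcoefD /q pembE leNgt k0 /= !add0r => ->.
by [].
Qed.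

Lemma self_similar_given :
  sigma <> 0 \/ (exists phi tphi, string_solution sigma theta GD v phi tphi) ->
  self_similar sigma theta v ->
  given_by_string_solution sigma theta GD v
    (Vspan (Tmap (col 0 g)) (Tmap (col 1 g))) (Wspan (Tmap (col 0 g)) (Tmap (col 1 g))).
Proof.
move=> hyp /self_similar_string[y yn Sg].
(* At sigma = 0 [jweight] vanishes, so y itself must be 0; the assumed string solution guarantees
   this. *)
have [a an aE] : exists2 a : H, negative_powers a & jweight sigma a = - y.
  have [s0|s0] := eqVneq sigma 0; last exact: jweight_surj.
  case: hyp => [/(_ s0)//|[phi [tphi /string_solutionP[M [Mu SM _ _]]]]].
  exists 0; first by move=> k _; rewrite gcoef0.
  rewrite (string_sigma0 s0 yn Sg Mu SM) oppr0.
  by apply: gserP => k; rewrite /= mulr0.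
have ad : dle (-1) (a *: Jmx C) by exact: dle_cJ.
have [G GX] := mxexp_exists ad.
have GJ : G *m Jmx C = Jmx C *m G by apply: (mxexp_comm ad GX); exact: mulmxJC.
exists G, (Tmap (col 0 (G *m g))), (Tmap (col 1 (G *m g))).
have [VE WE] := loop_act_spans GJ (col 0 g) (col 1 g).
split; [by exists a| |by rewrite !col_mul|by rewrite !col_mul].
apply/string_solutionP; exists (G *m g); split=> //.
  by apply: unipM => //; exact: mxexp_unip ad GX.
by rewrite (string_mx_exp _ an GX) aE Sg scaleNr mulNmx addNr mulmx0.
Qed.

Lemma given_self_similar : given_by_string_solution sigma theta GD v
    (Vspan (Tmap (col 0 g)) (Tmap (col 1 g))) (Wspan (Tmap (col 0 g)) (Tmap (col 1 g))) ->
  self_similar sigma theta v.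
Proof.
move=> [G [phi [tphi [[a an GX] /string_solutionP[M [Mu SM -> ->]] VE WE]]]].
have ad : dle (-1) (a *: Jmx C) by exact: dle_cJ.
have GJ : G *m Jmx C = Jmx C *m G by apply: (mxexp_comm ad GX); exact: mulmxJC.
have [VE' WE'] := loop_act_spans GJ (col 0 g) (col 1 g).
rewrite VE' -!col_mul in VE; rewrite WE' -!col_mul in WE.
have Gu : unip (G *m g) by apply: unipM => //; exact: mxexp_unip ad GX.
have /unip_Tmap[[a1 a0] [b1 b0]] := Gu; have /unip_Tmap[[c1 c0] [e1 e0]] := Mu.
(* The columns of G g and of M are normalized generators of the same flag, so G g = M. *)
have [E0 E1] := flag_generators_unique a1 a0 b1 b0 c1 c0 e1 e0 VE WE.
apply: (string_given_self_similar an GX Mu SM); apply/matrixP => i j.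
have colE (X : 'M[H]_2) : X i j = col j X i 0 by rewrite mxE.
rewrite !colE; congr (fun_of_matrix _ _ _); move: E0 E1 => /Tmap_inj E0 /Tmap_inj E1.
by elim/ord2_ind: j colE.
Qed.

Lemma solution_flag2 :
  flag2 (Vspan (Tmap (col 0 g)) (Tmap (col 1 g))) (Wspan (Tmap (col 0 g)) (Tmap (col 1 g))).
Proof. by have /unip_Tmap[[a1 a0] [b1 b0]] := gu; exact: flag2_span. Qed.




End Solution.
End String.
End LoopAlgebra.

Local Open Scope complex_scope.

Theorem theorem4p1 (R : realType) (sigma : R[i]) (theta : {poly R[i]})
    (GD : nat -> tser R[i] -> tser R[i]) (v : tser R[i])
    (V W : set (laurent R[i])) :
  gelfand_dickii GD -> mkdv GD v -> corresponds v V W ->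
  [/\ flag2 V W,
      given_by_string_solution sigma theta GD v V W ->
        self_similar sigma theta v,
      (sigma <> 0 \/
         exists phi tphi, string_solution sigma theta GD v phi tphi) ->
        self_similar sigma theta v ->
        given_by_string_solution sigma theta GD v V W
    & sigma <> 0 -> forall phi tphi phi' tphi' : laurent R[i],
        string_solution sigma theta GD v phi tphi ->
        string_solution sigma theta GD v phi' tphi' ->
        phi = phi' /\ tphi = tphi'].
Proof.
move=> GDP _ [g [gS [psi [gpsi psiv]] -> ->]].
split.
- exact: (solution_flag2 gS).
- exact: (given_self_similar GDP gS gpsi psiv).
- exact: (self_similar_given GDP gS gpsi psiv).
- move=> s0 phi tphi phi' tphi' S1 S2; exact: string_solution_unique s0 S1 S2.
Qed.
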